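(* Let $2\le q<\infty$ and let $X\neq\{0\}$ be a Banach space that is uniformly convex of power type $q$ with constant $\delta>0$. Let $\{T_t\}_{t>0}$ be a symmetric diffusion semigroup on a $\sigma$-finite measure space $(\Omega,\mathcal{A},\mu)$. Then the extension of $\{T_t\}_{t>0}$ to $Y=L_q(\Omega;X)$ is analytic. More precisely, there is a universal constant $c>0$ such that $\{T_t\}_{t>0}$ extends to a bounded holomorphic semigroup $T(z)$ on $Y$ which is defined at, and satisfies $$\|T(z)\|\lesssim\frac{q}{\delta}\Bigl(1+\log\Bigl(\frac{q}{\delta}\Bigr)\Bigr)$$ for, every $z\in\mathbb{C}\setminus\{0\}$ with $|\arg(z)|\le c\,\dfrac{\delta}{q}$; and $\{t\,\partial T_t\}_{t>0}$ is a uniformly bounded family of operators on $Y$, namely $$\sup_{t>0}\|t\,\partial T_t\|\lesssim\frac{q^2}{\delta^2}\Bigl(1+\log\Bigl(\frac{q}{\delta}\Bigr)\Bigr).$$ Here the norms are operator norms on $Y$ and the implied constants are universal.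
   Context: Notation: $a\lesssim b$ means $a\le c\,b$ for a universal constant $c\in(0,\infty)$; $\partial=\partial/\partial t$. Banach spaces are over $\mathbb{C}$. $L_q(\Omega;X)$ is the usual $L_q$ space of strongly measurable functions $\Omega\to X$. Uniform convexity of power type: $(X,\|\cdot\|)$ is uniformly convex of power type $q$ with constant $\delta>0$ if $$\Bigl\|\frac{x+y}{2}\Bigr\|^q+\delta\Bigl\|\frac{x-y}{2}\Bigr\|^q\le\frac12\bigl(\|x\|^q+\|y\|^q\bigr)\qquad\text{for all }x,y\in X.$$ Symmetric diffusion semigroup: on a $\sigma$-finite measure space $(\Omega,\mathcal{A},\mu)$, a linear operator $T$ is a symmetric Markovian operator if (1) $T$ is a linear contraction on $L_p(\Omega)$ for every $1\le p\le\infty$; (2) $T$ is positivity preserving and $T1=1$; (3) $T$ is self-adjoint on $L_2(\Omega)$. A family $\{T_t\}_{t>0}$ of symmetric Markovian operators is a symmetric diffusion semigroup if moreover (4) $T_tT_s=T_{t+s}$ for all $t,s>0$ and (5) $\lim_{t\to0}T_tf=f$ in $L_2(\Omega)$ for every $f\in L_2(\Omega)$. Since each $T_t$ is positive, it has a canonical contractive extension to $L_q(\Omega;X)$, acting as $T_t\otimes I_X$ on $L_q(\Omega)\otimes X$; this extension is again denoted $T_t$. Holomorphic semigroups: for $\alpha\in[0,\pi)$, $\Sigma_\alpha=\{z\in\mathbb{C}\setminus\{0\}:|\arg z|<\alpha\}$ and $\overline{\Sigma_\alpha}=\{z:|\arg z|\le\alpha\}$ (including $0$), with argument in $(-\pi,\pi)$.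 A bounded holomorphic semigroup (of angle $\eta$) on a Banach space $Y$ is a family of bounded operators $(T(z))_{z\in\Sigma_\eta\cup\{0\}}$ with (i) $T(z_1+z_2)=T(z_1)T(z_2)$ for $z_1,z_2\in\Sigma_\eta$; (ii) $z\mapsto T(z)$ holomorphic in $\Sigma_\eta$; (iii) $T(z)x\to x$ as $z\to0$, $z\in\overline{\Sigma_{\eta'}}$, for all $x\in Y$ and $0<\eta'<\eta$; (iv) $\|T(z)\|$ bounded on $\overline{\Sigma_{\eta'}}$ for every $0<\eta'<\eta$. Here $T(z)$ extends the semigroup in the sense that $T(t)=T_t$ for $t>0$. *)

(* Defs.v *)
From HB Require Import structures.
From mathcomp Require Import all_boot all_order all_algebra.
From mathcomp Require Import complex ring_quotient.
From mathcomp Require Import all_classical all_reals all_analysis.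
From mathcomp Require Import measurable_realfun ess_sup_inf.

Set Implicit Arguments.
Unset Strict Implicit.
Unset Printing Implicit Defensive.

Import Order.TTheory GRing.Theory Num.Theory numFieldNormedType.Exports.

Local Open Scope classical_set_scope.
Local Open Scope ring_scope.
Local Open Scope complex_scope.
Local Open Scope quotient_scope.

HB.instance Definition _ (R : realType) := NormedModule.copy R[i] R[i]^o.

Section real_norm.
Context {R : realType} {X : normedModType R[i]}.
Implicit Types x y : X.

(* The norm of a normedModType over R[i] takes its values in R[i]. *)
Definition rnorm x : R := complex.Re `|x|.

Lemma rnormE x : `|x| = (rnorm x)%:C.
Proof.
rewrite /rnorm; have : 0 <= `|x| by [].
by case: `|x| => a b; rewrite lecE /= => /andP[/eqP -> _].
Qed.

Lemma rnorm_ge0 x : 0 <= rnorm x.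
Proof. by rewrite -ler0c -rnormE. Qed.

Lemma rnormD x y : rnorm (x + y) <= rnorm x + rnorm y.
Proof. by rewrite -lecR rmorphD /= -!rnormE ler_normD. Qed.

Lemma rnormN x : rnorm (- x) = rnorm x.
Proof. by rewrite /rnorm normrN. Qed.

Lemma rnorm0 : rnorm (0 : X) = 0.
Proof. by rewrite /rnorm normr0. Qed.

Lemma rnorm0_eq0 x : rnorm x = 0 -> x = 0.
Proof. by move=> x0; apply/eqP; rewrite -normr_eq0 rnormE x0. Qed.

Lemma rnorm_dist x y : `|rnorm x - rnorm y| <= rnorm (x - y).
Proof.
have H a b : rnorm a - rnorm b <= rnorm (a - b).
  by rewrite lerBlDr (le_trans _ (rnormD _ _))// subrK.
by rewrite ler_norml H andbT lerNl opprB -(rnormN (x - y)) opprB H.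
Qed.

End real_norm.

Lemma rnorm_id (R : realType) (X : normedModType R[i]) (x : X) :
  rnorm (rnorm x)%:C = rnorm x.
Proof. by rewrite -rnormE /rnorm normr_id. Qed.

Lemma rnormZ (R : realType) (X : normedModType R[i]) (a : R[i]) (x : X) :
  rnorm (a *: x) = rnorm a * rnorm x.
Proof. by apply: complexI; rewrite rmorphM /= -!rnormE normrZ. Qed.

Lemma rnorm_cvg (R : realType) (X : normedModType R[i]) (u : X^nat) (l : X) :
  u @ \oo --> l -> rnorm (u n) @[n --> \oo] --> rnorm l.
Proof.
move=> /cvgrPdist_lt ul; apply/cvgrPdist_lt => e e0.
have := ul e%:C; rewrite ltcR => /(_ e0); apply: filterS => n.
by rewrite rnormE ltcR; apply: le_lt_trans; exact: rnorm_dist.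
Qed.

Section strongly_measurable.
Context {R : realType} {d} {Om : measurableType d}.

Definition simple_fun (X : Type) (s : Om -> X) : Prop :=
  finite_set (range s) /\ forall x, measurable (s @^-1` [set x]).

Definition strongly_measurable (X : normedModType R[i]) (f : Om -> X) : Prop :=
  exists s : (Om -> X)^nat,
    (forall n, simple_fun (s n)) /\
    (forall w, s n w @[n --> \oo] --> f w).

Lemma simple_fun_preimage (X : Type) (s : Om -> X) (B : set X) :
  simple_fun s -> measurable (s @^-1` B).
Proof.
move=> [fs ms].
rewrite (_ : s @^-1` B = \bigcup_(x in range s `&` B) (s @^-1` [set x])).
  apply: fin_bigcup_measurable => //.
  by apply: sub_finite_set fs => x [].
apply/seteqP; split => [w Bw|w [x [_ Bx]] /= ->//].
by exists (s w) => //; split => //; exists w.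
Qed.

Lemma simple_fun_op2 (X Y Z : Type) (h : X -> Y -> Z) s t :
  simple_fun s -> simple_fun t -> simple_fun (fun w : Om => h (s w) (t w)).
Proof.
move=> [fs ms] [ft mt]; split.
  apply: (@sub_finite_set _ _ [set h x y | x in range s & y in range t]).
    by move=> _ [w _ <-]; exists (s w); [exists w|exists (t w); [exists w|]].
  exact: finite_image2.
move=> z.
pose D := (range s `*` range t) `&` [set xy | h xy.1 xy.2 = z].
rewrite (_ : _ @^-1` _ =
    \bigcup_(xy in D) (s @^-1` [set xy.1] `&` t @^-1` [set xy.2])).
  apply: fin_bigcup_measurable => [|xy _]; last exact: measurableI.
  by apply: (sub_finite_set _ (finite_setX fs ft)) => xy [].
apply/seteqP; split => [w hw|w [[x y] [_ /= <-]] [/= -> ->]//].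
by exists (s w, t w) => //; split => //=; split => /=; exists w.
Qed.

Lemma simple_fun_cst (X : Type) (x : X) : simple_fun (fun _ : Om => x).
Proof.
split; last first.
  by move=> y; have [->|xy] := pselect (x = y);
    [rewrite (_ : _ @^-1` _ = setT)|rewrite (_ : _ @^-1` _ = set0)] => //;
    apply/seteqP; split.
by apply: (@sub_finite_set _ _ [set x]) => // _ [w _ <-].
Qed.

Lemma strongly_measurable_cst (X : normedModType R[i]) (x : X) :
  strongly_measurable (fun _ : Om => x).
Proof.
by exists (fun=> fun=> x); split => [n|w]; [exact: simple_fun_cst|exact: cvg_cst].
Qed.

Lemma strongly_measurable_op2 (X Y Z : normedModType R[i])
    (h : X -> Y -> Z) (f : Om -> X) (g : Om -> Y) :
  (forall (u : X^nat) (v : Y^nat) a b, u @ \oo --> a -> v @ \oo --> b ->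
    h (u n) (v n) @[n --> \oo] --> h a b) ->
  strongly_measurable f -> strongly_measurable g ->
  strongly_measurable (fun w => h (f w) (g w)).
Proof.
move=> hc [s [ss sf]] [t [st tg]].
exists (fun n w => h (s n w) (t n w)); split=> [n|w]; last exact: hc.
exact: simple_fun_op2.
Qed.

Variable X : normedModType R[i].

Lemma strongly_measurableD (f g : Om -> X) :
  strongly_measurable f -> strongly_measurable g -> strongly_measurable (f + g).
Proof.
by apply: (strongly_measurable_op2 (h := +%R)) => u v a b; exact: cvgD.
Qed.

Lemma strongly_measurable_scale (f : Om -> R[i]) (g : Om -> X) :
  strongly_measurable f -> strongly_measurable g ->
  strongly_measurable (fun w => f w *: g w).
Proof.
apply: (@strongly_measurable_op2 R[i] X X (fun a x => a *: x)) => u v a b.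
exact: cvgZ.
Qed.

Lemma measurable_rnorm (f : Om -> X) :
  strongly_measurable f -> measurable_fun setT (rnorm \o f).
Proof.
move=> [s [ss sf]].
apply/measurable_EFinP.
apply: (emeasurable_fun_cvg (fun n => EFin \o (rnorm \o s n))) => [n|w _].
  apply/measurable_EFinP => _ B mB; rewrite setTI comp_preimage.
  exact: simple_fun_preimage.
by apply: cvg_EFin; [exact: nearW|apply: rnorm_cvg; exact: sf].
Qed.

End strongly_measurable.

Section Lp_seminorm.
Context {R : realType} {d} {Om : measurableType d}.
Variables (mu : {measure set Om -> \bar R}) (p : \bar R) (p1 : (1 <= p)%E).
Variable X : normedModType R[i].
Implicit Types f g : Om -> X.

(* ||f||_p = (\int ||f(w)||^p)^(1/p), and the essential supremum for p = +oo *)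
Definition Lp_seminorm f : \bar R := 'N[mu]_p[EFin \o (rnorm \o f)]%E.

Definition Lp_fun : {pred Om -> X} :=
  mem [set f | strongly_measurable f /\ (Lp_seminorm f < +oo)%E].

Lemma Lp_funP f :
  (f \in Lp_fun) <-> strongly_measurable f /\ (Lp_seminorm f < +oo)%E.
Proof. by rewrite !inE. Qed.

Lemma le_Lnorm (u v : Om -> R) : measurable_fun setT u -> measurable_fun setT v ->
  (\forall w \ae mu, `|u w| <= `|v w|) ->
  ('N[mu]_p[EFin \o u] <= 'N[mu]_p[EFin \o v])%E.
Proof.
move=> mu_ mv uv; rewrite unlock /Lnorm; case: p p1 => [r r1| _|//]; last first.
  case: ifPn => // _; apply: le_ess_sup; apply: filterS uv => w /=.
  by rewrite lee_fin.
have r0 : 0 <= r by rewrite (le_trans ler01).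
have mr (h : Om -> R) : measurable_fun setT h ->
    measurable_fun setT (fun w => (`|h w| `^ r)%:E).
  move=> mh; apply/measurable_EFinP.
  apply: (@measurableT_comp _ _ _ _ _ _ (@powR R ^~ r)) => //.
  exact: measurableT_comp.
apply: gt0_ler_poweR.
- by rewrite invr_ge0.
- by rewrite in_itv/= leey andbT; apply: integral_ge0 => w _; rewrite lee_fin powR_ge0.
- by rewrite in_itv/= leey andbT; apply: integral_ge0 => w _; rewrite lee_fin powR_ge0.
apply: ae_ge0_le_integral => //.
- by move=> w _; rewrite lee_fin powR_ge0.
- exact: (mr _ mu_).
- by move=> w _; rewrite lee_fin powR_ge0.
- exact: (mr _ mv).
apply: filterS uv => w uvw _.
by rewrite lee_fin ge0_ler_powR.
Qed.

Lemma Lp_seminormD f g : strongly_measurable f -> strongly_measurable g ->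
  (Lp_seminorm (f + g)%R <= Lp_seminorm f + Lp_seminorm g)%E.
Proof.
move=> mf mg; apply: (@le_trans _ _
    'N[mu]_p[EFin \o ((rnorm \o f) \+ (rnorm \o g))%R]%E).
  apply: le_Lnorm.
  - by apply: measurable_rnorm; exact: strongly_measurableD.
  - by apply: measurable_funD; exact: measurable_rnorm.
  - by apply: nearW => w /=; rewrite !ger0_norm ?addr_ge0 ?rnorm_ge0// rnormD.
by apply: eminkowski => //; exact: measurable_rnorm.
Qed.

Lemma Lp_seminormZ (a : R[i]) f : f \in Lp_fun ->
  Lp_seminorm (a *: f) = ((rnorm a)%:E * Lp_seminorm f)%E.
Proof.
move=> /Lp_funP [mf Nf].
have Pf : rnorm \o f \in Lfun mu p.
  by apply/andP; rewrite !inE/=; split => //; exact: measurable_rnorm.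
have := LnormZ (Lfun_Sub p1 Pf) (rnorm a); rewrite /Lp_seminorm ger0_norm ?rnorm_ge0//.
move=> <-; congr Lnorm; apply/funext => w /=; congr EFin.
exact: rnormZ.
Qed.

Lemma Lp_seminorm_ae0 f : strongly_measurable f ->
  (\forall w \ae mu, f w = 0) -> Lp_seminorm f = 0%E.
Proof.
move=> mf f0; apply/eqP; rewrite eq_le Lnorm_ge0 andbT.
rewrite -(@Lnorm0 _ _ _ mu p); last by rewrite gt_eqF// (lt_le_trans _ p1).
rewrite (_ : cst 0%E = EFin \o (cst 0%R : Om -> R))//; apply: le_Lnorm => //.
  exact: measurable_rnorm.
by apply: filterS f0 => w /= ->; rewrite rnorm0.
Qed.

Lemma Lp_seminorm_eq0 f : strongly_measurable f -> Lp_seminorm f = 0%E ->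
  \forall w \ae mu, f w = 0.
Proof.
move=> mf /Lnorm_eq0_eq0; move=> /(_ _ (lt_le_trans lte01 p1)) H.
have /H : measurable_fun setT (EFin \o (rnorm \o f)).
  by apply/measurable_EFinP; exact: measurable_rnorm.
by apply: filterS => w /= /(_ I) [] /rnorm0_eq0.
Qed.

Lemma Lp_fun_submod_closed : submod_closed Lp_fun.
Proof.
have L0 : (0 : Om -> X) \in Lp_fun.
  apply/Lp_funP; split; first exact: strongly_measurable_cst.
  rewrite Lp_seminorm_ae0//; first exact: strongly_measurable_cst.
  exact: nearW.
split => // a f g Lf /Lp_funP [mg Ng]; have [mf Nf] := (Lp_funP _).1 Lf.
have maf : strongly_measurable (a *: f).
  by apply: strongly_measurable_scale mf; exact: strongly_measurable_cst.
apply/Lp_funP; split; first exact: strongly_measurableD.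
apply: (le_lt_trans (Lp_seminormD _ _)) => //.
rewrite lte_add_pinfty// Lp_seminormZ//.
by rewrite lte_mul_pinfty// ?lee_fin ?rnorm_ge0.
Qed.

HB.instance Definition _ :=
  GRing.isSubmodClosed.Build _ _ Lp_fun Lp_fun_submod_closed.

Definition Lp_elt (_ : (1 <= p)%E) : Type := {f : Om -> X | f \in Lp_fun}.

Local Notation E := (Lp_elt p1).

HB.instance Definition _ := [isSub of E for @sval _ _].
HB.instance Definition _ := [Choice of E by <:].
HB.instance Definition _ := [SubChoice_isSubLmodule of E by <:].

Lemma Lp_elt_meas (f : E) : strongly_measurable (val f).
Proof. by have /Lp_funP [] := valP f. Qed.

Lemma Lp_elt_fin (f : E) : (Lp_seminorm (val f) < +oo)%E.
Proof. by have /Lp_funP [] := valP f. Qed.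

Definition Lp_null : {pred E} := mem [set f | \forall w \ae mu, val f w = 0].

Lemma Lp_nullP (f : E) :
  reflect (\forall w \ae mu, val f w = 0) (f \in Lp_null).
Proof. by apply: (iffP idP); rewrite inE. Qed.

Lemma Lp_null_zmod_closed : zmod_closed Lp_null.
Proof.
split; first by apply/Lp_nullP; exact: nearW.
move=> f g /Lp_nullP f0 /Lp_nullP g0; apply/Lp_nullP.
apply: filterS2 f0 g0 => w fw gw.
by rewrite -[LHS]/(val f w - val g w) fw gw subr0.
Qed.

HB.instance Definition _ :=
  GRing.isZmodClosed.Build _ Lp_null Lp_null_zmod_closed.

Definition Lp_space : Type := Quotient.quot Lp_null.

HB.instance Definition _ := Choice.on Lp_space.
HB.instance Definition _ := EqQuotient.on Lp_space.
HB.instance Definition _ := GRing.Zmodule.on Lp_space.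
HB.instance Definition _ := ZmodQuotient.on Lp_space.

Local Notation L := Lp_space.
Local Notation "[ f ]" := (\pi_L f : L).

(* The underlying function of a class, well defined up to a null set. *)
Definition Lp_val (f : L) : Om -> X := val (repr f).

Lemma Lp_classP (f g : E) :
  [f] = [g] <-> (\forall w \ae mu, val f w = val g w).
Proof.
split=> [/eqP|fg]; last first.
  apply/eqP; rewrite -Quotient.idealrBE; apply/Lp_nullP.
  by apply: filterS fg => w fg; rewrite -[LHS]/(val f w - val g w) fg subrr.
rewrite -Quotient.idealrBE => /Lp_nullP; apply: filterS => w.
by rewrite -[LHS]/(val f w - val g w) => /eqP; rewrite subr_eq0 => /eqP.
Qed.

Lemma Lp_val_pi (f : E) : \forall w \ae mu, Lp_val [f] w = val f w.
Proof. by apply/Lp_classP; rewrite reprK. Qed.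

Lemma Lp_valP (f g : L) :
  f = g <-> (\forall w \ae mu, Lp_val f w = Lp_val g w).
Proof. by rewrite -Lp_classP !reprK. Qed.

Definition Lp_class f (fP : f \in Lp_fun) : L :=
  [exist (fun f => f \in Lp_fun) f fP].

Lemma Lp_val_class f (fP : f \in Lp_fun) :
  \forall w \ae mu, Lp_val (Lp_class fP) w = f w.
Proof. exact: Lp_val_pi. Qed.

Definition Lp_scale (a : R[i]) (f : L) : L := [a *: repr f].

Lemma Lp_scale_pi a (f : E) : Lp_scale a [f] = [a *: f].
Proof.
apply/Lp_classP; apply: filterS (Lp_val_pi f) => w fw.
by rewrite -[LHS]/(a *: Lp_val [f] w) fw.
Qed.

Lemma Lp_scaleA a b (f : L) : Lp_scale a (Lp_scale b f) = Lp_scale (a * b) f.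
Proof. by rewrite -[f]reprK !(Lp_scale_pi _ (repr f)) Lp_scale_pi scalerA. Qed.

Lemma Lp_scale1 : left_id 1 Lp_scale.
Proof. by move=> f; rewrite -[f]reprK Lp_scale_pi scale1r. Qed.

Lemma Lp_pi_add (f g : E) : [f + g] = [f] + [g] :> L.
Proof. exact: (Quotient.pi_add Lp_null f g). Qed.

Lemma Lp_scaleDr : right_distributive Lp_scale +%R.
Proof.
move=> a f g; rewrite -[f]reprK -[g]reprK -Lp_pi_add !Lp_scale_pi -Lp_pi_add.
by rewrite scalerDr.
Qed.

Lemma Lp_scaleDl (f : L) : {morph Lp_scale^~ f : a b / a + b}.
Proof.
by move=> a b; rewrite -[f]reprK !Lp_scale_pi -Lp_pi_add scalerDl.
Qed.

HB.instance Definition _ := GRing.Zmodule_isLmodule.Build R[i] L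
  Lp_scaleA Lp_scale1 Lp_scaleDr Lp_scaleDl.

Lemma Lp_pi_scale a (f : E) : [a *: f] = a *: [f] :> L.
Proof. by rewrite -Lp_scale_pi. Qed.

Definition Lp_norm (f : L) : R[i] := (fine (Lp_seminorm (Lp_val f)))%:C.

Lemma Lp_norm_pi (f : E) : Lp_norm [f] = (fine (Lp_seminorm (val f)))%:C.
Proof.
congr ((fine _)%:C); apply/eqP; rewrite eq_le.
have H (u v : E) : (\forall w \ae mu, val u w = val v w) ->
    (Lp_seminorm (val u) <= Lp_seminorm (val v))%E.
  move=> uv; apply: le_Lnorm; do ?[apply: measurable_rnorm; exact: Lp_elt_meas].
  by apply: filterS uv => w /= ->.
rewrite !H//; first by apply: filterS (Lp_val_pi f) => w.
exact: Lp_val_pi.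
Qed.

Lemma Lp_seminormK (f : E) :
  (fine (Lp_seminorm (val f)))%:E = Lp_seminorm (val f).
Proof. by rewrite fineK// ge0_fin_numE ?Lnorm_ge0//; exact: Lp_elt_fin. Qed.

Lemma Lp_normD (f g : L) : Lp_norm (f + g) <= Lp_norm f + Lp_norm g.
Proof.
rewrite -[f]reprK -[g]reprK -Lp_pi_add !Lp_norm_pi -rmorphD lecR.
rewrite -lee_fin EFinD !Lp_seminormK.
by apply: Lp_seminormD; exact: Lp_elt_meas.
Qed.

Lemma Lp_normZ a (f : L) : Lp_norm (a *: f) = `|a| * Lp_norm f.
Proof.
rewrite -[f]reprK -Lp_pi_scale !Lp_norm_pi rnormE -rmorphM; congr (_%:C).
apply: EFin_inj; rewrite EFinM !Lp_seminormK.
by rewrite -Lp_seminormZ//; exact: valP.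
Qed.

Lemma Lp_norm0_eq0 (f : L) : Lp_norm f = 0 -> f = 0.
Proof.
have <- : [0] = 0 :> L by rewrite -(scale0r (0 : E)) Lp_pi_scale scale0r.
rewrite -[f]reprK Lp_norm_pi => /complexI f0; apply/Lp_classP.
apply: Lp_seminorm_eq0; first exact: Lp_elt_meas.
by rewrite -Lp_seminormK f0.
Qed.

HB.instance Definition _ :=
  Lmodule_isNormed.Build R[i] L Lp_normD Lp_normZ Lp_norm0_eq0.

End Lp_seminorm.

Arguments Lp_class {R d Om mu p} p1 {X f} fP.
Arguments Lp_fun {R d Om} mu p X.
Arguments Lp_elt {R d Om} mu {p} X p1.
Arguments Lp_space {R d Om} mu {p} p1 X.

Section Lp_elements.
Context {R : realType} {d} {Om : measurableType d}.
Variable mu : {measure set Om -> \bar R}.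

Section tensor.
Variables (p : \bar R) (p1 : (1 <= p)%E) (X : normedModType R[i]).

Lemma Lp_tensor_subproof (f : Lp_space mu p1 R[i]) (x : X) :
  (fun w => Lp_val f w *: x) \in Lp_fun mu p X.
Proof.
pose g := (rnorm x)%:C *: Lp_val f.
have mf : strongly_measurable (Lp_val f) by exact: Lp_elt_meas.
have /Lp_funP [mg Ng] : g \in Lp_fun mu p R[i].
  by rewrite -[g]/(val ((rnorm x)%:C *: repr f)); exact: valP.
have mx : strongly_measurable (fun _ : Om => x).
  exact: strongly_measurable_cst.
have Egx : EFin \o (rnorm \o (fun w => Lp_val f w *: x)) = EFin \o (rnorm \o g).
  apply/funext => w; congr EFin.
  rewrite -[RHS]/(rnorm ((rnorm x)%:C *: Lp_val f w)) -[LHS]/(rnorm (Lp_val f w *: x)).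
  by rewrite !rnormZ rnorm_id mulrC.
apply/Lp_funP; split; first exact: (strongly_measurable_scale mf mx).
by rewrite /Lp_seminorm Egx.
Qed.

(* f \otimes x *)
Definition Lp_tensor (f : Lp_space mu p1 R[i]) (x : X) : Lp_space mu p1 X :=
  Lp_class p1 (Lp_tensor_subproof f x).

End tensor.

Definition le1y : (1 <= +oo :> \bar R)%E := leey 1.

Lemma Lp_one_subproof : (fun _ : Om => 1) \in Lp_fun mu +oo R[i].
Proof.
apply/Lp_funP; split; first exact: strongly_measurable_cst.
rewrite /Lp_seminorm unlock /Lnorm; case: ifPn => // mu0.
rewrite (_ : _ \o _ = cst `|(rnorm (1 : R[i]))%:E|%E)// ess_sup_cst//=.
exact: ltry.
Qed.

Definition Lp_one : Lp_space mu le1y R[i] :=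
  Lp_class le1y Lp_one_subproof.

Definition le12 : (1 <= 2%:R%:E :> \bar R)%E := lee1n 2.

Definition L2_inner (f g : Lp_space mu le12 R[i]) : R[i] :=
  let h w := Lp_val f w * (Lp_val g w)^* in
  (\int[mu]_w complex.Re (h w)) +i* (\int[mu]_w complex.Im (h w)).

End Lp_elements.

Section operators.
Context {R : realType}.

Definition opnorm (Y Z : normedModType R[i]) (F : Y -> Z) : \bar R :=
  ereal_sup [set (rnorm (F y))%:E | y in [set y | rnorm y <= 1]].

Variable Y : normedModType R[i].

(* derivatives in the operator norm, at a complex and at a real point *)
Definition is_op_cderive (T : R[i] -> {linear Y -> Y}) (z : R[i])
    (D : {linear Y -> Y}) : Prop :=
  (opnorm D < +oo)%E /\
  opnorm (fun y => h^-1 *: (T (z + h) y - T z y) - D y) @[h --> (0 : R[i])^']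
    --> (0 : \bar R).

Definition is_op_rderive (T : R -> {linear Y -> Y}) (t : R)
    (D : {linear Y -> Y}) : Prop :=
  (opnorm D < +oo)%E /\
  opnorm (fun y => (h^-1)%:C *: (T (t + h) y - T t y) - D y) @[h --> (0 : R)^']
    --> (0 : \bar R).

Definition has_arg (z : R[i]) (t : R) : Prop :=
  - pi < t < pi /\ z = `|z| * (cos t +i* sin t).

Definition sector (a : R) : set R[i] :=
  [set z | z != 0 /\ exists2 t, has_arg z t & `|t| < a].

Definition closed_sector (a : R) : set R[i] :=
  [set z | z = 0 \/ exists2 t, has_arg z t & `|t| <= a].

(* T is a total function; its values outside sector eta and 0 are irrelevant. *)
Record bounded_holomorphic_semigroup (eta : R) (T : R[i] -> {linear Y -> Y}) :
    Prop := {
  bhs_angle : 0 < eta < pi ;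
  bhs_bounded : forall z, sector eta z \/ z = 0 -> (opnorm (T z) < +oo)%E ;
  bhs_mul : forall z1 z2, sector eta z1 -> sector eta z2 ->
    forall y, T (z1 + z2) y = T z1 (T z2 y) ;
  bhs_holomorphic : forall z, sector eta z -> exists D, is_op_cderive T z D ;
  bhs_cvg : forall y eta', 0 < eta' < eta ->
    T z y @[z --> within (closed_sector eta') (nbhs (0 : R[i]))] --> y ;
  bhs_uniformly_bounded : forall eta', 0 < eta' < eta ->
    exists M : R, forall z, closed_sector eta' z -> (opnorm (T z) <= M%:E)%E
}.

End operators.

Definition uniformly_convex (R : realType) (X : normedModType R[i])
    (q delta : R) : Prop :=
  forall x y : X,
    rnorm (2^-1 *: (x + y)) `^ q + delta * rnorm (2^-1 *: (x - y)) `^ q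
      <= 2^-1 * (rnorm x `^ q + rnorm y `^ q).

Section symmetric_diffusion_semigroup.
Context {R : realType} {d} {Om : measurableType d}.
Variable mu : {measure set Om -> \bar R}.

(* An operator acting on all the scalar spaces L_p, 1 <= p <= +oo, is given by
   its restrictions to each of them. *)
Definition Lp_operator : Type := forall (p : \bar R) (p1 : (1 <= p)%E),
  {linear Lp_space mu p1 R[i] -> Lp_space mu p1 R[i]}.

Record symmetric_markovian (T : Lp_operator) : Prop := {
  sm_consistent : forall p (p1 : (1 <= p)%E) r (r1 : (1 <= r)%E)
    (f : Lp_space mu p1 R[i]) (g : Lp_space mu r1 R[i]),
    (\forall w \ae mu, Lp_val f w = Lp_val g w) ->
    \forall w \ae mu, Lp_val (T p p1 f) w = Lp_val (T r r1 g) w ;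
  sm_contraction : forall p (p1 : (1 <= p)%E), (opnorm (T p p1) <= 1)%E ;
  sm_positive : forall p (p1 : (1 <= p)%E) (f : Lp_space mu p1 R[i]),
    (\forall w \ae mu, 0 <= Lp_val f w) ->
    \forall w \ae mu, 0 <= Lp_val (T p p1 f) w ;
  sm_one : T _ le1y (Lp_one mu) = Lp_one mu ;
  sm_selfadjoint : forall f g : Lp_space mu le12 R[i],
    L2_inner (T _ le12 f) g = L2_inner f (T _ le12 g)
}.

(* The operators are indexed by R; only the T t with 0 < t matter. *)
Record symmetric_diffusion_semigroup (T : R -> Lp_operator) : Prop := {
  sds_markovian : forall t, 0 < t -> symmetric_markovian (T t) ;
  sds_mul : forall t s, 0 < t -> 0 < s ->
    forall p (p1 : (1 <= p)%E) (f : Lp_space mu p1 R[i]),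
    T t p p1 (T s p p1 f) = T (t + s) p p1 f ;
  sds_cvg : forall f : Lp_space mu le12 R[i],
    T t _ le12 f @[t --> (0 : R)^'+] --> f
}.

(* S extends T \otimes id_X.  Such an S is unique when p < +oo, the span of the
   f \otimes x being then dense. *)
Definition is_contractive_extension (X : normedModType R[i]) (T : Lp_operator)
    (p : \bar R) (p1 : (1 <= p)%E)
    (S : {linear Lp_space mu p1 X -> Lp_space mu p1 X}) : Prop :=
  (opnorm S <= 1)%E /\
  forall (f : Lp_space mu p1 R[i]) (x : X),
    S (Lp_tensor f x) = Lp_tensor (T p p1 f) x.

End symmetric_diffusion_semigroup.

(* Main.v *)
(** Two ideas are combined.

For a symmetric Markovian operator S, the numbers \int_A S 1_B are symmetric in
A and B, with marginals dominated by the measure.  Integrating Jensen's inequality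
against them and using uniform convexity of X at each pair of values gives, first
for simple f and g, then by density,
  ||(g + S f)/2||^q + delta ||(f - S g)/2||^q <= (||f||^q + ||g||^q)/2.
With S = T_(t/2) and g = S f this forces ||1 - T_t|| <= 2 - 2e for all t > 0,
where e = delta/(3q).

A contraction semigroup with that gap is analytic, quantitatively.  Each z
outside the unit disc has a power z^m close to the negative axis, whereas
||1 - S^m|| <= 2 - 2e; hence Q = (1 + S)/2 satisfies
||v - u Q v|| >= |1 - u| ||v|| / K for |u| < 1, with K = 18/e.  Averaging the
power series of (1 - u Q)^-(m+1) over roots of unity turns this into Ritt type
bounds ||(1 - Q)^k Q^n|| = O((1 + K)^k k! / n^k), which in the limit of small time
steps become ||T_t^(k)|| <= C_k / t^k with explicit C_k.  The Taylor series of
t |-> T_t at t = Re z therefore define T(z) on a sector of angle of order 1/K. *)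

Require Import Defs.
From HB Require Import structures.
From mathcomp Require Import all_boot all_order all_algebra.
From mathcomp Require Import complex ring lra zify.
From mathcomp Require Import all_classical all_reals all_analysis.
From mathcomp Require Import measurable_realfun ess_sup_inf.

Set Implicit Arguments.
Unset Strict Implicit.
Unset Printing Implicit Defensive.

Import Order.TTheory GRing.Theory Num.Theory numFieldNormedType.Exports.

Local Open Scope classical_set_scope.
Local Open Scope ring_scope.
Local Open Scope complex_scope.

(** Powers of a point of the unit circle need not come near -1 (take a cube root of unity), so the
    gap alone does not control the resolvent of S there. For Q = (1 + S)/2 one has 1 - u Q = (u/2)(z
    - S) with z = 2/u - 1, and |u| < 1 means |z + 1| > 2. Such z avoid a disc tangent at 1 to the
    unit disc, hence approach the unit circle only near 1, where the small steps of the argument do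
    reach the negative axis. The semigroup is recovered since ((1 + T_h)/2)^n is the mean of T at a
    binomial time, which concentrates at n h/2.

    A norm bound linear in q/delta needs a Ritt constant linear in K, although two resolvent factors
    are spent. Replacing |1 - u| by |1 - x u|, with 1 - x of order K/n, widens the Poisson kernel;
    the mean of |1 - x u|^-2 is then of order n/K and absorbs one factor K.

    Nothing is inverted: resolvent powers are truncated polynomials in Q with an explicit remainder.
    The value e = delta/(3q) comes from the tangent of a^q at a = 1, whose slope is q. *)

Section complex_norm.
Context {R : realType}.
Implicit Types z w : R[i].

Lemma rnormC_def z : rnorm z = Num.sqrt (complex.Re z ^+ 2 + complex.Im z ^+ 2).
Proof. by rewrite /rnorm normc_def. Qed.

Lemma rnormC_sqr z : rnorm z ^+ 2 = complex.Re z ^+ 2 + complex.Im z ^+ 2.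
Proof. by rewrite rnormC_def sqr_sqrtr// addr_ge0// sqr_ge0. Qed.

Lemma rnormC (x : R) : rnorm x%:C = `|x|.
Proof. by rewrite rnormC_def/= expr0n/= addr0 sqrtr_sqr. Qed.

Lemma rnormM z w : rnorm (z * w) = rnorm z * rnorm w.
Proof. by rewrite -[z * w]/(z *: (w : R[i]^o)) rnormZ. Qed.

Lemma rnormC1 : rnorm (1 : R[i]) = 1.
Proof. by rewrite -[1]/(1%:C) rnormC normr1. Qed.

Lemma rnormX z n : rnorm (z ^+ n) = rnorm z ^+ n.
Proof. by elim: n => [|n ih]; rewrite ?expr0 ?rnormC1// !exprS rnormM ih. Qed.

Lemma rnormV z : rnorm z^-1 = (rnorm z)^-1.
Proof.
have [->|z0] := eqVneq z 0; first by rewrite invr0 rnorm0 invr0.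
have nz : rnorm z != 0 by apply: contra_neq z0 => /rnorm0_eq0.
by apply: (mulfI nz); rewrite -rnormM !divff// rnormC1.
Qed.

Lemma rnormC_nat n : rnorm (n%:R : R[i]) = n%:R.
Proof.
rewrite (_ : n%:R = (n%:R : R)%:C); last by rewrite rmorph_nat.
by rewrite rnormC ger0_norm.
Qed.

Lemma Re_le_rnorm z : complex.Re z <= rnorm z.
Proof.
rewrite (le_trans (ler_norm _))// -sqrtr_sqr rnormC_def ler_wsqrtr//.
by rewrite lerDl sqr_ge0.
Qed.

End complex_norm.

Section rnorm_theory.
Context {R : realType} {X : normedModType R[i]}.
Implicit Types x y : X.

Lemma rnormB x y : rnorm (x - y) = rnorm (y - x).
Proof. by rewrite -rnormN opprB. Qed.

Lemma rnorm_triangle x y z : rnorm (x - z) <= rnorm (x - y) + rnorm (y - z).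
Proof. by rewrite (le_trans _ (rnormD _ _))// addrA subrK. Qed.

Lemma rnormDle x y : rnorm x <= rnorm y + rnorm (x - y).
Proof. by rewrite (le_trans _ (rnormD _ _))// [y + _]addrC subrK. Qed.

Lemma rnorm_subr x y : rnorm (x - y) <= rnorm x + rnorm y.
Proof. by rewrite (le_trans (rnormD _ _))// rnormN. Qed.

Lemma rnorm_sum (I : Type) (r : seq I) (P : pred I) (F : I -> X) :
  rnorm (\sum_(i <- r | P i) F i) <= \sum_(i <- r | P i) rnorm (F i).
Proof.
elim/big_ind2: _ => [|x a y b xa yb|//]; first by rewrite rnorm0.
by rewrite (le_trans (rnormD _ _))// lerD.
Qed.

Lemma rnormZC (a : R) x : rnorm (a%:C *: x) = `|a| * rnorm x.
Proof. by rewrite rnormZ rnormC. Qed.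

End rnorm_theory.

(** * Unit circle: roots of unity and polar form *)

Section unit_circle.
Context {R : realType}.

Definition cis (t : R) : R[i] := cos t +i* sin t.

Lemma cisD s t : cis (s + t) = cis s * cis t.
Proof.
by apply/eqP; rewrite eq_complex/= cosD sinD eqxx/= addrC (mulrC (sin s)).
Qed.

Lemma cisX t n : cis t ^+ n = cis (n%:R * t).
Proof.
elim: n => [|n ih]; first by rewrite expr0 mul0r /cis cos0 sin0.
by rewrite exprS ih -cisD -add1n natrD mulrDl mul1r.
Qed.

Lemma rnorm_cis t : rnorm (cis t) = 1.
Proof. by rewrite rnormC_def/= cos2Dsin2 sqrtr1. Qed.

Lemma cos_lt1 (t : R) : 0 < t < pi *+ 2 -> cos t < 1.
Proof.
have H s : 0 < s <= pi -> cos s < 1 :> R.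
  move=> /andP[s0 spi]; rewrite -cos0 ltr_cos// in_itv/=.
    by rewrite lexx pi_ge0.
  by rewrite ltW.
move=> /andP[t0 t2]; have [tpi|tpi] := leP t pi; first by rewrite H// t0.
rewrite -cosN -cosD2pi H//; rewrite addrC subr_gt0 t2/= lerBlDr.
by rewrite mulr2n lerD2l ltW.
Qed.

Lemma cis_root_prim N : (0 < N)%N -> let w := cis (pi *+ 2 / N%:R) in
  w ^+ N = 1 /\ forall j, (0 < j < N)%N -> w ^+ j != 1.
Proof.
move=> N0 /=; have N0' : (0 : R) < N%:R by rewrite ltr0n.
rewrite cisX mulrCA divff ?gt_eqF// mulr1 /cis cos2pi sin2pi; split => //.
move=> j /andP[j0 jN]; rewrite cisX; apply/negP => /eqP[] /eqP + _.
apply/negP; rewrite lt_eqF// cos_lt1//.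
rewrite mulrA; apply/andP; split.
  by rewrite divr_gt0// mulr_gt0 ?ltr0n// pmulrn_lgt0// pi_gt0.
by rewrite ltr_pdivrMr// mulrC ltr_pM2l ?ltr_nat// pmulrn_lgt0// pi_gt0.
Qed.

(** Orthogonality of characters: for j > 0 the sum is killed by the nonzero factor [w ^+ j - 1]. *)
Lemma sum_root_unity N (j : nat) (w : R[i]) : (j < N)%N -> w ^+ N = 1 ->
  (forall i, (0 < i < N)%N -> w ^+ i != 1) ->
  \sum_(l < N) (w ^+ j) ^+ l = if j == 0%N then N%:R else 0.
Proof.
move=> jN wN wj; case: eqVneq => [->|j0].
  rewrite expr0 (eq_bigr (fun=> 1)); last by move=> l _; rewrite expr1n.
  by rewrite sumr_const card_ord.
apply: (@mulfI _ (w ^+ j - 1)).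
  by rewrite subr_eq0 wj// lt0n j0.
by rewrite mulr0 -subrX1 -exprM mulnC exprM wN expr1n subrr.
Qed.

Lemma polar (z : R[i]) : exists t, [/\ - pi < t, t <= pi & z = (rnorm z)%:C * cis t].
Proof.
have [->|z0] := eqVneq z 0.
  by exists 0; rewrite rnorm0 mul0r oppr_lt0 pi_gt0 pi_ge0.
have nz : 0 < rnorm z.
  by rewrite lt_neqAle rnorm_ge0 andbT eq_sym; apply: contra_neq z0 => /rnorm0_eq0.
have [c [s zcs]] : exists c s, z = (rnorm z)%:C * (c +i* s).
  exists (complex.Re z / rnorm z), (complex.Im z / rnorm z).
  apply: (@mulfI _ (rnorm z)^-1%:C).
    by rewrite -[0]/(0%:C) (inj_eq (@complexI _)) invr_eq0 gt_eqF.
  rewrite mulrA -rmorphM mulVf ?gt_eqF// mul1r; move: (rnorm z)^-1 => r.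
  by case: z {z0 nz} => a b /=; simpc; rewrite ![r * _]mulrC.
have cs : c ^+ 2 + s ^+ 2 = 1.
  have := congr1 (fun z => rnorm z ^+ 2) zcs.
  rewrite rnormM exprMn rnormC ger0_norm ?rnorm_ge0// (rnormC_sqr (c +i* s))/= => h.
  apply: (@mulfI _ (rnorm z ^+ 2)); first by rewrite expf_neq0// gt_eqF.
  by rewrite mulr1 [RHS]h.
have c1 : -1 <= c <= 1.
  by move: cs (sqr_ge0 s) => cs s2; apply/andP; split; nra.
have sa : sin (acos c) = `|s|.
  by rewrite sin_acos// -cs addrC addKr sqrtr_sqr.
have ca : cos (acos c) = c by rewrite acosK.
have a0 := acos_ge0 c1; have a1 := acos_lepi c1.
have [s0|s0] := leP 0 s.
  exists (acos c); split => //; last by rewrite /cis ca sa ger0_norm.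
  by rewrite (lt_le_trans _ a0)// oppr_lt0 pi_gt0.
exists (- acos c); split.
(* The bound -pi < t is strict because a cosine equal to -1 would force s = 0, against s < 0. *)
- rewrite ltrN2 acos_ltpi//; case/andP: c1 => c1 ->; rewrite andbT lt_neqAle c1 andbT.
  apply: contraL s0 => /eqP c1'; move: cs; rewrite -c1' sqrrN expr1n => /eqP.
  by rewrite -subr_eq0 addrAC subrr add0r sqrf_eq0 => /eqP ->; rewrite ltxx.
- by rewrite (le_trans _ (pi_ge0 R))// oppr_le0.
- by rewrite /cis cosN sinN ca sa ltr0_norm// opprK.
Qed.

End unit_circle.

(** * Polynomial calculus of a linear operator *)

Section poly_action.
Context {R : realType} {Y : normedModType R[i]} (Q : {linear Y -> Y}).
Implicit Types (p r : {poly R[i]}) (y : Y).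

(** The operator p(Q). Going through polynomials makes every commutation between powers of Q, 1 - Q
    and 1 - u Q an identity in a commutative ring. *)
Definition pact p y : Y := \sum_(i < size p) p`_i *: iter i Q y.

Lemma pactE p y n : (size p <= n)%N -> pact p y = \sum_(i < n) p`_i *: iter i Q y.
Proof.
move=> pn; rewrite /pact (big_ord_widen _ (fun i => p`_i *: iter i Q y) pn).
rewrite big_mkcond; apply: eq_bigr => i _; case: ltnP => // h.
by rewrite nth_default// scale0r.
Qed.

Lemma iter_linear n : linear (iter n Q).
Proof. by elim: n => // n ih a x y /=; rewrite ih linearP. Qed.

Lemma pactD p r y : pact (p + r) y = pact p y + pact r y.
Proof.
pose n := maxn (size p) (size r).
rewrite (@pactE p _ n) ?leq_maxl// (@pactE r _ n) ?leq_maxr//.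
rewrite (@pactE (p + r) _ n) ?size_polyD// -big_split/=.
by apply: eq_bigr => i _; rewrite coefD scalerDl.
Qed.

Lemma pactZ a p y : pact (a *: p) y = a *: pact p y.
Proof.
rewrite (@pactE (a *: p) _ (size p)) ?size_scale_leq// scaler_sumr.
by apply: eq_bigr => i _; rewrite coefZ scalerA.
Qed.

Lemma pact0 y : pact 0 y = 0.
Proof. by rewrite /pact size_poly0 big_ord0. Qed.

Lemma pact_sum (I : Type) (s : seq I) (P : pred I) (F : I -> {poly R[i]}) y :
  pact (\sum_(i <- s | P i) F i) y = \sum_(i <- s | P i) pact (F i) y.
Proof. by elim/big_ind2: _ => [|p a r b <- <-|//]; rewrite ?pact0 ?pactD. Qed.

Lemma pactXn n y : pact 'X^n y = iter n Q y.
Proof.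
rewrite /pact size_polyXn big_ord_recr/= big1 ?add0r ?coefXn ?eqxx ?scale1r//.
by move=> i _; rewrite coefXn ltn_eqF// scale0r.
Qed.

Lemma pact1 y : pact 1 y = y.
Proof. by rewrite -(expr0 'X) pactXn. Qed.

Lemma pactN p y : pact (- p) y = - pact p y.
Proof. by rewrite -scaleN1r pactZ scaleN1r. Qed.

Lemma pactB p r y : pact (p - r) y = pact p y - pact r y.
Proof. by rewrite pactD pactN. Qed.

Lemma pact_linear p : linear (pact p).
Proof.
move=> a x y; rewrite scaler_sumr -big_split/=; apply: eq_bigr => i _.
by rewrite iter_linear scalerDr !scalerA mulrC.
Qed.

HB.instance Definition _ p :=
  GRing.isLinear.Build R[i] Y Y *:%R (pact p) (pact_linear p).

Lemma pactXnM n p y : pact ('X^n * p) y = iter n Q (pact p y).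
Proof.
elim: n => [|n ih]; first by rewrite mul1r.
rewrite exprS -mulrA /= -ih; move: ('X^n * p) => r.
rewrite (@pactE ('X * r) _ (size r).+1); last by rewrite (leq_trans (size_polyMleq _ _))// size_polyX.
rewrite big_ord_recl coefXM eqxx scale0r add0r /pact linear_sum.
by apply: eq_bigr => i _; rewrite coefXM/= linearZ.
Qed.

Lemma pactM p r y : pact (p * r) y = pact p (pact r y).
Proof.
rewrite -[p in LHS]coefK poly_def mulr_suml pact_sum; apply: eq_bigr => i _.
by rewrite -scalerAl pactZ pactXnM.
Qed.

End poly_action.

(* The truncated power series of (1 - z)^-(m+1). *)
Section truncated_series.
Context {A : comNzRingType}.
Implicit Types z : A.

Definition tser (m N : nat) z : A := \sum_(j < N) 'C(j + m, m)%:R * z ^+ j.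

Lemma tser0 N z : (1 - z) * tser 0 N z = 1 - z ^+ N.
Proof.
rewrite -opprB mulNr /tser (eq_bigr (fun j : 'I_N => z ^+ j)).
  by rewrite -subrX1 opprB.
by move=> j _; rewrite bin0 mul1r.
Qed.

Lemma tserS m N z :
  (1 - z) * tser m.+1 N z = tser m N z - 'C(N + m, m.+1)%:R * z ^+ N.
Proof.
elim: N => [|N ih].
  by rewrite /tser !big_ord0 mulr0 add0n bin_small// mul0r subrr.
rewrite /tser !big_ord_recr/= -!/(tser _ _ _) mulrDr ih !addnS addSn binS natrD exprS.
ring.
Qed.

(** Each factor 1 - z lowers m by one ([tserS]) and leaves one boundary term divisible by z^N. *)
Lemma tser_err m N z : (1 - z) ^+ m.+1 * tser m N z =
  1 - z ^+ N * (1 + \sum_(i < m) 'C(N + i, i.+1)%:R * (1 - z) ^+ i.+1).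
Proof.
elim: m => [|m ih]; first by rewrite big_ord0 expr1 tser0 addr0 mulr1.
rewrite exprSr -mulrA tserS mulrBr ih big_ord_recr/=; ring.
Qed.

End truncated_series.

(** * Averages over roots of unity *)

Section discrete_averages.
Context {R : realType}.
Implicit Types (a b x : R) (u w : R[i]).

Lemma Re_sum (I : Type) (r : seq I) (P : pred I) (F : I -> R[i]) :
  complex.Re (\sum_(i <- r | P i) F i) = \sum_(i <- r | P i) complex.Re (F i).
Proof. by apply: (big_morph (@complex.Re R)) => // -[a b] [c d]. Qed.

(** The left side is a single term of the binomial expansion of (b + (1 - b))^(n + j) = 1. *)
Lemma bin_geometric b j n : 0 <= b <= 1 ->
  'C(n + j, j)%:R * b ^+ n * (1 - b) ^+ j <= 1.
Proof.
move=> /andP[b0 b1]; have b1' : 0 <= 1 - b by rewrite subr_ge0.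
have : (b + (1 - b)) ^+ (n + j) = 1 by rewrite addrC subrK expr1n.
rewrite exprDn => {3}<-; have jn : (j < (n + j).+1)%N by rewrite ltnS leq_addl.
rewrite (bigD1 (Ordinal jn))//= addnK -[in leRHS]mulr_natl mulrA lerDl.
by apply: sumr_ge0 => i _; rewrite mulrn_wge0// mulr_ge0// exprn_ge0.
Qed.

Lemma geometric_lt b e : 0 <= b < 1 -> 0 < e ->
  exists N0, forall N, (N0 <= N)%N -> b ^+ N < e.
Proof.
move=> /andP[b0 b1] e0; have /cvgrPdist_lt/(_ e e0) : b ^+ n @[n --> \oo] --> 0.
  by apply: cvg_expr; rewrite ger0_norm.
move=> [N0 _ h]; exists N0 => N /h /=.
by rewrite sub0r normrN ger0_norm// exprn_ge0.
Qed.

(** Makes the remainder of [tser_err] negligible. For b strictly between a and 1, [bin_geometric]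
    bounds the binomials times b^N uniformly in N, and (a/b)^N tends to 0. *)
Lemma bin_geometric_lt a m e : 0 <= a < 1 -> 0 < e -> exists N0, forall N, (N0 <= N)%N ->
  a ^+ N * (1 + \sum_(i < m) 'C(N + i, i.+1)%:R * 2 ^+ i.+1) < e.
Proof.
move=> /andP[a0 a1] e0; pose b := (1 + a) / 2.
have b01 : 0 < b < 1 by rewrite /b; apply/andP; split; lra.
have [b0 b1] := andP b01; have ab : 0 <= a / b < 1.
  by rewrite divr_ge0 ?(ltW b0)//= ltr_pdivrMr// mul1r /b; lra.
clearbody b; pose G := 1 + \sum_(i < m) (2 / (1 - b)) ^+ i.+1.
have G0 : 0 < G.
  by rewrite ltr_wpDr// sumr_ge0// => i _; rewrite exprn_ge0// divr_ge0// subr_ge0 ltW.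
have [N0 hN] := geometric_lt ab (divr_gt0 e0 G0).
exists N0 => N /hN; rewrite ltr_pdivlMr//; apply: le_lt_trans.
rewrite expr_div_n mulrAC ler_pdivlMr ?exprn_gt0// -mulrA ler_wpM2l ?exprn_ge0//.
rewrite mulrDl mulr_suml /G lerD//; first by rewrite mul1r exprn_ile1 ?ltW.
apply: ler_sum => i _; rewrite expr_div_n ler_pdivlMr; last first.
  by rewrite exprn_gt0// subr_gt0.
rewrite -mulrA -mulrA mulrCA ler_piMr ?exprn_ge0// mulrA.
have bb : 0 <= b <= 1 by rewrite !ltW.
apply: le_trans (bin_geometric i.+1 N bb).
rewrite -!mulrA ler_wpM2r ?mulr_ge0 ?exprn_ge0 ?subr_ge0 ?(ltW b0) ?(ltW b1)//.
by rewrite ler_nat addnS leq_bin2l// leqnSn.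
Qed.

Lemma rnorm_pos u : u != 0 -> 0 < rnorm u.
Proof.
by move=> u0; rewrite lt_neqAle rnorm_ge0 andbT eq_sym; apply: contra_neq u0 => /rnorm0_eq0.
Qed.

(** The Poisson kernel as a real part: the right side is affine in (1 - b w)^-1, whose sums over
    roots of unity are geometric. *)
Lemma re_inv_poisson b w : 0 <= b < 1 -> rnorm w = 1 ->
  (1 - b ^+ 2) / rnorm (1 - b%:C * w) ^+ 2 = 2 * complex.Re (1 - b%:C * w)^-1 - 1.
Proof.
move=> /andP[b0 b1] w1; have /rnorm_pos : 1 - b%:C * w != 0.
  rewrite subr_eq0; apply: contraTneq b1 => /(congr1 (@rnorm _ _)).
  by rewrite rnormM w1 mulr1 rnormC1 rnormC ger0_norm// => <-; rewrite ltxx.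
have w2 : complex.Re w ^+ 2 + complex.Im w ^+ 2 = 1 by rewrite -rnormC_sqr w1 expr1n.
move=> /(exprn_gt0 2); rewrite rnormC_sqr; case: w w1 w2 => c s /= _ w2.
rewrite !mul0r subr0 addr0 sub0r sqrrN => h2.
apply: (mulIf (lt0r_neq0 h2)); rewrite divfK ?gt_eqF// mulrBl.
rewrite -[2 * _ * _]mulrA divfK ?gt_eqF//.
rewrite (exprMn _ b s) (_ : s ^+ 2 = 1 - c ^+ 2); first by ring.
by rewrite -w2 addrAC subrr add0r.
Qed.

(** Over the N-th roots of unity the Poisson kernel has mean 2/(1 - b^N) - 1, at most 3 when b^N <=
    1/2. Dividing by 1 - b^2 >= 1 - b gives the bound. *)
Lemma sum_poisson b w N : (0 < N)%N -> 0 <= b < 1 -> b ^+ N <= 2^-1 ->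
  rnorm w = 1 -> w ^+ N = 1 -> (forall i, (0 < i < N)%N -> w ^+ i != 1) ->
  \sum_(l < N) (rnorm (1 - b%:C * w ^+ l) ^+ 2)^-1 <= 3 * N%:R / (1 - b).
Proof.
move=> N0 b01 bN w1 wN wi; have [b0 b1] := andP b01.
have wl1 l : rnorm (w ^+ l) = 1 by rewrite rnormX w1 expr1n.
have bN1 : 1 - b ^+ N != 0 by rewrite subr_eq0 eq_sym lt_eqF// (le_lt_trans bN)//; lra.
have bNC : 1 - (b ^+ N)%:C != 0 :> R[i].
  by rewrite -[1]/(1%:C) -rmorphB/= -[0]/(0%:C) (inj_eq (@complexI _)).
(* As (w^l)^N = 1, the geometric series folds into its first N terms. *)
have inv l : (1 - b%:C * w ^+ l)^-1 =
    (1 - b ^+ N)^-1%:C * \sum_(j < N) (b ^+ j)%:C * (w ^+ j) ^+ l.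
  have E : (1 - b%:C * w ^+ l) * (\sum_(j < N) (b ^+ j)%:C * (w ^+ j) ^+ l) = (1 - b ^+ N)%:C.
    rewrite (eq_bigr (fun j : 'I_N => (b%:C * w ^+ l) ^+ j)); last first.
      by move=> j _; rewrite exprMn -!exprM mulnC rmorphXn.
    rewrite -opprB mulNr -subrX1 opprB exprMn -exprM mulnC exprM wN expr1n mulr1.
    by rewrite rmorphB/= rmorphXn.
  have nz : 1 - b%:C * w ^+ l != 0.
    apply: contra_eq_neq E => ->; rewrite mul0r eq_sym.
    by rewrite -[0]/(0%:C) (inj_eq (@complexI _)).
  apply: (mulfI nz); rewrite divff// mulrCA E -rmorphM/= mulVf//.
have sumRe : \sum_(l < N) complex.Re (1 - b%:C * w ^+ l)^-1 = N%:R / (1 - b ^+ N).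
  have ReC (r : R) (z : R[i]) : complex.Re (r%:C * z) = r * complex.Re z.
    by case: z => c s /=; rewrite mul0r subr0.
  rewrite -Re_sum.
  under eq_bigr do rewrite inv.
  rewrite -mulr_sumr ReC exchange_big/= mulrC; congr (_ / _).
  rewrite (bigD1 (Ordinal N0))//= [X in _ + X]big1 ?addr0; last first.
    move=> j j0; rewrite -mulr_sumr (sum_root_unity _ wN wi)// ifN ?mulr0//.
    rewrite (eq_bigr (fun=> 1)) => [|l _]; last by rewrite mul1r expr1n.
  by rewrite sumr_const card_ord -[1]/(1%:C) -rmorphMn/=.
have b2 : 0 < 1 - b ^+ 2 by rewrite subr_gt0 expr_lt1.
rewrite ler_pdivlMr ?subr_gt0//.
apply: (@le_trans _ _ (\sum_(l < N) ((1 - b ^+ 2) / rnorm (1 - b%:C * w ^+ l) ^+ 2))).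
  rewrite mulr_suml ler_sum// => l _; rewrite mulrC ler_wpM2r ?invr_ge0 ?sqr_ge0//.
  by rewrite lerD2l lerN2 expr2 ler_piMl// ltW.
under eq_bigr do rewrite (re_inv_poisson b01 (wl1 _)).
rewrite sumrB -mulr_sumr sumRe.
rewrite sumr_const card_ord -[1 *+ N]/(N%:R) lerBlDr.
rewrite [leRHS](_ : _ = 2 * (N%:R * 2)); last by ring.
by rewrite ler_wpM2l// ler_wpM2l// -[leRHS]invrK lef_pV2 ?posrE ?invr_gt0//; lra.
Qed.

End discrete_averages.

(** * Ritt's inequality *)

Lemma bernoulli_exp (R : realDomainType) (b : R) n : 0 <= b /\ b <= 1 ->
  1 - n%:R * (1 - b) <= b ^+ n.
Proof.
move=> [b0 b1]; elim: n => [|n ih]; first by rewrite mul0r subr0 expr0.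
rewrite exprS; apply: le_trans (ler_wpM2l b0 ih); rewrite -natr1.
have : 0 <= n%:R * (1 - b) * (1 - b) by rewrite !mulr_ge0// subr_ge0.
lra.
Qed.

Section ritt.
Context {R : realType} {Y : normedModType R[i]} (Q : {linear Y -> Y}) (K : R).
Hypothesis K1 : 1 <= K.
Hypothesis Q_contr : forall y, rnorm (Q y) <= rnorm y.
Hypothesis Q_res : forall (u : R[i]) (v : Y), rnorm u < 1 ->
  rnorm (1 - u) * rnorm v <= K * rnorm (v - u *: Q v).
Implicit Types (u w : R[i]) (v y : Y) (a x : R) (k n N : nat).

Let K0 : 0 < K. Proof. exact: lt_le_trans ltr01 K1. Qed.

Local Notation P u := (1 - u *: 'X : {poly R[i]}).

Lemma pact_res u v : pact Q (P u) v = v - u *: Q v.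
Proof. by rewrite pactB pact1 pactZ -['X]expr1 pactXn. Qed.

Lemma pact_sub1X v : pact Q (1 - 'X) v = v - Q v.
Proof. by rewrite -['X]scale1r pact_res scale1r. Qed.

(** Trades |1 - u| for |1 - x u|. The excess 1 - x is paid by |v - u Q v| >= (1 - |u|) |v|, which
    holds because Q is a contraction. *)
Lemma ritt_low u v x : rnorm u < 1 -> x <= 1 -> 1 - x <= K * (1 - rnorm u) ->
  rnorm (1 - x%:C * u) * rnorm v <= 2 * K * rnorm (pact Q (P u) v).
Proof.
move=> u1 x1 xu; rewrite pact_res.
have h1 := Q_res v u1.
have h2 : (1 - rnorm u) * rnorm v <= rnorm (v - u *: Q v).
  rewrite mulrBl mul1r lerBlDr; apply: le_trans (rnormDle v (u *: Q v)) _.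
  by rewrite addrC lerD2l rnormZ ler_wpM2l ?rnorm_ge0.
have h3 : rnorm (1 - x%:C * u) <= rnorm (1 - u) + (1 - x).
  rewrite (_ : 1 - _ = (1 - u) + (1 - x)%:C * u); last by rewrite rmorphB/=; ring.
  rewrite (le_trans (rnormD _ _))// lerD2l rnormM rnormC ger0_norm ?subr_ge0//.
  by rewrite ler_piMr ?subr_ge0// ltW.
apply: le_trans (ler_wpM2r (rnorm_ge0 v) h3) _.
rewrite mulrDl -mulrA mulr_natl mulr2n lerD//.
apply: le_trans (ler_wpM2r (rnorm_ge0 v) xu) _.
by rewrite -mulrA ler_wpM2l// ltW.
Qed.

(** From u (1 - Q) = (1 - u Q) - (1 - u): each factor 1 - Q is exchanged for a factor 1 - u Q at the
    cost 1 + K. *)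
Lemma ritt_diff u v k : rnorm u < 1 ->
  rnorm u ^+ k * rnorm (pact Q ((1 - 'X) ^+ k) v) <=
  (1 + K) ^+ k * rnorm (pact Q (P u ^+ k) v).
Proof.
move=> u1; elim: k v => [|k ih] v; first by rewrite !expr0 !mul1r.
rewrite [(1 - 'X) ^+ _]exprS pactM pact_sub1X [rnorm u ^+ _]exprSr -mulrA.
set z := pact Q ((1 - 'X) ^+ k) v.
have h : rnorm u * rnorm (z - Q z) <= (1 + K) * rnorm (pact Q (P u) z).
  rewrite -rnormZ pact_res mulrDl mul1r (_ : _ *: _ = (z - u *: Q z) - (1 - u) *: z).
    by rewrite (le_trans (rnorm_subr _ _))// lerD2l rnormZ Q_res.
  by rewrite scalerBr scalerBl scale1r opprB [RHS]addrC addrA subrK.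
apply: (@le_trans _ _ (rnorm u ^+ k * ((1 + K) * rnorm (pact Q (P u) z)))).
  by rewrite ler_wpM2l// exprn_ge0// rnorm_ge0.
rewrite mulrCA exprS -!mulrA ler_wpM2l ?addr_ge0 ?(ltW K0)//.
rewrite /z -pactM [P u * _]mulrC pactM (le_trans (ih _))//.
by rewrite exprSr pactM.
Qed.

Lemma iter_contr n y : rnorm (iter n Q y) <= rnorm y.
Proof. by elim: n => // n ih; apply: le_trans (Q_contr _) ih. Qed.

Lemma pact_res_le u v k : rnorm u <= 1 ->
  rnorm (pact Q (P u ^+ k) v) <= 2 ^+ k * rnorm v.
Proof.
move=> u1; elim: k => [|k ih]; first by rewrite !expr0 mul1r pact1.
rewrite [P u ^+ _]exprS pactM pact_res exprS -mulrA mulr_natl mulr2n.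
rewrite (le_trans (rnorm_subr _ _))// lerD// rnormZ.
apply: le_trans ih; rewrite (le_trans _ (Q_contr _))//.
by rewrite ler_piMl// rnorm_ge0.
Qed.

(** The second hypothesis makes the remainder of [tser_err] at most |y|; its powers of 2 bound the
    norms of the powers of 1 - u Q. *)
Lemma tser_err_le m N u y : rnorm u < 1 ->
  rnorm u ^+ N * (1 + \sum_(i < m) 'C(N + i, i.+1)%:R * 2 ^+ i.+1) <= 1 ->
  rnorm (pact Q (P u ^+ m.+1 * tser m N (u *: 'X)) y) <= 2 * rnorm y.
Proof.
move=> u1 err; rewrite tser_err pactB pact1 mulr_natl mulr2n.
rewrite (le_trans (rnorm_subr _ _))// lerD2l.
rewrite exprZn -scalerAl pactZ pactXnM rnormZ rnormX.
apply: le_trans (ler_wpM2l (exprn_ge0 _ (rnorm_ge0 _)) (iter_contr _ _)) _.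
apply: (@le_trans _ _ (rnorm u ^+ N *
    ((1 + \sum_(i < m) 'C(N + i, i.+1)%:R * 2 ^+ i.+1) * rnorm y))); last first.
  by rewrite mulrA ler_piMl// rnorm_ge0.
rewrite ler_wpM2l ?exprn_ge0 ?rnorm_ge0//.
rewrite pactD pact1 (le_trans (rnormD _ _))// mulrDl mul1r lerD2l.
rewrite pact_sum (le_trans (rnorm_sum _ _ _))// mulr_suml ler_sum// => i _.
rewrite mulr_natl -scaler_nat pactZ rnormZ rnormC_nat -mulrA ler_wpM2l//.
exact/pact_res_le/ltW.
Qed.

(* The n-th Taylor coefficient of [tser m N (u *: 'X)] is extracted by
   averaging over the N-th roots of unity. *)
Lemma tser_average m n N a w y : (n < N)%N -> w ^+ N = 1 ->
  (forall i, (0 < i < N)%N -> w ^+ i != 1) ->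
  \sum_(l < N) (w ^+ l) ^+ (N - n) *: pact Q (tser m N ((a%:C * w ^+ l) *: 'X)) y =
  (N%:R * 'C(n + m, m)%:R * a ^+ n)%:C *: iter n Q y.
Proof.
move=> nN wN wi; pose c (j : nat) : R[i] := 'C(j + m, m)%:R * a%:C ^+ j.
transitivity (\sum_(l < N) \sum_(j < N)
    (c j * (w ^+ ((N - n + j) %% N)%N) ^+ l) *: iter j Q y).
  apply: eq_bigr => l _; rewrite pact_sum scaler_sumr; apply: eq_bigr => j _.
  rewrite exprZn mulr_natl -scaler_nat pactZ pactZ pactXn !scalerA; congr (_ *: _).
  rewrite exprMn /c -!exprM mulrCA [X in _ * X]mulrCA mulrA; congr (_ * _).
  by rewrite -exprD -mulnDr mulnC exprM -[in LHS](expr_mod _ wN) -exprM.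
have N0 : (0 < N)%N by lia.
rewrite exchange_big/=.
(* Only j = n gives an exponent divisible by N, so orthogonality keeps that term alone. *)
have e j : (j < N)%N -> (((N - n + j) %% N)%N == 0%N) = (j == n).
  move=> jN; have [->|] := eqVneq j n; first by rewrite subnK ?modnn// ltnW.
  move=> /eqP jn; apply/negbTE/eqP => /eqP /dvdnP [[|[|q]]]; lia.
rewrite (bigD1 (Ordinal nN))//= [X in _ + X]big1 ?addr0; last first.
  move=> j jn; rewrite -scaler_suml -mulr_sumr (sum_root_unity _ wN wi) ?ltn_pmod//.
  by rewrite e//= ifN ?mulr0 ?scale0r.
rewrite -scaler_suml -mulr_sumr (sum_root_unity _ wN wi) ?ltn_pmod//.
rewrite e// eqxx; congr (_ *: _).
by rewrite /c mulrC mulrA !rmorphM/= rmorphXn/= !rmorph_nat.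
Qed.

(** The n-th coefficient of the truncated (1 - u Q)^-(k+2) y is averaged over |u| = a. Of the k + 2
    factors, k absorb (1 - Q)^k by [ritt_diff], and two yield |1 - x u|^-2, which [sum_poisson]
    averages. *)
Lemma ritt_bound n k y : (0 < n)%N -> K <= (n + k)%:R *+ 2 ->
  'C(n + k.+1, k.+1)%:R * rnorm (pact Q ((1 - 'X) ^+ k) (iter n Q y)) <=
  192 * K * (1 + K) ^+ k * (n + k)%:R * rnorm y.
Proof.
move=> n0; have : exists2 p : R, p = (n + k)%:R *+ 2 & 2 <= p.
  by exists ((n + k)%:R *+ 2) => //; rewrite -mulrnA ler_nat; lia.
move=> [p pE p2]; rewrite -pE => Kp.
(* With p = 2(n + k), a^(n+k) stays above 1/2. As K <= p, the value 1 - x = K/(p + K) lies between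
   K/(2p) and K (1 - a): large enough for a Poisson mean of order p/K, small enough for
   [ritt_low]. *)
pose a := 1 - p^-1; pose x := p / (p + K).
have p0 : 0 < p by lra.
have pV : 0 < p^-1 <= 2^-1 by rewrite invr_gt0 p0 lef_pV2// posrE.
have a01 : 0 <= a < 1 by rewrite /a; lra.
have pK0 : 0 < p + K by rewrite addr_gt0.
have x1 : 1 - x = K / (p + K).
  by rewrite /x -[X in X - _](@divff _ (p + K)) ?gt_eqF// -mulrBl addrAC subrr add0r.
have xK : K / (2 * p) <= 1 - x.
  by rewrite x1 ler_wpM2l ?(ltW K0)// lef_pV2 ?posrE//; lra.
have x1' : 0 < 1 - x by rewrite x1 divr_gt0.
have xa : 1 - x <= K * (1 - a).
  rewrite x1 /a opprB addrCA subrr addr0 ler_wpM2l ?(ltW K0)// lef_pV2 ?posrE//.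
  by rewrite lerDl (ltW K0).
have x0 : 0 <= x by rewrite /x divr_ge0 ?ltW.
have [a0 a1] := andP a01; have ax : x * a <= x by rewrite ler_piMr// ltW.
have b01 : 0 <= x * a < 1 by rewrite mulr_ge0//=; lra.
have aE : a = 1 - p^-1 by [].
have x_lt1 : x < 1 by lra.
clearbody x a.
have [N1 hN1] := bin_geometric_lt k.+1 a01 ltr01.
have [N2 hN2] := @geometric_lt R (x * a) 2^-1 b01 (ltac:(lra)).
pose N := (maxn n.+1 (maxn N1 N2))%N.
have nN : (n < N)%N by rewrite leq_maxl.
have N0 : (0 < N)%N by rewrite (leq_trans _ nN).
have N1N : (N1 <= N)%N by rewrite /N !leq_max leqnn orbT.
have N2N : (N2 <= N)%N by rewrite /N !leq_max leqnn !orbT.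
have NR0 : (0 : R) < N%:R by rewrite ltr0n.
clearbody N; set w := cis (pi *+ 2 / N%:R : R).
have [wN wi] : w ^+ N = 1 /\ forall j, (0 < j < N)%N -> w ^+ j != 1 by exact: cis_root_prim.
have w1 : rnorm w = 1 by rewrite rnorm_cis.
have wl1 l : rnorm (w ^+ l) = 1 by rewrite rnormX w1 expr1n.
have ul l : rnorm (a%:C * w ^+ l) = a by rewrite rnormM wl1 mulr1 rnormC ger0_norm.
have pois := sum_poisson N0 b01 (ltW (hN2 _ N2N)) w1 wN wi.
pose H l := pact Q (tser k.+1 N ((a%:C * w ^+ l) *: 'X)) y.
(* The constant 8 K^2 is (2K)^2 from two uses of [ritt_low] times 2 from [tser_err_le]. *)
have Hl l : a ^+ k * rnorm (pact Q ((1 - 'X) ^+ k) (H l)) <=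
    (8 * K ^+ 2 * (1 + K) ^+ k * rnorm y) * (rnorm (1 - (x * a)%:C * w ^+ l) ^+ 2)^-1.
  set u := a%:C * w ^+ l; have u1 : rnorm u < 1 by rewrite ul.
  have xle1 := ltW x_lt1.
  have xu : 1 - x <= K * (1 - rnorm u) by rewrite ul.
  have xau : (x * a)%:C * w ^+ l = x%:C * u by rewrite rmorphM mulrA.
  have np : 0 < rnorm (1 - (x * a)%:C * w ^+ l).
    apply: rnorm_pos; rewrite subr_eq0; apply/eqP => /(congr1 (@rnorm _ _)).
    rewrite rnormM wl1 rnormC rnormC1 mulr1 ger0_norm ?mulr_ge0// => xa1.
    by move: b01; rewrite -xa1 ltxx andbF.
  rewrite xau in np *; rewrite ler_pdivlMr ?exprn_gt0//.
  have := ritt_diff (H l) k u1; rewrite ul => h.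
  apply: (@le_trans _ _ ((1 + K) ^+ k * rnorm (pact Q (P u ^+ k) (H l)) *
      rnorm (1 - x%:C * u) ^+ 2)); first by rewrite ler_wpM2r ?sqr_ge0.
  have l1 := ritt_low (pact Q (P u ^+ k) (H l)) u1 xle1 xu.
  have l2 := ritt_low (pact Q (P u ^+ k.+1) (H l)) u1 xle1 xu.
  rewrite -pactM -exprS in l1; rewrite -pactM -exprS in l2.
  have l3 : rnorm (pact Q (P u ^+ k.+2) (H l)) <= 2 * rnorm y.
    by rewrite /H -pactM; apply: tser_err_le => //; rewrite ul; apply/ltW/hN1.
  have K1k : 0 <= (1 + K) ^+ k by rewrite exprn_ge0// addr_ge0// ltW.
  rewrite [leRHS](_ : _ = (1 + K) ^+ k * (2 * K * (2 * K * (2 * rnorm y)))); last by ring.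
  rewrite -mulrA ler_wpM2l// expr2 mulrA mulrAC [X in X * _]mulrC.
  apply: le_trans (ler_wpM2r (ltW np) l1) _.
  rewrite -[leLHS]mulrA ler_wpM2l ?mulr_ge0 ?(ltW K0)// mulrC.
  by apply: le_trans l2 _; rewrite ler_wpM2l ?mulr_ge0 ?(ltW K0).
have avg : N%:R * 'C(n + k.+1, k.+1)%:R * a ^+ (n + k) *
    rnorm (pact Q ((1 - 'X) ^+ k) (iter n Q y)) <=
    (8 * K ^+ 2 * (1 + K) ^+ k * rnorm y) * (3 * N%:R / (1 - x * a)).
  have := tser_average k.+1 a y nN wN wi => /(congr1 (pact Q ((1 - 'X) ^+ k))).
  rewrite [RHS in _ = RHS -> _]linearZ linear_sum/= => /(congr1 (@rnorm _ _)).
  rewrite rnormZC ger0_norm; last by rewrite !mulr_ge0// exprn_ge0.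
  rewrite exprD mulrA [_ * a ^+ k]mulrC -[leLHS]mulrA => <-.
  apply: le_trans (ler_wpM2l (exprn_ge0 _ a0) (rnorm_sum _ _ _)) _.
  rewrite mulr_sumr; apply: (@le_trans _ _ (\sum_(l < N)
    (8 * K ^+ 2 * (1 + K) ^+ k * rnorm y) * (rnorm (1 - (x * a)%:C * w ^+ l) ^+ 2)^-1)).
    by apply: ler_sum => l _; rewrite linearZ rnormZ rnormX wl1 expr1n mul1r Hl.
  by rewrite -mulr_sumr ler_wpM2l// !mulr_ge0 ?rnorm_ge0 ?exprn_ge0 ?addr_ge0 ?(ltW K0).
have ank : 2^-1 <= a ^+ (n + k).
  apply: le_trans (bernoulli_exp (n + k) (conj a0 (ltW a1))).
  rewrite aE opprB addrCA subrr addr0 pE -[(n + k)%:R *+ 2](mulr_natr (n + k)%:R 2) invfM mulrA divff ?mul1r; first by lra.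
  by rewrite pnatr_eq0 addn_eq0 negb_and -lt0n n0.
set Z := rnorm (pact Q _ _) in avg *; set B : R := 'C(_, _)%:R in avg *.
have Z0 : 0 <= Z by exact: rnorm_ge0.
have B0 : 0 <= B by [].
have [G0 y0] : 0 <= (1 + K) ^+ k /\ 0 <= rnorm y.
  by rewrite rnorm_ge0 exprn_ge0// addr_ge0// ltW.
have h1 : (1 - x * a)^-1 <= 2 * p / K.
  rewrite -[leRHS]invrK lef_pV2 ?posrE ?invf_div ?divr_gt0 ?mulr_gt0//; last by lra.
  by apply: le_trans xK _; lra.
have h2 : B * Z <= 2 * (B * a ^+ (n + k) * Z).
  rewrite [leRHS](_ : _ = (2 * a ^+ (n + k)) * (B * Z)); last by ring.
  by rewrite ler_peMl ?mulr_ge0//; lra.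
have h3 : B * a ^+ (n + k) * Z <= 24 * K ^+ 2 * (1 + K) ^+ k * rnorm y * (1 - x * a)^-1.
  rewrite -(ler_pM2l NR0) [leLHS]mulrA [N%:R * (_ * _)]mulrA (le_trans avg)//.
  by rewrite le_eqVlt; apply/orP; left; apply/eqP; ring.
apply: le_trans h2 _; rewrite -ler_pdivlMl//; apply: le_trans h3 _.
apply: (@le_trans _ _ (24 * K ^+ 2 * (1 + K) ^+ k * rnorm y * (2 * p / K))).
  by rewrite ler_wpM2l// mulr_ge0// mulr_ge0// mulr_ge0// exprn_ge0// ltW.
by rewrite pE expr2 le_eqVlt; apply/orP; left; apply/eqP; field; rewrite gt_eqF.
Qed.

End ritt.

(** * Resolvent bound *)

Lemma abs_sin_le (R : realType) (x : R) : 0 <= x -> sin x <= x.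
Proof.
move=> x0; have dsin y : y \in `]0, x[ -> is_derive y 1 (@sin R) (cos y).
  by move=> ?; exact: is_derive_sin.
have [c _] := MVT_segment x0 dsin (continuous_subspaceT (@continuous_sin R)).
rewrite sin0 !subr0 => ->.
by rewrite ler_piMl// cos_le1.
Qed.

Lemma one_sub_cos_le (R : realType) (x : R) : 0 <= x <= pi -> 1 - cos x <= x ^+ 2 / 2.
Proof.
move=> /andP[x0 xpi]; rewrite {1}(_ : x = (x / 2) *+ 2); last by rewrite -mulr_natr divfK.
rewrite cos_mulr2n cos2sin2 (_ : _ - _ = 2 * sin (x / 2) ^+ 2); last by ring.
have s0 : 0 <= sin (x / 2) by apply: sin_ge0_pi; apply/andP; split; lra.
have sx : sin (x / 2) <= x / 2 by apply: abs_sin_le; lra.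
have : sin (x / 2) ^+ 2 <= (x / 2) ^+ 2 by rewrite ler_pXn2r// nnegrE; lra.
by rewrite expr_div_n; lra.
Qed.

Section resolvent.
Context {R : realType} {Y : normedModType R[i]} (S : {linear Y -> Y}) (e : R).
Hypothesis e01 : 0 < e <= 1.
Hypothesis S_contr : forall y, rnorm (S y) <= rnorm y.
Hypothesis S_far : forall m y, (0 < m)%N ->
  rnorm (y - iter m S y) <= (2 - 2 * e) * rnorm y.

(** Telescoping of z^m - S^m into m terms, each bounded by |z|^m since |z| >= 1. *)
Lemma power_resolvent (z : R[i]) m v : 1 <= rnorm z ->
  rnorm (z ^+ m *: v - iter m S v) <= m%:R * rnorm z ^+ m * rnorm (z *: v - S v).
Proof.
move=> z1; elim: m v => [|m ih] v.
  by rewrite !mul0r expr0 scale1r subrr rnorm0.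
rewrite (_ : _ - _ = z ^+ m *: (z *: v - S v) + (z ^+ m *: S v - iter m S (S v))); last first.
  by rewrite scalerBr scalerA -exprSr addrA subrK iterSr.
apply: le_trans (rnormD _ _) _; rewrite rnormZ rnormX -natr1 mulrDl mul1r mulrDl addrC.
have zm : rnorm z ^+ m <= rnorm z ^+ m.+1 by rewrite ler_weXn2l.
have zm0 : 0 <= rnorm z ^+ m by rewrite exprn_ge0// rnorm_ge0.
apply: lerD; last by rewrite ler_wpM2r ?rnorm_ge0.
apply: le_trans (ih _) _; apply: ler_pM; rewrite ?mulr_ge0 ?rnorm_ge0//.
  by rewrite ler_wpM2l.
by rewrite -linearZ -linearB S_contr.
Qed.

(* The power m = floor (pi / |arg z|) of z is close to the negative real axis,
   so that 1 - z ^ m is almost 2 in modulus, whereas |1 - S ^ m| <= 2 - 2e. *)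
Lemma resolvent_bound (z : R[i]) v : 1 <= rnorm z ->
  rnorm (z - 1) ^+ 2 <= 2 * (rnorm z ^+ 2 - 1) ->
  rnorm (z - 1) * rnorm v <= 18 / e * rnorm (z *: v - S v).
Proof.
have [e0 e1] := andP e01.
move=> z1; set r := rnorm (z - 1); set V := rnorm v.
set h := rnorm (z *: v - S v); set p := rnorm z in z1 * => r2.
have r0 : 0 <= r := rnorm_ge0 _. have V0 : 0 <= V := rnorm_ge0 _.
have h0 : 0 <= h := rnorm_ge0 _.
have ph : (p - 1) * V <= h.
  rewrite mulrBl mul1r lerBlDr -rnormZ.
  apply: le_trans (rnormDle _ (S v)) _; rewrite addrC lerD2l.
  exact: S_contr.
have rp : r <= p + 1 by apply: le_trans (rnorm_subr _ _) _; rewrite rnormC1.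
(* When |z| - 1 is at least e r/18, contractivity of S suffices. Otherwise the hypothesis on r^2
   forces r <= e/3, so z is near 1 and almost on the unit circle. *)
have [pr|pr] := leP (e * r) (18 * (p - 1)).
  rewrite mulrAC ler_pdivlMr//.
  apply: (@le_trans _ _ (18 * ((p - 1) * V))); last by rewrite ler_wpM2l.
  by rewrite mulrA mulrC mulrA ler_wpM2r.
have rpos : 0 < r by rewrite -(pmulr_rgt0 _ e0); lra.
have er : e * r <= r by rewrite ler_piMl.
have r3 : r < 3 by lra.
have re : 3 * r <= e.
  have : r ^+ 2 * 9 <= 3 * (e * r) by nra.
  by rewrite expr2; nra.
have [t0 [t1 t2 zt]] := polar z; pose t := `|t0|.
have tpi : t <= pi by rewrite /t ler_norml t2 ltW.
have cost : cos t = cos t0 by rewrite cos_norm.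
pose d := rnorm (cis t0 - 1); have d0 : 0 <= d := rnorm_ge0 _.
have d2 : d ^+ 2 = 2 - 2 * cos t.
  rewrite /d rnormC_sqr/= cost subr0; have := cos2Dsin2 t0; lra.
have zc : rnorm (z - cis t0) = p - 1.
  rewrite zt -/p -[X in _ - X]mul1r -mulrBl rnormM rnorm_cis mulr1.
  by rewrite -[1]/(1%:C) -rmorphB/= rnormC ger0_norm ?subr_ge0.
have rd : r <= (p - 1) + d by rewrite -zc; exact: rnorm_triangle.
have dr : d <= (p - 1) + r by rewrite -zc rnormB; exact: rnorm_triangle.
have tt : d <= t.
  rewrite -(@ler_pXn2r _ 2)// ?nnegrE ?normr_ge0// d2.
  have : 1 - cos t <= t ^+ 2 / 2 by apply: one_sub_cos_le; rewrite normr_ge0.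
  lra.
have tr : 17 * r <= 18 * t by lra.
have tpos : 0 < t by lra.
have pit : 0 <= pi / t by rewrite divr_ge0 ?pi_ge0// ltW.
pose m := Num.trunc (pi / t); have /andP[m1 m2] := truncn_itv pit.
have m0 : (0 < m)%N by rewrite truncn_gt0 ler_pdivlMr// mul1r.
rewrite -/m in m1 m2; rewrite ler_pdivlMr// in m1; rewrite ltr_pdivrMr// in m2.
have mr : m%:R * r <= 5.
  have : m%:R * (17 * r) <= 18 * (m%:R * t) by rewrite [leRHS]mulrCA ler_wpM2l.
  have := pihalf_lt2 R; lra.
(* By the choice of m, pi - m t lies in [0, t), and cos decreases on [0, pi]. *)
have cosm : cos (m%:R * t) <= - cos t.
  rewrite -[m%:R * t](subKr pi) cosB cospi sinpi mul0r addr0 mulN1r lerN2.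
  rewrite -natr1 mulrDl mul1r in m2.
  have [->//|ne] := eqVneq (pi - m%:R * t) t.
  have A : pi - m%:R * t \in `[0, pi].
    have : 0 <= m%:R * t by rewrite mulr_ge0// ltW.
    by rewrite in_itv/= => ?; apply/andP; split; lra.
  have B : t \in `[0, pi] by rewrite in_itv/= tpi ltW.
  by apply: ltW; rewrite ltr_cos//; lra.
have cos1 : 1 - r ^+ 2 <= cos t.
  have : d ^+ 2 <= (19 / 18 * r) ^+ 2 by rewrite ler_pXn2r ?nnegrE//; lra.
  by rewrite exprMn d2; have := sqr_ge0 r; lra.
have r21 : r ^+ 2 <= e by rewrite expr2; nra.
have pm1 : 1 <= p ^+ m by rewrite exprn_ege1.
(* Since p - 1 < x = e r/18, one has p (1 - x) <= 1, and Bernoulli gives (1 - x)^m >= 1 - m x >=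
   1/2. *)
have pm2 : p ^+ m <= 2.
  pose x := e * r / 18; have x01 : 0 <= 1 - x /\ 1 - x <= 1.
    by rewrite /x; split; have := mulr_ge0 (ltW e0) r0; lra.
  have := bernoulli_exp m x01; rewrite opprB addrCA subrr addr0 => b1.
  have b2 : p ^+ m * (1 - x) ^+ m <= 1.
    rewrite -exprMn exprn_ile1//; first by rewrite mulr_ge0//; lra.
    by rewrite /x; nra.
  have mx : m%:R * x <= 2^-1.
    rewrite /x mulrA; have : m%:R * (e * r) <= m%:R * r by rewrite ler_wpM2l.
    by lra.
  have : p ^+ m * 2^-1 <= 1 by apply: le_trans b2; rewrite ler_wpM2l; lra.
  by lra.
have Rezm : 2 - r ^+ 2 <= rnorm (1 - z ^+ m).
  apply: le_trans (Re_le_rnorm _); rewrite zt -/p exprMn cisX -rmorphXn/=.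
  rewrite mul0r subr0.
  have -> : cos (m%:R * t0) = cos (m%:R * t).
    by rewrite -cos_norm normrM ger0_norm.
  have : p ^+ m * cos (m%:R * t) <= - (cos t).
    apply: (@le_trans _ _ (p ^+ m * - cos t)); first by rewrite ler_wpM2l//; lra.
    by rewrite mulrN lerN2 ler_peMl//; nra.
  lra.
have key := S_far v m0.
have : rnorm ((1 - z ^+ m) *: v) <= (2 - 2 * e) * V + m%:R * p ^+ m * h.
  rewrite (_ : _ *: v = (v - iter m S v) - (z ^+ m *: v - iter m S v)).
    by rewrite (le_trans (rnorm_subr _ _))// lerD// power_resolvent.
  by rewrite scalerBl scale1r opprB addrA subrK.
rewrite rnormZ -/V => k1.
(* |1 - z^m| >= 2 - r^2 >= 2 - e exceeds the gap bound 2 - 2e by e. *)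
have k2 : e * V <= m%:R * p ^+ m * h.
  have : (2 - r ^+ 2) * V <= rnorm (1 - z ^+ m) * V by rewrite ler_wpM2r.
  have : (2 * e - r ^+ 2) * V >= e * V by rewrite ler_wpM2r//; lra.
  by lra.
rewrite mulrAC ler_pdivlMr//.
have k3 : r * (e * V) <= r * (m%:R * p ^+ m * h) by rewrite ler_wpM2l.
have k4 : (m%:R * r) * (p ^+ m * h) <= 5 * (2 * h).
  by apply: ler_pM; rewrite ?mulr_ge0 ?ler_wpM2r//; lra.
by lra.
Qed.

End resolvent.

Section half_sum.
Context {R : realType} {Y : normedModType R[i]} (S : {linear Y -> Y}).
Hypothesis S_contr : forall y, rnorm (S y) <= rnorm y.

Definition half_sum (y : Y) : Y := (2^-1)%:C *: (y + S y).

Lemma half_sum_linear : linear half_sum.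
Proof.
move=> a x y; rewrite /half_sum scalerA [a * _]mulrC -scalerA -scalerDr linearP.
by rewrite [a *: (x + _)]scalerDr addrACA.
Qed.

HB.instance Definition _ :=
  GRing.isLinear.Build R[i] Y Y *:%R half_sum half_sum_linear.

Lemma half_sum_contr y : rnorm (half_sum y) <= rnorm y.
Proof.
rewrite rnormZC ger0_norm ?invr_ge0// ler_pdivrMl//.
by rewrite mulr_natl mulr2n (le_trans (rnormD _ _))// lerD2l.
Qed.

Lemma half_sum_res (e : R) : 0 < e <= 1 ->
  (forall m y, (0 < m)%N -> rnorm (y - iter m S y) <= (2 - 2 * e) * rnorm y) ->
  forall (u : R[i]) v, rnorm u < 1 ->
  rnorm (1 - u) * rnorm v <= 18 / e * rnorm (v - u *: half_sum v).
Proof.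
move=> e01 S_far u v u1; have [e0 e1] := andP e01.
have [->|u0] := eqVneq u 0.
  rewrite subr0 rnormC1 mul1r scale0r subr0 ler_peMl ?rnorm_ge0//.
  by rewrite ler_pdivlMr// mul1r; lra.
(* This z makes 1 - u Q equal to (u/2)(z - S), and |u| <= 1 is equivalent to |z - 1|^2 <= 2 (|z|^2 -
   1). *)
pose z := 2 * u^-1 - 1; have up := rnorm_pos u0.
have uz : (u * 2^-1) * (z - 1) = 1 - u.
  by rewrite /z; field; rewrite u0.
have u2 : rnorm (1 - u) ^+ 2 <= 2 - 2 * complex.Re u.
  move: u1; rewrite -(@ltr_pXn2r _ 2)// ?nnegrE ?rnorm_ge0// expr1n !rnormC_sqr/=.
  by case: (u) => a b/=; nra.
have uz2 : rnorm u * rnorm (z + 1) = 2.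
  by rewrite -rnormM /z subrK mulrCA divff// mulr1 rnormC_nat.
have zz : rnorm (z - 1) ^+ 2 <= 2 * (rnorm z ^+ 2 - 1).
  rewrite -(@ler_pM2l _ (rnorm u ^+ 2)) ?exprn_gt0//.
  have E1 : rnorm u ^+ 2 * rnorm (z - 1) ^+ 2 = 4 * rnorm (1 - u) ^+ 2.
    by rewrite -uz !rnormM rnormV rnormC_nat; field.
  have E2 : rnorm u ^+ 2 * rnorm z ^+ 2 = rnorm (2 - u) ^+ 2.
    rewrite -exprMn -rnormM; congr (rnorm _ ^+ 2); rewrite /z; field; exact: u0.
  rewrite E1 [leRHS](_ : _ = 2 * (rnorm (2 - u) ^+ 2 - rnorm u ^+ 2)); last first.
    by rewrite -E2; ring.
  move: u1; rewrite -(@ltr_pXn2r _ 2)// ?nnegrE ?rnorm_ge0// expr1n !rnormC_sqr.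
  by case: (u) => a b/=; nra.
have z1 : 1 <= rnorm z.
  rewrite -(@ler_pXn2r _ 2)// ?nnegrE ?rnorm_ge0// expr1n.
  by have := sqr_ge0 (rnorm (z - 1)); lra.
have := resolvent_bound e01 S_contr S_far v z1 zz.
rewrite -(@ler_pM2l _ (rnorm (u * 2^-1))); last by rewrite rnormM rnormV rnormC_nat; lra.
rewrite mulrA -rnormM uz => /le_trans; apply.
rewrite mulrCA -rnormZ le_eqVlt; apply/orP; left; apply/eqP; congr (_ * rnorm _).
rewrite /half_sum scalerBr scalerA (_ : u * 2^-1 * z = 1 - u / 2); last first.
  by rewrite /z; field; exact: u0.
rewrite scalerBl scale1r scalerA -addrA -opprD scalerDr.
have -> : (2^-1)%:C = 2^-1 :> R[i] by rewrite fmorphV rmorph_nat.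
by [].
Qed.

End half_sum.

(** * Derivatives of a contraction semigroup *)

(** Turns the binomial of [ritt_bound] into a power n^k; the factor n + k cancels the one on the
    right side there. *)
Lemma bin_ge n k : ((n + k) * n ^ k <= k.+1`! * 'C(n + k.+1, k.+1))%N.
Proof.
rewrite mulnC -[leqRHS]mulnC bin_ffact addnS ffactnS/= mulnC leq_mul//.
by elim: k => [|k ih]; rewrite ?expn0 ?ffactn0// addnS ffactSS expnS leq_mul// leqW// leq_addr.
Qed.

(** The interface between the two halves of the proof: the operator theory starts from these
    properties, and the coupling inequality supplies [csg_far]. *)
Record contraction_semigroup (R : realType) (Y : normedModType R[i])
    (T : R -> {linear Y -> Y}) (e : R) : Prop := {
  csg_pos : 0 < e <= 1 ;
  csg_contr : forall t y, 0 < t -> rnorm (T t y) <= rnorm y ;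
  csg_mul : forall s t y, 0 < s -> 0 < t -> T s (T t y) = T (s + t) y ;
  csg_cvg0 : forall y (eta : R), 0 < eta ->
    exists2 r : R, 0 < r & forall t, 0 < t < r -> rnorm (T t y - y) < eta ;
  csg_far : forall t y, 0 < t -> rnorm (y - T t y) <= (2 - 2 * e) * rnorm y
}.

Section semigroup_differences.
Context {R : realType} {Y : normedModType R[i]} (T : R -> {linear Y -> Y}) (e : R).
Hypothesis sg : contraction_semigroup T e.
Implicit Types (a b c r s t h eta C : R) (y v : Y) (k l m n : nat).
Let e01 := csg_pos sg.
Let T_contr := csg_contr sg.
Let T_mul := csg_mul sg.
Let T_cvg0 := csg_cvg0 sg.

Let K := 18 / e.
Let K1 : 1 <= K.
Proof. by have [e0 e1] := andP e01; rewrite /K ler_pdivlMr// mul1r; lra. Qed.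

Definition sg_diff s v : Y := v - T s v.

Lemma sg_diff_linear s : linear (sg_diff s).
Proof. by move=> a x y; rewrite /sg_diff linearP scalerBr opprD addrACA. Qed.

HB.instance Definition _ s :=
  GRing.isLinear.Build R[i] Y Y *:%R (sg_diff s) (sg_diff_linear s).

Lemma sg_iter h m y : 0 < h -> iter m.+1 (T h) y = T (m.+1%:R * h) y.
Proof.
move=> h0; elim: m => [|m ih]; first by rewrite mul1r.
by rewrite iterS ih T_mul ?mulr_gt0// -[m.+2%:R]natr1 mulrDl mul1r addrC.
Qed.

(** [T] carries no information at time 0, where the semigroup is the identity; binomial times can
    take this value. *)
Let W y t := if 0 < t then T t y else y.

Let W_mul y h t : 0 < h -> 0 <= t -> T h (W y t) = W y (t + h).
Proof.
move=> h0; rewrite le_eqVlt /W => /predU1P[<-|t0].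
  by rewrite ltxx add0r h0.
by rewrite t0 addr_gt0// T_mul// addrC.
Qed.

Let W_contr x y t : rnorm (W x t - W y t) <= rnorm (x - y).
Proof. by rewrite /W; case: ifPn => // t0; rewrite -linearB T_contr. Qed.

Let W_dist y a b r eta : (forall t, 0 < t < r -> rnorm (T t y - y) < eta) ->
  0 <= eta -> 0 <= a <= b -> b - a < r -> rnorm (W y b - W y a) <= eta.
Proof.
move=> yr eta0 /andP[a0]; rewrite le_eqVlt => /predU1P[->|ab] bar.
  by rewrite subrr rnorm0.
have ba0 : 0 < b - a by rewrite subr_gt0.
rewrite (_ : W y b = W (T (b - a) y) a).
  by apply: le_trans (W_contr _ _ _) _; apply/ltW/yr; rewrite ba0.
have b0 := le_lt_trans a0 ab.
rewrite /W b0; case: ifPn => [a1|]; first by rewrite T_mul// addrC subrK.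
by rewrite -leNgt => a1; rewrite (@le_anti _ _ a 0) ?subr0// a0 a1.
Qed.

(** Continuity in the form used by Chebyshev's inequality: eta near t, and a quadratic weight
    dominating the trivial bound 2 |y| elsewhere. *)
Let W_quad y t eta : 0 < t -> 0 < eta -> exists2 C, 0 <= C &
  forall a, 0 <= a -> rnorm (W y a - W y t) <= eta + C * (a - t) ^+ 2.
Proof.
move=> t0 eta0; have [r r0 yr] := T_cvg0 y eta0.
have r2 : 0 < r ^+ 2 by rewrite exprn_gt0.
exists (2 * rnorm y / r ^+ 2); first by rewrite divr_ge0 ?mulr_ge0 ?rnorm_ge0// ltW.
move=> a a0; have [ar|ar] := ltP `|a - t| r.
  rewrite ler_wpDr//; first by rewrite mulr_ge0 ?sqr_ge0// divr_ge0 ?mulr_ge0 ?rnorm_ge0// ltW.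
  have [ta|ta] := leP t a.
    apply: (W_dist yr (ltW eta0)); first by rewrite (ltW t0).
    exact: le_lt_trans (ler_norm _) ar.
  rewrite rnormB; apply: (W_dist yr (ltW eta0)); first by rewrite a0 ltW.
  by rewrite distrC in ar; exact: le_lt_trans (ler_norm _) ar.
apply: ler_wpDl; first exact: ltW.
have Wy b : rnorm (W y b) <= rnorm y.
  by rewrite /W; case: ifP => // b0; exact: T_contr.
apply: (le_trans (rnorm_subr _ _)); apply: (@le_trans _ _ (2 * rnorm y)).
  by rewrite mulr_natl mulr2n lerD.
rewrite mulrAC ler_pdivlMr// ler_wpM2l ?mulr_ge0 ?rnorm_ge0//.
by rewrite -(real_normK (num_real (a - t))) ler_pXn2r// nnegrE// ltW.
Qed.

Let Qh h := half_sum (T h).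

(** Q^n averages W over the times c + h B with B binomial of parameters n and 1/2. The bracket is
    the second moment of this time about t, squared bias plus variance. *)
Let Q_quad y t eta C h n c : 0 < h -> 0 <= c ->
  (forall a, 0 <= a -> rnorm (W y a - W y t) <= eta + C * (a - t) ^+ 2) ->
  rnorm (iter n (Qh h) (W y c) - W y t) <=
  eta + C * ((c + n%:R * (h / 2) - t) ^+ 2 + n%:R * (h ^+ 2 / 4)).
Proof.
move=> h0 + Wq; elim: n c => [|n ih] c c0.
  by rewrite !mul0r !addr0; exact: Wq.
rewrite iterSr /Qh /half_sum W_mul// -/(Qh h).
have -> : iter n (Qh h) ((2^-1)%:C *: (W y c + W y (c + h))) =
    (2^-1)%:C *: (iter n (Qh h) (W y c) + iter n (Qh h) (W y (c + h))).
  by rewrite -!pactXn linearZ linearD.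
set x1 := iter n _ _; set x2 := iter n _ _; set w := W y t.
have -> : (2^-1)%:C *: (x1 + x2) - w = (2^-1)%:C *: ((x1 - w) + (x2 - w)).
  rewrite addrACA -opprD scalerBr [_ *: (w + w)]scalerDr -scalerDl -rmorphD/=.
  by rewrite (_ : 2^-1 + 2^-1 = 1) ?scale1r//; lra.
rewrite rnormZC ger0_norm// ler_pdivrMl//; apply: le_trans (rnormD _ _) _.
have ch0 : 0 <= c + h by rewrite addr_ge0// ltW.
have := ih _ c0; have := ih _ ch0; rewrite -/x1 -/x2 -/w -natr1 => i1 i2.
by apply: le_trans (lerD i2 i1) _; rewrite le_eqVlt; apply/orP; left; apply/eqP; field.
Qed.

(** With h = s/l and n h/2 just above t, the binomial time has mean close to t and variance of order
    t h, which vanishes as l grows. *)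
Lemma half_sum_approx y t eta (B : R) s : 0 < t -> 0 < s -> 0 < eta ->
  exists l n : nat, [/\ (0 < l)%N, (0 < n)%N, B <= n%:R, l%:R / n%:R <= s / (2 * t) &
    rnorm (iter n (half_sum (T (s / l%:R))) y - T t y) <= eta].
Proof.
move=> t0 s0 eta0; have eta2 : 0 < eta / 2 by rewrite divr_gt0.
have [C C0 hC] := W_quad y t0 eta2.
(* Each summand meets one demand on l > A: h < 1, then n >= B, then an error of order C h (1 + t)
   below eta. *)
pose A := 1 + s + s * `|B| / t + C * s * (1 + t) / eta.
have A1 : 1 <= A.
  rewrite /A -!addrA lerDl !addr_ge0// ?(ltW s0)// divr_ge0 ?mulr_ge0 ?(ltW s0) ?(ltW t0) ?(ltW eta0)//.
  by rewrite addr_ge0// ltW.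
pose l := (Num.trunc A).+1; have lA : A < l%:R by rewrite truncnS_gt.
have l0 : (0 : R) < l%:R by rewrite ltr0n.
clearbody l.
pose n := (Num.trunc (2 * t * l%:R / s)).+1; exists l, n.
have tls : 0 <= 2 * t * l%:R / s by rewrite !divr_ge0 ?mulr_ge0// ltW.
have /andP[n1 n2] := truncn_itv tls; rewrite -/n in n2.
have n3 : n%:R <= 2 * t * l%:R / s + 1 by rewrite /n -natr1 lerD2r.
have n0 : (0 < n)%N by [].
have nR0 : (0 : R) < n%:R by rewrite ltr0n.
clearbody n; set h := s / l%:R.
have h0 : 0 < h by rewrite divr_gt0.
have l0' : (0 < l)%N by rewrite -(ltr_nat R).
have nh : 2 * t < n%:R * h.
  by rewrite /h mulrA ltr_pdivlMr// -ltr_pdivrMr.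
have nh2 : n%:R * h <= 2 * t + h.
  rewrite /h mulrA ler_pdivrMr// mulrDl divfK ?gt_eqF//.
  by rewrite -(ler_pM2r s0) mulrDl mul1r divfK ?gt_eqF// in n3.
have Bt : 0 <= s * `|B| / t by rewrite divr_ge0 ?mulr_ge0 ?(ltW s0) ?(ltW t0).
have Ct : 0 <= C * s * (1 + t) / eta.
  by rewrite divr_ge0 ?(ltW eta0)// mulr_ge0 ?mulr_ge0 ?(ltW s0)// addr_ge0// ltW.
have sl : s < l%:R by rewrite (le_lt_trans _ lA)// /A; lra.
have h1 : h < 1 by rewrite ltr_pdivrMr// mul1r.
split => //.
- apply: le_trans (ler_norm _) _.
  have : s * `|B| / t < l%:R by rewrite (le_lt_trans _ lA)// /A; lra.
  rewrite ltr_pdivrMr// => sB.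
  rewrite -(ler_pM2l s0) ltW// (lt_le_trans sB)//.
  rewrite ltr_pdivrMr// in n2.
  by rewrite [s * _]mulrC (le_trans _ (ltW n2))//; have := mulr_gt0 l0 t0; lra.
- rewrite ltr_pdivrMr// in n2.
  by rewrite ler_pdivrMr// mulrAC ler_pdivlMr ?mulr_gt0// mulrC [leRHS]mulrC ltW.
have h00 : (0 : R) <= 0 by [].
have := Q_quad n h0 h00 hC; rewrite {1}/W ltxx add0r {1}/W t0 => /le_trans; apply.
rewrite [leRHS](_ : eta = eta / 2 + eta / 2); last by lra.
rewrite lerD2l.
have q1 : (n%:R * (h / 2) - t) ^+ 2 <= h / 4.
  have -> : n%:R * (h / 2) - t = (n%:R * h - 2 * t) / 2 by field.
  have : (n%:R * h - 2 * t) ^+ 2 <= h ^+ 2 by rewrite ler_pXn2r// ?nnegrE; lra.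
  have : h ^+ 2 <= h by rewrite expr2 ler_piMr// ltW.
  by rewrite expr_div_n; lra.
have q2 : n%:R * (h ^+ 2 / 4) <= h * (2 * t + 1) / 4.
  rewrite expr2 mulrA mulrA ler_pM2r ?invr_gt0// mulrC ler_wpM2l ?ltW//; lra.
have q3 : C * (h * (1 + t)) <= eta.
  have : C * s * (1 + t) / eta < l%:R by rewrite (le_lt_trans _ lA)// /A; lra.
  rewrite ltr_pdivrMr// => q; rewrite /h mulrAC mulrA ler_pdivrMr//.
  by rewrite mulrC [eta * _]mulrC (le_trans _ (ltW q))// mulrC -!mulrA.
apply: (@le_trans _ _ (C * (h * (1 + t) / 2))); last by rewrite mulrA ler_pM2r ?invr_gt0.
by rewrite ler_wpM2l//; lra.
Qed.

Definition diff_const k : R := 192 * K * (1 + K) ^+ k * k.+1`!%:R.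

Lemma diff_const_ge0 k : 0 <= diff_const k.
Proof.
have K0 : 0 <= K by exact: le_trans ler01 K1.
have K1k : 0 <= (1 + K) ^+ k by rewrite exprn_ge0// addr_ge0.
by rewrite /diff_const mulr_ge0// mulr_ge0// mulr_ge0.
Qed.

Lemma pact_half_sum h k v : pact (T h) ((1 - 'X) ^+ k) v =
  (2 ^+ k)%:C *: pact (half_sum (T h)) ((1 - 'X) ^+ k) v.
Proof.
elim: k v => [|k ih] v; first by rewrite !expr0 !pact1 scale1r.
rewrite !exprSr !pactM ih !pact_sub1X rmorphM/= -scalerA; congr (_ *: _).
rewrite -linearZ; congr (pact _ _ _); rewrite /half_sum scalerBr scalerA -rmorphM/=.
rewrite divff// scale1r opprD; have -> : 2%:C = 2%:R :> R[i] by rewrite rmorph_nat.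
by rewrite scaler_nat mulr2n addrA addrK.
Qed.

Lemma iter_sg_diff s l k v : 0 < s -> (0 < l)%N ->
  iter k (sg_diff s) v = pact (T (s / l%:R)) ((1 - 'X ^+ l) ^+ k) v.
Proof.
move=> s0 l0; elim: k => [|k ih]; first by rewrite expr0 pact1.
rewrite iterS ih exprS pactM pactB pact1 pactXn /sg_diff; congr (_ - _).
case: l l0 {ih} => // l _; rewrite sg_iter ?divr_gt0//.
by rewrite mulrCA divff ?mulr1.
Qed.

Lemma pact_geom_le h l k v : 0 < h ->
  rnorm (pact (T h) ((\sum_(i < l) 'X^i) ^+ k) v) <= l%:R ^+ k * rnorm v.
Proof.
move=> h0; elim: k v => [|k ih] v; first by rewrite !expr0 pact1 mul1r.
rewrite exprSr pactM (le_trans (ih _))// exprSr -mulrA ler_wpM2l// ?exprn_ge0//.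
rewrite pact_sum (le_trans (rnorm_sum _ _ _))//.
rewrite -[l in leRHS]card_ord mulr_natl -sumr_const ler_sum// => i _.
by rewrite pactXn; apply: iter_contr => y; exact: T_contr.
Qed.

(** T_t y is replaced by Q^n y with Q = (1 + T_h)/2 and h = s/l. Then 1 - T_s = 1 - T_h^l is a sum
    of l contractions times 2 (1 - Q), so the Ritt bound n^-k is multiplied by (2 l)^k, and 2 l/n <=
    s/t. *)
Lemma sg_diff_bound s t k y : 0 < s -> 0 < t ->
  rnorm (iter k (sg_diff s) (T t y)) <= diff_const k * (s / t) ^+ k * rnorm y.
Proof.
move=> s0 t0; apply/ler_addgt0Pr => eta eta0.
have eta2 : 0 < eta / 2 ^+ k by rewrite divr_gt0// exprn_gt0.
have [l [n [l0 n0 Kn ln app]]] := half_sum_approx y K t0 s0 eta2.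
set h := s / l%:R in app; have h0 : 0 < h by rewrite divr_gt0// ltr0n.
set z := iter n _ y in app.
have step v : rnorm (sg_diff s v) <= 2 * rnorm v.
  by rewrite mulr_natl mulr2n (le_trans (rnorm_subr _ _))// lerD2l T_contr.
have steps v : rnorm (iter k (sg_diff s) v) <= 2 ^+ k * rnorm v.
  elim: (k) => [|j ih]; first by rewrite expr0 mul1r.
  by rewrite iterS (le_trans (step _))// exprS -mulrA ler_wpM2l.
have zb : rnorm (iter k (sg_diff s) z) <= diff_const k * (s / t) ^+ k * rnorm y.
  rewrite (iter_sg_diff _ _ s0 l0) -/h -opprB subrX1 -mulNr opprB mulrC exprMn pactM.
  apply: le_trans (pact_geom_le _ _ _ h0) _.
  rewrite pact_half_sum rnormZC ger0_norm ?exprn_ge0// mulrA -exprMn.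
  have Q_contr v : rnorm (half_sum (T h) v) <= rnorm v by apply: half_sum_contr => ?; exact: T_contr.
  have S_far m v : (0 < m)%N -> rnorm (v - iter m (T h) v) <= (2 - 2 * e) * rnorm v.
    by case: m => // m _; rewrite sg_iter//; apply: (csg_far sg); rewrite mulr_gt0.
  have Q_res := half_sum_res (fun y => T_contr y h0) e01 S_far.
  have Kp : K <= (n + k)%:R *+ 2.
    rewrite (le_trans Kn)// -mulrnA ler_nat; lia.
  have := ritt_bound K1 Q_contr Q_res y n0 Kp; rewrite -/z.
  set w := rnorm _; have w0 : 0 <= w by exact: rnorm_ge0.
  have nk0 : (0 : R) < (n + k)%:R by rewrite ltr0n addn_gt0 n0.
  have n0R : (0 : R) < n%:R by rewrite ltr0n.
  have K0 : 0 <= K by exact: le_trans ler01 K1.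
  move=> hw; have {}hw : n%:R ^+ k * w <= diff_const k * rnorm y.
    rewrite -(ler_pM2l nk0).
    have : (n + k)%:R * n%:R ^+ k <= k.+1`!%:R * 'C(n + k.+1, k.+1)%:R :> R.
      by rewrite -natrX -!natrM ler_nat bin_ge.
    move=> /(ler_wpM2r w0); rewrite -mulrA => /le_trans; apply.
    rewrite -mulrA; apply: le_trans (ler_wpM2l _ hw) _ => //.
    by rewrite /diff_const le_eqVlt; apply/orP; left; apply/eqP; ring.
  apply: (@le_trans _ _ ((s / t) ^+ k * (n%:R ^+ k * w))); last first.
    by rewrite [_ * (s / t) ^+ k]mulrC -mulrA ler_wpM2l// exprn_ge0// divr_ge0// ltW.
  rewrite mulrA -exprMn ler_wpM2r//.
  apply: lerXn2r; rewrite ?nnegrE ?mulr_ge0 ?invr_ge0 ?(ltW s0) ?(ltW t0)//.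
  rewrite -ler_pdivrMr// [s / t](_ : _ = 2 * (s / (2 * t))); last by field; rewrite gt_eqF.
  by rewrite mulrAC mulrC ler_pM2l.
apply: le_trans (rnormDle _ (iter k (sg_diff s) z)) _; apply: lerD => //.
rewrite -!pactXn -linearB/= pactXn (le_trans (steps _))//.
by rewrite mulrC -ler_pdivlMr ?exprn_gt0// rnormB.
Qed.

End semigroup_differences.

(** * Limits and geometric series *)

Section norm_limits.
Context {R : realType} {Y : normedModType R[i]}.
Implicit Types (u v : Y^nat) (a b : Y) (eta B : R).

(** The norm of the space is valued in R[i]; this is convergence with real tolerances, so that real
    arithmetic applies. *)
Definition rcvg u a := forall eta, 0 < eta ->
  exists N, forall n, (N <= n)%N -> rnorm (u n - a) < eta.

Definition rcauchy u := forall eta, 0 < eta ->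
  exists N, forall m n, (N <= m)%N -> (N <= n)%N -> rnorm (u m - u n) < eta.

Lemma rcvg_cst a : rcvg (fun=> a) a.
Proof. by move=> eta eta0; exists 0%N => n _; rewrite subrr rnorm0. Qed.

Lemma rcvg_le u a c B : rcvg u a -> (exists N, forall n, (N <= n)%N -> rnorm (u n - c) <= B) ->
  rnorm (a - c) <= B.
Proof.
move=> ua [N1 uB]; apply/ler_addgt0Pr => eta eta0; have [N2 h] := ua _ eta0.
have := h _ (leq_maxr N1 N2); have := uB _ (leq_maxl N1 N2) => h1 h2.
rewrite (le_trans (rnorm_triangle _ (u (maxn N1 N2)) _))// addrC lerD//.
by rewrite rnormB ltW.
Qed.

Lemma rcvg_bound u a B : rcvg u a -> (forall n, rnorm (u n) <= B) -> rnorm a <= B.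
Proof.
move=> ua uB; rewrite -[a]subr0; apply: (rcvg_le ua); exists 0%N => n _.
by rewrite subr0.
Qed.

Lemma rcvg_unique u a b : rcvg u a -> rcvg u b -> a = b.
Proof.
move=> ua ub; apply/eqP; rewrite -subr_eq0; apply/eqP/rnorm0_eq0/le_anti.
rewrite rnorm_ge0 andbT; apply/ler_addgt0Pr => eta eta0; rewrite add0r.
apply: (rcvg_le ua); have [N h] := ub _ eta0.
by exists N => n /h /ltW.
Qed.

Lemma rcvgD u v a b : rcvg u a -> rcvg v b -> rcvg (fun n => u n + v n) (a + b).
Proof.
move=> ua vb eta eta0; have eta2 : 0 < eta / 2 by rewrite divr_gt0.
have [N1 h1] := ua _ eta2; have [N2 h2] := vb _ eta2.
exists (maxn N1 N2) => n; rewrite geq_max => /andP[/h1 {}h1 /h2 {}h2].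
by rewrite opprD addrACA (le_lt_trans (rnormD _ _))// [eta]splitr ltrD.
Qed.

Lemma rcvgZ (c : R[i]) u a : rcvg u a -> rcvg (fun n => c *: u n) (c *: a).
Proof.
move=> ua eta eta0; have c1 : 0 < rnorm c + 1 by rewrite ltr_wpDl ?rnorm_ge0.
have [N h] := ua _ (divr_gt0 eta0 c1); exists N => n /h.
rewrite ltr_pdivlMr// -scalerBr rnormZ; apply: le_lt_trans.
by rewrite mulrC ler_wpM2l ?rnorm_ge0// lerDl.
Qed.

Lemma rcvg_dist u v a (w : R^nat) : rcvg u a ->
  (forall eta, 0 < eta -> exists N, forall n, (N <= n)%N -> w n < eta) ->
  (forall n, rnorm (v n - u n) <= w n) -> rcvg v a.
Proof.
move=> ua w0 vw eta eta0; have eta2 : 0 < eta / 2 by rewrite divr_gt0.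
have [N1 h1] := ua _ eta2; have [N2 h2] := w0 _ eta2.
exists (maxn N1 N2) => n; rewrite geq_max => /andP[/h1 {}h1 /h2 {}h2].
rewrite (le_lt_trans (rnorm_triangle _ (u n) _))// [eta]splitr ltrD//.
exact: le_lt_trans (vw n) h2.
Qed.

(** A uniform bound lets strong limits of operators be composed; this is how products of derivatives
    and of power series are obtained. *)
Lemma rcvg_comp (A : nat -> {linear Y -> Y}) (A' : Y -> Y) u a B :
  (forall n y, rnorm (A n y) <= B * rnorm y) -> (forall y, rcvg (A ^~ y) (A' y)) ->
  rcvg u a -> rcvg (fun n => A n (u n)) (A' a).
Proof.
move=> AB AA ua; have B1 : 0 < `|B| + 1 by rewrite ltr_wpDl.
apply: (rcvg_dist (w := fun n => (`|B| + 1) * rnorm (u n - a)) (AA a)).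
  move=> eta eta0; have [N h] := ua _ (divr_gt0 eta0 B1).
  by exists N => n /h; rewrite ltr_pdivlMr// mulrC.
move=> n; rewrite -linearB (le_trans (AB _ _))// ler_wpM2r ?rnorm_ge0//.
by rewrite (le_trans (ler_norm _))// lerDl.
Qed.

Lemma exprV2_lt eta : 0 < eta -> exists N, forall n, (N <= n)%N -> (2^-1) ^+ n < eta.
Proof. by apply: geometric_lt; rewrite invr_ge0 invf_lt1// ler0n ltr1n. Qed.

Lemma geometric_dist u C : 0 <= C -> (forall n, rnorm (u n - u n.+1) <= C * 2^-1 ^+ n) ->
  forall m n, (m <= n)%N -> rnorm (u m - u n) <= 2 * C * 2^-1 ^+ m.
Proof.
move=> C0 uC m n mn.
suff : rnorm (u m - u n) <= 2 * C * (2^-1 ^+ m - 2^-1 ^+ n).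
  by move=> /le_trans; apply; rewrite ler_wpM2l ?mulr_ge0// lerBlDr lerDl exprn_ge0.
elim: n mn => [|n ih]; first by rewrite leqn0 => /eqP ->; rewrite !subrr rnorm0 mulr0.
rewrite leq_eqVlt => /predU1P[->|/ih {}ih]; first by rewrite !subrr rnorm0 mulr0.
apply: le_trans (rnorm_triangle _ (u n) _) _.
by have := uC n; rewrite exprS; lra.
Qed.

Lemma geometric_cvg : (forall u, rcauchy u -> exists a, rcvg u a) ->
  forall u C, 0 <= C -> (forall n, rnorm (u n - u n.+1) <= C * 2^-1 ^+ n) ->
  exists a, rcvg u a.
Proof.
move=> Yc u C C0 uC; apply: Yc => eta eta0.
have C1 : 0 < 4 * C + 1 by rewrite ltr_wpDl// mulr_ge0.
have [N h] := exprV2_lt (divr_gt0 eta0 C1); exists N => m n Nm Nn.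
have {}h : (4 * C + 1) * 2^-1 ^+ N < eta.
  by have := h _ (leqnn N); rewrite ltr_pdivlMr// mulrC.
apply: le_lt_trans h; apply: le_trans (rnorm_triangle _ (u N) _) _.
rewrite rnormB; have := geometric_dist C0 uC Nm; have := geometric_dist C0 uC Nn.
have : 0 <= (2^-1 : R) ^+ N by rewrite exprn_ge0.
by lra.
Qed.

Lemma series_cvg : (forall u, rcauchy u -> exists a, rcvg u a) ->
  forall u B, 0 <= B -> (forall k, rnorm (u k) <= B * 2^-1 ^+ k) ->
  exists a, rcvg (fun N => \sum_(k < N) u k) a.
Proof.
move=> Yc u B B0 uB; apply: (geometric_cvg Yc B0) => n.
by rewrite big_ord_recr/= opprD addrA subrr add0r rnormN.
Qed.

Lemma series_bound u a B : 0 <= B -> (forall k, rnorm (u k) <= B * 2^-1 ^+ k) ->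
  rcvg (fun N => \sum_(k < N) u k) a -> rnorm a <= 2 * B.
Proof.
move=> B0 uB; move=> /rcvg_bound; apply=> n.
have uS m : rnorm (\sum_(k < m) u k - \sum_(k < m.+1) u k) <= B * 2^-1 ^+ m.
  by rewrite big_ord_recr/= opprD addrA subrr add0r rnormN.
have := geometric_dist (u := fun N => \sum_(k < N) u k) B0 uS (leq0n n).
by rewrite big_ord0 sub0r rnormN expr0 mulr1.
Qed.

End norm_limits.

Lemma addNKl (V : zmodType) (x r : V) : x + (- x + r) = r.
Proof. by rewrite addrA subrr add0r. Qed.

(* Decides linear identities with unit coefficients in an abelian group. *)
Ltac zmod := apply: subr0_eq; rewrite -[LHS]addr0 ?(opprD, opprK, oppr0, add0r) -!addrA;
  repeat first [ reflexivity | rewrite addKr | rewrite addNKl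
    | match goal with
      | |- - ?x + _ = 0 => rewrite [_ + (x + _)]addrCA
      | |- ?x + _ = 0 => rewrite [_ + (- x + _)]addrCA
      end ].

(** * Derivatives of all orders on positive times *)

Section semigroup_derivatives.
Context {R : realType} {Y : normedModType R[i]} (T : R -> {linear Y -> Y}) (e : R).
Hypothesis sg : contraction_semigroup T e.
Hypothesis Yc : forall u : Y^nat, rcauchy u -> exists a, rcvg u a.
Implicit Types (a b c r s t x : R) (y v : Y) (k l m n : nat).
Let T_mul := csg_mul sg.
Local Notation cst := (diff_const e).
Let cst0 k : 0 <= cst k := diff_const_ge0 sg k.

Lemma sg_comm s t y : 0 < s -> 0 < t -> T s (T t y) = T t (T s y).
Proof. by move=> s0 t0; rewrite !T_mul// addrC. Qed.

Lemma sg_diff_le s t y : 0 < s -> 0 < t ->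
  rnorm (sg_diff T s (T t y)) <= cst 1 * (s / t) * rnorm y.
Proof. by move=> s0 t0; have := sg_diff_bound sg 1 y s0 t0; rewrite expr1. Qed.

(** Each difference is smoothed by one half of the time t. This stands in for a bound on the second
    derivative. *)
Lemma sg_diff_mixed a c t y : 0 < a -> 0 < c -> 0 < t ->
  rnorm (sg_diff T c (sg_diff T a (T t y))) <= 4 * cst 1 ^+ 2 / t ^+ 2 * (a * c) * rnorm y.
Proof.
move=> a0 c0 t0; have t2 : 0 < t / 2 by rewrite divr_gt0.
have -> : T t y = T (t / 2) (T (t / 2) y) by rewrite T_mul// -splitr.
have -> : sg_diff T a (T (t / 2) (T (t / 2) y)) = T (t / 2) (sg_diff T a (T (t / 2) y)).
  by rewrite /sg_diff linearB (sg_comm (T (t / 2) y) a0 t2).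
apply: le_trans (sg_diff_le _ c0 t2) _.
apply: le_trans (ler_wpM2l _ (sg_diff_le _ a0 t2)) _.
  by rewrite mulr_ge0// divr_ge0 ?ltW.
by rewrite le_eqVlt; apply/orP; left; apply/eqP; field; rewrite gt_eqF.
Qed.

Definition sg_incr t a y : Y := T (t + a) y - T t y.

Lemma sg_incrE t a y : 0 < t -> 0 < a -> sg_incr t a y = - sg_diff T a (T t y).
Proof. by move=> t0 a0; rewrite /sg_diff opprB T_mul// [a + t]addrC. Qed.

Lemma sg_incr_le t a y : 0 < t -> 0 < a -> rnorm (sg_incr t a y) <= cst 1 * (a / t) * rnorm y.
Proof. by move=> t0 a0; rewrite sg_incrE// rnormN sg_diff_le. Qed.

Let L t := 4 * cst 1 ^+ 2 / t ^+ 2.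
Let L0 t : 0 <= L t. Proof. by rewrite /L divr_ge0 ?sqr_ge0// mulr_ge0// sqr_ge0. Qed.

(** The increment over a later step of length a differs from the first by a mixed second difference,
    of size at most L a (n a); n of them accumulate to L (n a)^2. *)
Lemma sg_incr_mul t a n y : 0 < t -> 0 < a ->
  rnorm (sg_incr t (n%:R * a) y - n%:R%:C *: sg_incr t a y) <=
  L t * (n%:R * a) ^+ 2 * rnorm y.
Proof.
move=> t0 a0; elim: n => [|n ih].
  by rewrite !mul0r rmorph0 scale0r subr0 /sg_incr addr0 subrr rnorm0 expr0n/= mulr0 mul0r.
have na0 : 0 <= n%:R * a by rewrite mulr_ge0// ltW.
have -> : sg_incr t (n.+1%:R * a) y - n.+1%:R%:C *: sg_incr t a y =
    (sg_incr t (n%:R * a) y - n%:R%:C *: sg_incr t a y) +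
    (T (t + n%:R * a + a) y - T (t + n%:R * a) y - sg_incr t a y).
  rewrite -natr1 rmorphD/= scalerDl scale1r mulrDl mul1r addrA.
  by rewrite /sg_incr; zmod.
apply: le_trans (rnormD _ _) _.
have step : rnorm (T (t + n%:R * a + a) y - T (t + n%:R * a) y - sg_incr t a y) <=
    L t * (n%:R * a * a) * rnorm y.
  move: na0; rewrite le_eqVlt => /predU1P[<-|na0].
    by rewrite addr0 subrr rnorm0 mul0r mulr0 mul0r.
  have -> : T (t + n%:R * a + a) y - T (t + n%:R * a) y - sg_incr t a y =
      sg_diff T (n%:R * a) (sg_diff T a (T t y)).
    rewrite /sg_diff /sg_incr [T (_ * _) (_ - _)]linearB !T_mul ?addr_gt0//.
    rewrite [n%:R * a + (a + t)]addrC [a + t]addrC [n%:R * a + t]addrC [t + a + _]addrAC; zmod.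
  by have := sg_diff_mixed y a0 na0 t0; rewrite [a * _]mulrC.
apply: le_trans (lerD ih step) _; rewrite -mulrDl -mulrDr.
rewrite ler_wpM2r ?rnorm_ge0// ler_wpM2l// -natr1.
by have := mulr_ge0 na0 (ltW a0); have := sqr_ge0 a; nra.
Qed.

(** The step a need not divide b. With n the integer part of b/a, the two leftovers cost one
    increment of length at most a each. *)
Lemma sg_incr_quot t a b y : 0 < t -> 0 < a -> a <= b ->
  rnorm (sg_incr t b y - (b / a)%:C *: sg_incr t a y) <=
  (L t * b ^+ 2 + 2 * (cst 1 * (a / t))) * rnorm y.
Proof.
move=> t0 a0 ab; have b0 := lt_le_trans a0 ab.
have ba0 : 0 <= b / a by rewrite divr_ge0 ?ltW.
have /andP[n1 n2] := truncn_itv ba0; set n := Num.trunc _ in n1 n2.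
have n0 : (0 < n)%N by rewrite truncn_gt0 ler_pdivlMr// mul1r.
rewrite ler_pdivlMr// in n1; rewrite ltr_pdivrMr// in n2.
have na0 : 0 < n%:R * a by rewrite mulr_gt0// ltr0n.
have -> : sg_incr t b y - (b / a)%:C *: sg_incr t a y =
    (sg_incr t (n%:R * a) y - n%:R%:C *: sg_incr t a y) +
    ((sg_incr t b y - sg_incr t (n%:R * a) y) + (n%:R - b / a)%:C *: sg_incr t a y).
  by rewrite rmorphB/= scalerBl; zmod.
rewrite mulrDl; apply: le_trans (rnormD _ _) _; apply: lerD.
  apply: le_trans (sg_incr_mul n y t0 a0) _.
  by rewrite ler_wpM2r ?rnorm_ge0// ler_wpM2l// ler_pXn2r// nnegrE ltW.
rewrite mulr2n mulrDl mul1r mulrDl; apply: le_trans (rnormD _ _) _; apply: lerD.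
  rewrite /sg_incr opprB addrA subrK; have [->|nb] := eqVneq (n%:R * a) b.
    by rewrite subrr rnorm0 mulr_ge0 ?rnorm_ge0// mulr_ge0// divr_ge0// ltW.
  have bn : 0 < b - n%:R * a by rewrite subr_gt0 lt_neqAle nb.
  have tn : 0 < t + n%:R * a by rewrite addr_gt0.
  have -> : t + b = t + n%:R * a + (b - n%:R * a) by zmod.
  apply: le_trans (sg_incr_le y tn bn) _.
  rewrite ler_wpM2r ?rnorm_ge0// ler_wpM2l// ler_pM ?invr_ge0 ?(ltW bn) ?(ltW tn)//.
    by move: n2; rewrite -natr1; lra.
  by rewrite lef_pV2 ?posrE// lerDl ltW.
have nb : `|n%:R - b / a| <= 1.
  rewrite distrC ger0_norm ?subr_ge0 ?ler_pdivlMr// lerBlDr ler_pdivrMr//.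
  by move: n2; rewrite -natr1; lra.
rewrite rnormZC; apply: le_trans (ler_pM _ _ nb (sg_incr_le y t0 a0)) _; rewrite ?rnorm_ge0//.
by rewrite mul1r.
Qed.

(** With dyadic steps, consecutive difference quotients differ by 2^n (1 - T_a)^2, a = 2^-(n+1),
    which is of order 2^-n on vectors T_t y. *)
Definition dyadic_deriv n v : Y := (2 ^+ n)%:C *: (T (2^-1 ^+ n) v - v).

Lemma dyadic_deriv_linear n : linear (dyadic_deriv n).
Proof.
move=> a x y; rewrite /dyadic_deriv scalerA [a * _]mulrC -scalerA -scalerDr linearP.
by rewrite [a *: (_ - _)]scalerBr opprD addrACA.
Qed.

HB.instance Definition _ n :=
  GRing.isLinear.Build R[i] Y Y *:%R (dyadic_deriv n) (dyadic_deriv_linear n).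

Let h0 n : 0 < (2^-1 : R) ^+ n. Proof. by rewrite exprn_gt0// invr_gt0. Qed.

Lemma dyadic_deriv_comm n k t v : 0 < t ->
  iter k (dyadic_deriv n) (T t v) = T t (iter k (dyadic_deriv n) v).
Proof.
move=> t0; elim: k => // k ih; rewrite !iterS ih /dyadic_deriv [T t (_ *: _)]linearZ.
by rewrite [T t (_ - _)]linearB/= (sg_comm _ t0 (h0 n)).
Qed.

Lemma dyadic_deriv_bound n k t y : 0 < t ->
  rnorm (iter k (dyadic_deriv n) (T t y)) <= cst k / t ^+ k * rnorm y.
Proof.
move=> t0; have E v : iter k (dyadic_deriv n) v =
    ((- 2 ^+ n) ^+ k)%:C *: iter k (sg_diff T (2^-1 ^+ n)) v.
  elim: k => [|k ih]; first by rewrite expr0 scale1r.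
  rewrite !iterS ih -[dyadic_deriv n _]/((dyadic_deriv n : {linear Y -> Y}) _) linearZ/=.
  rewrite exprSr rmorphM/= -scalerA; congr (_ *: _).
  by rewrite /dyadic_deriv -opprB scalerN -scaleNr rmorphN.
rewrite E rnormZC normrX normrN ger0_norm ?exprn_ge0//.
apply: le_trans (ler_wpM2l _ (sg_diff_bound sg k y (h0 n) t0)) _; first by rewrite !exprn_ge0.
rewrite mulrA mulrCA -exprMn exprVn mulrA divff ?expf_neq0// mul1r.
by rewrite exprVn.
Qed.

Lemma dyadic_deriv_cauchy n t y : 0 < t ->
  rnorm (dyadic_deriv n (T t y) - dyadic_deriv n.+1 (T t y)) <= L t * rnorm y * 2^-1 ^+ n.
Proof.
move=> t0; set a := 2^-1 ^+ n.+1 : R; have a0 : 0 < a := h0 n.+1.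
have aE : 2^-1 ^+ n = a + a.
  by rewrite /a exprS; lra.
have -> : dyadic_deriv n (T t y) - dyadic_deriv n.+1 (T t y) =
    (2 ^+ n)%:C *: sg_diff T a (sg_diff T a (T t y)).
  rewrite /dyadic_deriv /sg_diff -/a aE exprSr rmorphM/= -scalerA -scalerBr.
  congr (_ *: _); rewrite (_ : 2%:C = 1 + 1); last by rewrite rmorphD.
  by rewrite scalerDl scale1r [T a (_ - _)]linearB !T_mul ?addr_gt0// addrA; zmod.
rewrite rnormZC ger0_norm ?exprn_ge0//.
apply: le_trans (ler_wpM2l _ (sg_diff_mixed y a0 a0 t0)) _; first by rewrite exprn_ge0.
rewrite -/(L t) [leRHS](_ : _ = L t * 2^-1 ^+ n * rnorm y); last by ring.
rewrite [leLHS](_ : _ = L t * (2 ^+ n * (a * a)) * rnorm y); last by ring.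
rewrite ler_wpM2r ?rnorm_ge0// ler_wpM2l// /a exprS.
have E : 2 ^+ n * 2^-1 ^+ n = 1 :> R by rewrite -exprMn divff// expr1n.
rewrite [leLHS](_ : _ = (2 ^+ n * 2^-1 ^+ n) * (2^-1 ^+ n / 4)); last by field.
by rewrite E mul1r; have := h0 n; lra.
Qed.

(** Writing D^(k+1) T_t as (D^k T_(t/2)) (D T_(t/2)), the inner factor converges and the outer
    operators are uniformly bounded by [dyadic_deriv_bound]. *)
Lemma dyadic_deriv_cvg k t y : 0 < t ->
  exists z : Y, rcvg (fun n => iter k (dyadic_deriv n) (T t y)) z.
Proof.
elim: k t y => [|k ih] t y t0; first by exists (T t y); exact: rcvg_cst.
have t2 : 0 < t / 2 by rewrite divr_gt0.
have [b hb] : exists z : Y, rcvg (fun n => dyadic_deriv n (T (t / 2) y)) z.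
  apply: (geometric_cvg Yc (C := L (t / 2) * rnorm y)).
    by rewrite mulr_ge0 ?rnorm_ge0.
  by move=> n; exact: dyadic_deriv_cauchy.
have [A hA] : exists A : Y -> Y, forall v,
    rcvg (fun n => iter k (dyadic_deriv n) (T (t / 2) v)) (A v).
  by have [A] := choice (fun v => ih (t / 2) v t2); exists A.
exists (A b).
pose An n : {linear Y -> Y} := pact (dyadic_deriv n) 'X^k \o T (t / 2).
have A1 n v : rnorm (An n v) <= cst k / (t / 2) ^+ k * rnorm v.
  by rewrite /= pactXn dyadic_deriv_bound.
have A2 v : rcvg (An ^~ v) (A v).
  by move=> eta /(hA v)[N h]; exists N => n /h; rewrite /= pactXn.
have E n : An n (dyadic_deriv n (T (t / 2) y)) = iter k.+1 (dyadic_deriv n) (T t y).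
  rewrite iterSr /= pactXn; congr (iter k _ _).
  by rewrite -(dyadic_deriv_comm n 1 _ t2)/= T_mul// -splitr.
by move=> eta /(rcvg_comp A1 A2 hb)[N h]; exists N => n /h; rewrite E.
Qed.

(* [sg_deriv k t] is the k-th derivative of the semigroup at [t > 0]. *)
Definition sg_deriv k t y : Y :=
  xget 0 [set z : Y | rcvg (fun n => iter k (dyadic_deriv n) (T t y)) z].

Lemma sg_deriv_cvg k t y : 0 < t ->
  rcvg (fun n => iter k (dyadic_deriv n) (T t y)) (sg_deriv k t y).
Proof.
by move=> t0; exact: (xgetPex 0 (dyadic_deriv_cvg k y t0)).
Qed.

Lemma sg_derivP k t y (z : Y) : 0 < t ->
  rcvg (fun n => iter k (dyadic_deriv n) (T t y)) z -> sg_deriv k t y = z.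
Proof. by move=> t0 hz; exact: rcvg_unique (sg_deriv_cvg k y t0) hz. Qed.

Lemma sg_deriv_linear k t : 0 < t -> linear (sg_deriv k t).
Proof.
move=> t0 c x y; apply: sg_derivP => //.
have := rcvgD (rcvgZ c (sg_deriv_cvg k x t0)) (sg_deriv_cvg k y t0).
move=> h eta /h[N {}h]; exists N => n /h.
by rewrite -[iter k _ (T t (c *: x + y))]pactXn !linearP/= !pactXn.
Qed.

Lemma sg_deriv_bound k t y : 0 < t -> rnorm (sg_deriv k t y) <= cst k / t ^+ k * rnorm y.
Proof.
move=> t0; apply: (rcvg_bound (sg_deriv_cvg k y t0)) => n.
exact: dyadic_deriv_bound.
Qed.

Lemma sg_deriv0 t y : 0 < t -> sg_deriv 0 t y = T t y.
Proof. by move=> t0; apply: sg_derivP => //; exact: rcvg_cst. Qed.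

Lemma sg_deriv_mul k l s t y : 0 < s -> 0 < t ->
  sg_deriv k s (sg_deriv l t y) = sg_deriv (k + l) (s + t) y.
Proof.
move=> s0 t0; apply/esym/sg_derivP; first by rewrite addr_gt0.
pose An n : {linear Y -> Y} := pact (dyadic_deriv n) 'X^k \o T s.
have A1 n v : rnorm (An n v) <= cst k / s ^+ k * rnorm v.
  by rewrite /= pactXn dyadic_deriv_bound.
have A2 v : rcvg (An ^~ v) (sg_deriv k s v).
  by move=> eta /(sg_deriv_cvg k v s0)[N h]; exists N => n /h; rewrite /= pactXn.
have E n : An n (iter l (dyadic_deriv n) (T t y)) =
    iter (k + l) (dyadic_deriv n) (T (s + t) y).
  by rewrite /= pactXn -(dyadic_deriv_comm _ _ _ s0) T_mul// -iterD.
by move=> eta /(rcvg_comp A1 A2 (sg_deriv_cvg l y t0))[N h]; exists N => n /h; rewrite E.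
Qed.

(** The limit of [sg_incr_quot] along dyadic a, in which the term of order a disappears. *)
Lemma sg_deriv_taylor t b y : 0 < t -> 0 < b ->
  rnorm (T (t + b) y - T t y - b%:C *: sg_deriv 1 t y) <= L t * b ^+ 2 * rnorm y.
Proof.
move=> t0 b0; rewrite -/(sg_incr t b y) rnormB.
have lim := rcvgZ b%:C (sg_deriv_cvg 1 y t0).
apply/ler_addgt0Pr => eta eta0; apply: (rcvg_le lim).
pose A := 2 * (cst 1 / t) * rnorm y + 1.
have A0 : 0 < A by rewrite ltr_wpDl// mulr_ge0 ?rnorm_ge0// mulr_ge0// divr_ge0// ltW.
have eb : 0 < Num.min (eta / A) b by rewrite lt_min divr_gt0.
have [N hN] := exprV2_lt eb; exists N => n /hN; rewrite lt_min => /andP[h1 h2].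
rewrite rnormB; have := sg_incr_quot y t0 (h0 n) (ltW h2).
have -> : (b / 2^-1 ^+ n)%:C *: sg_incr t (2^-1 ^+ n) y =
    b%:C *: iter 1 (dyadic_deriv n) (T t y).
  rewrite /= /dyadic_deriv scalerA -rmorphM/= -exprVn invrK T_mul ?h0//.
  by rewrite /sg_incr [t + _]addrC.
move=> /le_trans; apply; rewrite mulrDl lerD2l.
move: h1; rewrite ltr_pdivlMr// => /ltW; apply: le_trans.
rewrite /A mulrDr mulr1 -[leLHS]addr0 lerD ?(ltW (h0 n))//.
by rewrite le_eqVlt; apply/orP; left; apply/eqP; field; rewrite gt_eqF.
Qed.

(** The difference is the derivative at t/2 applied to an increment of length b at t/2. *)
Lemma sg_deriv_add t b y : 0 < t -> 0 < b ->
  rnorm (sg_deriv 1 (t + b) y - sg_deriv 1 t y) <= L t * b * rnorm y.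
Proof.
move=> t0 b0; have t2 : 0 < t / 2 by rewrite divr_gt0.
have -> : sg_deriv 1 t y = sg_deriv 1 (t / 2) (T (t / 2) y).
  by rewrite -(sg_deriv0 _ t2) sg_deriv_mul// addn0 -splitr.
have -> : sg_deriv 1 (t + b) y = sg_deriv 1 (t / 2) (T (t / 2 + b) y).
  by rewrite -(sg_deriv0 _ (addr_gt0 t2 b0)) sg_deriv_mul ?addr_gt0// addn0 addrA -splitr.
have lin := sg_deriv_linear 1 t2.
have -> : sg_deriv 1 (t / 2) (T (t / 2 + b) y) - sg_deriv 1 (t / 2) (T (t / 2) y) =
    sg_deriv 1 (t / 2) (sg_incr (t / 2) b y).
  by rewrite /sg_incr addrC -scaleN1r -lin scaleN1r addrC.
apply: le_trans (sg_deriv_bound _ _ t2) _.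
apply: le_trans (ler_wpM2l _ (sg_incr_le y t2 b0)) _.
  by rewrite divr_ge0// exprn_ge0// ltW.
by rewrite le_eqVlt; apply/orP; left; apply/eqP; rewrite /L; field; rewrite gt_eqF.
Qed.

End semigroup_derivatives.

(** * Holomorphic extension *)

(** Reindexing of a Cauchy product: diagonals against a square cut by k + l < N. *)
Lemma sum_triangle (V : nmodType) (F : nat -> nat -> V) N :
  \sum_(n < N) \sum_(k < n.+1) F k (n - k)%N =
  \sum_(k < N) \sum_(l < N | (k + l < N)%N) F k l.
Proof.
transitivity (\sum_(n < N) \sum_(k < N | (k < n.+1)%N) F k (n - k)%N).
  by apply: eq_bigr => n _; rewrite (big_ord_widen N (fun k => F k (n - k)%N)).
rewrite (exchange_big_dep xpredT)//=; apply: eq_bigr => k _.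
rewrite -(big_mkord (fun n => (k < n.+1)%N) (fun n => F k (n - k)%N)).
rewrite -(big_mkord (fun l => (k + l < N)%N) (F k)).
have kN := ltnW (ltn_ord k).
transitivity (\sum_(k <= n < N) F k (n - k)%N).
  by rewrite [RHS](big_nat_widenl _ 0)//=; apply: eq_bigl => n; rewrite ltnS.
transitivity (\sum_(0 <= l < N - k) F k l).
  by rewrite -{1}[nat_of_ord k]add0n big_addn; apply: eq_bigr => l _; rewrite addnK.
rewrite [LHS](big_nat_widen _ _ N) ?leq_subr//=; apply: eq_bigl => l.
by rewrite ltn_subRL.
Qed.

Section analytic_extension.
Context {R : realType} {Y : normedModType R[i]} (T : R -> {linear Y -> Y}) (e : R).
Hypothesis sg : contraction_semigroup T e.
Hypothesis Yc : forall u : Y^nat, rcauchy u -> exists a, rcvg u a.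
Implicit Types (a b c r s t x : R) (y : Y) (k l m n : nat) (w v z h : R[i]).
Local Notation cst := (diff_const e).
Local Notation E := (sg_deriv T).
Let cst0 k : 0 <= cst k := diff_const_ge0 sg k.

(** [ang] and [ext_bound] are the ratio 1 + K and the prefactor 192 K of [diff_const], with K = 18/e
    the resolvent constant. *)
Definition ang : R := 1 + 18 / e.
Definition ext_bound : R := 192 * (18 / e).

Lemma ang_ge1 : 1 <= ang.
Proof. by have /andP[e0 _] := csg_pos sg; rewrite lerDl divr_ge0// ltW. Qed.

Lemma ext_bound_ge1 : 1 <= ext_bound.
Proof.
have /andP[e0 e1] := csg_pos sg.
by rewrite /ext_bound mulrA ler_pdivlMr// mul1r; lra.
Qed.

Let M0 : 0 <= ext_bound := le_trans ler01 ext_bound_ge1.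
Let G0 : 0 < ang := lt_le_trans ltr01 ang_ge1.

Definition taylor_term x w y k : Y := (w ^+ k / k`!%:R) *: E k x y.

Lemma taylor_term_le x w y k : 0 < x ->
  rnorm (taylor_term x w y k) <= ext_bound * (k.+1%:R * (ang * rnorm w / x) ^+ k) * rnorm y.
Proof.
move=> x0; rewrite rnormZ rnormM rnormX rnormV rnormC_nat.
have k0 : (0 : R) < k`!%:R by rewrite ltr0n fact_gt0.
apply: le_trans (ler_wpM2l _ (sg_deriv_bound sg Yc k y x0)) _.
  by rewrite divr_ge0 ?exprn_ge0 ?rnorm_ge0// ltW.
rewrite /diff_const factS natrM -/ang -/ext_bound expr_div_n exprMn.
by rewrite le_eqVlt; apply/orP; left; apply/eqP; field; rewrite !gt_eqF ?exprn_gt0.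
Qed.

Lemma succ_exp_le k : k.+1%:R * 16^-1 ^+ k <= 8^-1 ^+ k :> R.
Proof.
rewrite -(@ler_pM2r _ (16 ^+ k)) ?exprn_gt0// -mulrA -!exprMn mulVf// expr1n mulr1.
rewrite (_ : 8^-1 * 16 = 2); last by field.
by rewrite -natrX ler_nat ltn_expl.
Qed.

Lemma taylor_term_geom x w y k : 0 < x -> 16 * ang * rnorm w <= x ->
  rnorm (taylor_term x w y k) <= ext_bound * rnorm y * 8^-1 ^+ k.
Proof.
move=> x0 wx; apply: le_trans (taylor_term_le w y k x0) _.
rewrite [leRHS]mulrAC ler_wpM2r ?rnorm_ge0// ler_wpM2l//.
apply: le_trans (succ_exp_le k); rewrite ler_wpM2l//.
apply: lerXn2r; rewrite ?nnegrE ?invr_ge0//.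
  by rewrite divr_ge0 ?mulr_ge0 ?rnorm_ge0// ltW.
by rewrite ler_pdivrMr// ler_pdivlMl// mulrA.
Qed.

(** From order 2 on, two powers of the ratio are kept apart from the geometric decay, so that the
    tail of the series is quadratic in w. *)
Lemma taylor_term_sqr x w y k : 0 < x -> 16 * ang * rnorm w <= x -> (2 <= k)%N ->
  rnorm (taylor_term x w y k) <=
  ext_bound * (16 * ang * rnorm w / x) ^+ 2 * rnorm y * 8^-1 ^+ k.
Proof.
move=> x0 wx k2; apply: le_trans (taylor_term_le w y k x0) _.
rewrite [leRHS]mulrAC ler_wpM2r ?rnorm_ge0// -[leRHS]mulrA ler_wpM2l//.
set q := _ / x; have q0 : 0 <= q.
  by rewrite divr_ge0 ?mulr_ge0 ?rnorm_ge0 ?(ltW G0)// ltW.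
have -> : 16 * ang * rnorm w / x = 16 * q by rewrite /q !mulrA.
have q1 : 16 * q <= 1 by rewrite /q mulrA ler_pdivrMr// mul1r mulrA.
apply: (@le_trans _ _ ((16 * q) ^+ 2 * (k.+1%:R * 16^-1 ^+ k))); last first.
  by rewrite ler_wpM2l ?succ_exp_le ?sqr_ge0.
rewrite mulrCA ler_wpM2l//.
rewrite -(@ler_pM2r _ (16 ^+ k)) ?exprn_gt0// -mulrA -!exprMn mulVf// expr1n mulr1.
by rewrite mulrC; apply: ler_wiXn2l => //; rewrite mulr_ge0.
Qed.

(** The operator T(x + w), summed from its Taylor series at x; meaningful when 16 [ang] |w| <= x. *)
Definition complex_sg x w y : Y :=
  xget 0 [set z : Y | rcvg (fun N => \sum_(k < N) taylor_term x w y k) z].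

Let half8 k : 8^-1 ^+ k <= 2^-1 ^+ k :> R.
Proof. by apply: lerXn2r; rewrite ?nnegrE//; lra. Qed.

Lemma complex_sg_cvg x w y : 0 < x -> 16 * ang * rnorm w <= x ->
  rcvg (fun N => \sum_(k < N) taylor_term x w y k) (complex_sg x w y).
Proof.
move=> x0 wx; have My : 0 <= ext_bound * rnorm y by rewrite mulr_ge0 ?rnorm_ge0.
have ub k : rnorm (taylor_term x w y k) <= ext_bound * rnorm y * 2^-1 ^+ k.
  by apply: le_trans (taylor_term_geom y k x0 wx) _; rewrite ler_wpM2l.
exact: (xgetPex 0 (series_cvg Yc My ub)).
Qed.

Lemma complex_sgP x w y (p : Y) : 0 < x -> 16 * ang * rnorm w <= x ->
  rcvg (fun N => \sum_(k < N) taylor_term x w y k) p -> complex_sg x w y = p.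
Proof. by move=> x0 wx hp; exact: rcvg_unique (complex_sg_cvg y x0 wx) hp. Qed.

Lemma complex_sg_bound x w y : 0 < x -> 16 * ang * rnorm w <= x ->
  rnorm (complex_sg x w y) <= 2 * ext_bound * rnorm y.
Proof.
move=> x0 wx; have My : 0 <= ext_bound * rnorm y by rewrite mulr_ge0 ?rnorm_ge0.
rewrite -mulrA; apply: series_bound (complex_sg_cvg y x0 wx) => // k.
by apply: le_trans (taylor_term_geom y k x0 wx) _; rewrite ler_wpM2l.
Qed.

Lemma taylor_term_linear x w k : 0 < x -> linear (taylor_term x w ^~ k).
Proof.
move=> x0 a y y'; rewrite /taylor_term (sg_deriv_linear sg Yc)// scalerDr.
by rewrite !scalerA mulrC.
Qed.

Lemma partial_sum_linear x w N : 0 < x ->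
  linear (fun y => \sum_(k < N) taylor_term x w y k).
Proof.
move=> x0 a y y'; rewrite scaler_sumr -big_split/=; apply: eq_bigr => k _.
exact: (taylor_term_linear w k x0).
Qed.

Lemma complex_sg_linear x w : 0 < x -> 16 * ang * rnorm w <= x -> linear (complex_sg x w).
Proof.
move=> x0 wx a y y'; apply: complex_sgP => //.
move=> eta /(rcvgD (rcvgZ a (complex_sg_cvg y x0 wx)) (complex_sg_cvg y' x0 wx))[N hN].
by exists N => n /hN; rewrite (partial_sum_linear _ _ x0).
Qed.

Lemma complex_sg0 x y : 0 < x -> complex_sg x 0 y = T x y.
Proof.
move=> x0; apply: complex_sgP => //; first by rewrite rnorm0 mulr0 ltW.
move=> eta eta0; exists 1%N => -[//|n] _; rewrite big_ord_recl big1 => [|k _].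
  by rewrite addr0 /taylor_term expr0 fact0 divr1 scale1r (sg_deriv0 sg Yc)// subrr rnorm0.
by rewrite /taylor_term expr0n/= mul0r scale0r.
Qed.

Lemma sg_derivZ k x z y : 0 < x -> E k x (z *: y) = z *: E k x y.
Proof.
move=> x0; pose F : {linear Y -> Y} := HB.pack (E k x)
  (GRing.isLinear.Build R[i] Y Y *:%R (E k x) (sg_deriv_linear sg Yc k x0)).
exact: (linearZ_LR F).
Qed.

Lemma taylor_term_mul x x' w v y k l : 0 < x -> 0 < x' ->
  taylor_term x w (taylor_term x' v y l) k =
  (w ^+ k / k`!%:R * (v ^+ l / l`!%:R)) *: E (k + l) (x + x') y.
Proof.
by move=> x0 x'0; rewrite /taylor_term sg_derivZ// (sg_deriv_mul sg Yc)// scalerA.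
Qed.

Lemma sum_taylor_add x x' w v y N : 0 < x -> 0 < x' ->
  \sum_(n < N) taylor_term (x + x') (w + v) y n =
  \sum_(k < N) \sum_(l < N | (k + l < N)%N) taylor_term x w (taylor_term x' v y l) k.
Proof.
move=> x0 x'0; rewrite -(sum_triangle (fun k l => taylor_term x w (taylor_term x' v y l) k)).
apply: eq_bigr => n _; rewrite /taylor_term [w + v]addrC exprDn mulr_suml scaler_suml.
apply: eq_bigr => k _; rewrite -!/(taylor_term _ _ _ _) taylor_term_mul//.
have kn : (k <= n)%N by rewrite -ltnS.
rewrite subnKC//; congr (_ *: _); rewrite -mulr_natr -(bin_fact kn) !natrM.
have f0 m : m`!%:R != 0 :> R[i] by rewrite pnatr_eq0 -lt0n fact_gt0.
have b0 : 'C(n, k)%:R != 0 :> R[i] by rewrite pnatr_eq0 -lt0n bin_gt0.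
by field; rewrite !f0 b0.
Qed.

(** Only the terms with k + l >= N remain, at most N^2 of them with decay 8^-N each. Since N <= 2^N,
    the rate 2^-N survives; this is why the series is kept at ratio 1/8. *)
Lemma sum_taylor_mul_dist x x' w v y N : 0 < x -> 0 < x' ->
  16 * ang * rnorm w <= x -> 16 * ang * rnorm v <= x' ->
  rnorm (\sum_(k < N) taylor_term x w (\sum_(l < N) taylor_term x' v y l) k -
         \sum_(n < N) taylor_term (x + x') (w + v) y n) <=
  ext_bound ^+ 2 * rnorm y * 2^-1 ^+ N.
Proof.
move=> x0 x'0 wx vx; rewrite sum_taylor_add//.
have -> : \sum_(k < N) taylor_term x w (\sum_(l < N) taylor_term x' v y l) k =
    \sum_(k < N) \sum_(l < N) taylor_term x w (taylor_term x' v y l) k.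
  apply: eq_bigr => k _.
  pose F : {linear Y -> Y} := HB.pack (taylor_term x w ^~ k)
    (GRing.isLinear.Build R[i] Y Y *:%R _ (taylor_term_linear w k x0)).
  exact: (linear_sum F).
rewrite -sumrB; have B0 : 0 <= ext_bound ^+ 2 * rnorm y * 8^-1 ^+ N.
  by rewrite mulr_ge0 ?exprn_ge0// mulr_ge0 ?sqr_ge0 ?rnorm_ge0.
have tl (k l : nat) : (N <= k + l)%N -> rnorm (taylor_term x w (taylor_term x' v y l) k) <=
    ext_bound ^+ 2 * rnorm y * 8^-1 ^+ N.
  move=> Nkl; apply: le_trans (taylor_term_geom _ k x0 wx) _.
  apply: (@le_trans _ _ (ext_bound * (ext_bound * rnorm y * 8^-1 ^+ l) * 8^-1 ^+ k)).
    by rewrite ler_wpM2r ?exprn_ge0// ler_wpM2l// taylor_term_geom.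
  rewrite [leLHS](_ : _ = ext_bound ^+ 2 * rnorm y * (8^-1 ^+ (k + l))); last first.
    by rewrite exprD; ring.
  apply: ler_wpM2l; first by rewrite mulr_ge0 ?sqr_ge0 ?rnorm_ge0.
  by apply: ler_wiXn2l => //; lra.
apply: (@le_trans _ _ (\sum_(k < N) \sum_(l < N) ext_bound ^+ 2 * rnorm y * 8^-1 ^+ N)).
  apply: le_trans (rnorm_sum _ _ _) _; apply: ler_sum => k _.
  rewrite (bigID (fun l : 'I_N => (k + l < N)%N))/= addrAC subrr add0r.
  apply: le_trans (rnorm_sum _ _ _) _; rewrite [leRHS](bigID (fun l : 'I_N => (k + l < N)%N))/=.
  rewrite ler_wpDl//; first by rewrite sumr_ge0.
  by apply: ler_sum => l; rewrite -leqNgt; exact: tl.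
rewrite !sumr_const card_ord -mulrnA -[leLHS]mulr_natr natrM -[leLHS]mulrA.
apply: ler_wpM2l; first by rewrite mulr_ge0 ?sqr_ge0 ?rnorm_ge0.
have N2 : N%:R <= 2 ^+ N :> R by rewrite -natrX ler_nat ltnW// ltn_expl.
apply: (@le_trans _ _ (8^-1 ^+ N * (2 ^+ N * 2 ^+ N))).
  by rewrite ler_wpM2l ?exprn_ge0// ler_pM.
by rewrite -!exprMn (_ : 8^-1 * (2 * 2) = 2^-1)//; field.
Qed.

(** The binomial formula together with [sg_deriv_mul] matches the Cauchy product of the two series
    with the series at x + x'. *)
Lemma complex_sg_mul x x' w v y : 0 < x -> 0 < x' ->
  16 * ang * rnorm w <= x -> 16 * ang * rnorm v <= x' ->
  complex_sg x w (complex_sg x' v y) = complex_sg (x + x') (w + v) y.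
Proof.
move=> x0 x'0 wx vx; apply/esym/complex_sgP.
- by rewrite addr_gt0.
- apply: (@le_trans _ _ (16 * ang * (rnorm w + rnorm v))); last by rewrite mulrDr lerD.
  by rewrite ler_wpM2l ?rnormD// mulr_ge0// ltW.
pose A N : {linear Y -> Y} := HB.pack (fun y => \sum_(k < N) taylor_term x w y k)
  (GRing.isLinear.Build R[i] Y Y *:%R _ (partial_sum_linear w N x0)).
have A1 N p : rnorm (A N p) <= 2 * ext_bound * rnorm p.
  rewrite -mulrA; have My : 0 <= ext_bound * rnorm p by rewrite mulr_ge0 ?rnorm_ge0.
  have uS m : rnorm (A m p - A m.+1 p) <= ext_bound * rnorm p * 2^-1 ^+ m.
    rewrite /= big_ord_recr/= opprD addrA subrr add0r rnormN.
    by apply: le_trans (taylor_term_geom p m x0 wx) _; rewrite ler_wpM2l.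
  have := geometric_dist (u := fun N => A N p) My uS (leq0n N).
  by rewrite /= big_ord0 sub0r rnormN expr0 mulr1.
have A2 p : rcvg (A ^~ p) (complex_sg x w p) by exact: complex_sg_cvg.
have lim := rcvg_comp A1 A2 (complex_sg_cvg y x'0 vx).
apply: (rcvg_dist (w := fun N => ext_bound ^+ 2 * rnorm y * 2^-1 ^+ N) lim).
  move=> eta eta0; have C0 : 0 < ext_bound ^+ 2 * rnorm y + 1.
    by rewrite ltr_wpDl// mulr_ge0 ?sqr_ge0 ?rnorm_ge0.
  have [N hN] := exprV2_lt (divr_gt0 eta0 C0); exists N => n /hN.
  rewrite ltr_pdivlMr// mulrC; apply: le_lt_trans.
  by rewrite ler_wpM2r ?exprn_ge0// lerDl.
by move=> N; rewrite rnormB; exact: sum_taylor_mul_dist.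
Qed.

Lemma complex_sg_taylor x w y : 0 < x -> 16 * ang * rnorm w <= x ->
  rnorm (complex_sg x w y - T x y - w *: E 1 x y) <=
  2 * (ext_bound * (16 * ang * rnorm w / x) ^+ 2 * rnorm y).
Proof.
move=> x0 wx; set B := ext_bound * _ * _.
have B0 : 0 <= B by rewrite mulr_ge0 ?rnorm_ge0// mulr_ge0 ?sqr_ge0.
pose u k := if (k < 2)%N then 0 else taylor_term x w y k.
apply: (@series_bound _ _ u _ B) => //.
  move=> k; rewrite /u; case: ltnP => k2; first by rewrite rnorm0 mulr_ge0// exprn_ge0.
  by apply: le_trans (taylor_term_sqr y x0 wx k2) _; rewrite ler_wpM2l.
move=> eta /(complex_sg_cvg y x0 wx)[N hN]; exists N.+2 => -[|[|n]]//.
rewrite !ltnS => Nn; apply: le_lt_trans (hN n.+2 (leqW (leqW Nn))).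
have e0 : taylor_term x w y 0 = T x y.
  by rewrite /taylor_term expr0 fact0 divr1 scale1r (sg_deriv0 sg Yc).
have e1 : taylor_term x w y 1 = w *: E 1 x y.
  by rewrite /taylor_term expr1 factS fact0 divr1.
rewrite !big_ord_recl /u /= e0 e1 !add0r.
by rewrite le_eqVlt; apply/orP; left; apply/eqP; congr rnorm; zmod.
Qed.

End analytic_extension.

(** * Operator norms *)

Section operator_norm.
Context {R : realType}.

Lemma opnorm_le (Y Z : normedModType R[i]) (F : Y -> Z) (B : R) :
  0 <= B -> (forall y, rnorm (F y) <= B * rnorm y) -> (opnorm F <= B%:E)%E.
Proof.
move=> B0 FB; apply: ge_ereal_sup => _ [y /= y1 <-]; rewrite lee_fin.
by rewrite (le_trans (FB y))// ler_piMr.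
Qed.

Lemma opnorm_bound (Y Z : normedModType R[i]) (F : {linear Y -> Z}) (B : R) :
  0 <= B -> (opnorm F <= B%:E)%E -> forall y, rnorm (F y) <= B * rnorm y.
Proof.
move=> B0 FB y; have [->|y0] := eqVneq y 0; first by rewrite raddf0 !rnorm0 mulr0.
have ny : 0 < rnorm y.
  by rewrite lt_neqAle rnorm_ge0 andbT eq_sym; apply: contra_neq y0 => /rnorm0_eq0.
have : ((rnorm (F ((rnorm y)^-1%:C *: y)))%:E <= opnorm F)%E.
  apply: ereal_sup_ubound; exists ((rnorm y)^-1%:C *: y) => //=.
  by rewrite rnormZC ger0_norm ?invr_ge0 ?rnorm_ge0// mulVf// gt_eqF.
move=> /le_trans /(_ FB); rewrite lee_fin linearZ rnormZC ger0_norm ?invr_ge0 ?rnorm_ge0//.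
by rewrite ler_pdivrMl// mulrC.
Qed.

Lemma opnorm_ge0 (Y Z : normedModType R[i]) (F : Y -> Z) : (0 <= opnorm F)%E.
Proof.
apply: (@le_trans _ _ (rnorm (F 0))%:E); first by rewrite lee_fin rnorm_ge0.
by apply: ereal_sup_ubound; exists 0 => //=; rewrite rnorm0.
Qed.

Lemma ereal_cvg0 (I : Type) (F : set_system I) (FF : Filter F) (f : I -> \bar R) :
  (forall x, (0 <= f x)%E) -> (forall eta : R, 0 < eta -> \forall x \near F, (f x <= eta%:E)%E) ->
  f @ F --> (0 : \bar R).
Proof.
move=> f0 fF; have ffin : \forall x \near F, f x \is a fin_num.
  apply: filterS (fF _ ltr01) => x fx; rewrite ge0_fin_numE//.
  by rewrite (le_lt_trans fx)// ltry.
apply/fine_cvgP; split => //; apply/cvgrPdist_le => eta eta0.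
apply: filterS2 ffin (fF _ eta0) => x fx fe /=.
by rewrite sub0r normrN ger0_norm ?fine_ge0// -lee_fin fineK.
Qed.

Lemma near_dnbhs0_rnorm (r : R) : 0 < r -> \forall h \near (0 : R[i])^', h != 0 /\ rnorm h < r.
Proof.
move=> r0; have r0C : 0 < r%:C by rewrite ltcR.
have : \forall h \near (0 : R[i])^', `|h| < r%:C by exact: dnbhs0_lt.
have : \forall h \near (0 : R[i])^', h != 0 by exact: nbhs_dnbhs_neq.
by apply: filterS2 => h h0; rewrite rnormE ltcR.
Qed.

End operator_norm.

(** * The extension on a cone and its expansion at real points *)

Section holomorphic_extension.
Context {R : realType} {Y : normedModType R[i]} (T : R -> {linear Y -> Y}) (e : R).
Hypothesis sg : contraction_semigroup T e.
Hypothesis Yc : forall u : Y^nat, rcauchy u -> exists a, rcvg u a.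
Implicit Types (a b c r s t x : R) (y : Y) (w v z h : R[i]).
Local Notation ang := (ang e).
Local Notation M := (ext_bound e).
Local Notation E := (sg_deriv T).
Local Notation cst := (diff_const e).
Let M0 : 0 <= M := le_trans ler01 (ext_bound_ge1 sg).
Let G0 : 0 < ang := lt_le_trans ltr01 (ang_ge1 sg).

(** On [cone 16] the Taylor series at Re z is controlled; [cone 32] leaves room to split off half of
    the real part. *)
Definition cone (k : R) z := (0 < complex.Re z) && (k * ang * `|complex.Im z| <= complex.Re z).

Let L t : R := 4 * cst 1 ^+ 2 / t ^+ 2.
Let L0 t : 0 <= L t.
Proof. by rewrite /L divr_ge0 ?sqr_ge0// mulr_ge0// sqr_ge0. Qed.

(** For a < 0 the forward expansion is taken at t + a >= t/2, where [L] is at most 4 [L t], and read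
    backwards. *)
Lemma sg_taylor_two_sided t a y : 0 < t -> `|a| <= t / 2 ->
  rnorm (T (t + a) y - T t y - a%:C *: E 1 t y) <= 8 * L t * a ^+ 2 * rnorm y /\
  rnorm (E 1 (t + a) y - E 1 t y) <= 4 * L t * `|a| * rnorm y.
Proof.
move=> t0; rewrite ler_norml => /andP[a1 a2].
have [a0|a0|->] := ltgtP a 0; last first.
- rewrite addr0 !subrr normr0 expr0n/= !mulr0 !mul0r rnorm0; split=> //.
  by rewrite rmorph0 scale0r subr0 rnorm0.
- split.
    apply: le_trans (sg_deriv_taylor sg Yc y t0 a0) _.
    rewrite ler_wpM2r ?rnorm_ge0// ler_wpM2r ?sqr_ge0// -/(L t).
    by rewrite ler_peMl//; lra.
  apply: le_trans (sg_deriv_add sg Yc y t0 a0) _; rewrite gtr0_norm//.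
  rewrite ler_wpM2r ?rnorm_ge0// ler_wpM2r ?(ltW a0)// -/(L t).
  by rewrite ler_peMl//; lra.
have s0 : 0 < - a by rewrite oppr_gt0.
have ta : 0 < t + a by lra.
have Lt : L (t + a) <= 4 * L t.
  have tt : (t / 2) ^+ 2 <= (t + a) ^+ 2 by rewrite ler_pXn2r// ?nnegrE; lra.
  rewrite {1}/L ler_pdivrMr ?exprn_gt0//.
  apply: le_trans (ler_wpM2l _ tt); last by rewrite mulr_ge0.
  by rewrite le_eqVlt; apply/orP; left; apply/eqP; rewrite /L; field; rewrite gt_eqF.
have h1 := sg_deriv_taylor sg Yc y ta s0; have h2 := sg_deriv_add sg Yc y ta s0.
rewrite -/(L _) addrK in h1; rewrite -/(L _) addrK in h2.
have h3 : rnorm (E 1 (t + a) y - E 1 t y) <= 4 * L t * `|a| * rnorm y.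
  rewrite rnormB (le_trans h2)// ltr0_norm// ler_wpM2r ?rnorm_ge0//.
  by rewrite ler_wpM2r// ltW.
split => //.
rewrite (_ : _ - _ - _ = (a%:C *: (E 1 (t + a) y - E 1 t y)) -
    (T t y - T (t + a) y - (- a)%:C *: E 1 (t + a) y)); last first.
  by rewrite rmorphN scaleNr scalerBr; zmod.
apply: le_trans (rnorm_subr _ _) _; rewrite rnormZC.
have h4 : `|a| * rnorm (E 1 (t + a) y - E 1 t y) <= 4 * L t * a ^+ 2 * rnorm y.
  apply: le_trans (ler_wpM2l (normr_ge0 a) h3) _.
  rewrite -[a ^+ 2](real_normK (num_real a)).
  by rewrite le_eqVlt; apply/orP; left; apply/eqP; ring.
have h5 : L (t + a) * (- a) ^+ 2 * rnorm y <= 4 * L t * a ^+ 2 * rnorm y.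
  by rewrite sqrrN ler_wpM2r ?rnorm_ge0// ler_wpM2r ?sqr_ge0.
by apply: le_trans (lerD h4 (le_trans h1 h5)) _; lra.
Qed.

(** The identity is a default outside the cone; at 0 it is the value that convergence at 0
    requires. *)
Definition complex_ext_fun z y : Y :=
  if cone 16 z then complex_sg T (complex.Re z) (0 +i* complex.Im z) y else y.

Lemma rnorm_imag (b : R) : rnorm (0 +i* b : R[i]) = `|b|.
Proof. by rewrite rnormC_def/= expr0n/= add0r sqrtr_sqr. Qed.

Lemma complex_ext_linear z : linear (complex_ext_fun z).
Proof.
move=> c x y; rewrite /complex_ext_fun; case: ifPn => // /andP[z0 zI].
by apply: (complex_sg_linear sg Yc) => //; rewrite rnorm_imag.
Qed.

Lemma cone_weaken k z : 16 <= k -> cone k z -> cone 16 z.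
Proof.
move=> k16 /andP[z0 zI]; rewrite /cone z0/=; apply: le_trans zI.
by rewrite ler_wpM2r// ler_wpM2r// ltW.
Qed.

Lemma complex_ext_bound z y : rnorm (complex_ext_fun z y) <= 2 * M * rnorm y.
Proof.
rewrite /complex_ext_fun; case: ifPn => [/andP[z0 zI]|_].
  by apply: (complex_sg_bound sg Yc) => //; rewrite rnorm_imag.
by rewrite ler_peMl ?rnorm_ge0//; have := ext_bound_ge1 sg; lra.
Qed.

Lemma complex_ext_real t y : 0 < t -> complex_ext_fun t%:C y = T t y.
Proof.
move=> t0; rewrite /complex_ext_fun /cone/= t0 normr0 mulr0 ltW//=.
exact: (complex_sg0 sg Yc).
Qed.

Lemma cone_add k z w : 0 <= k -> cone k z -> cone k w -> cone k (z + w).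
Proof.
case: z w => a b [c d] k0 /andP[/= a0 ab] /andP[/= c0 cd]; rewrite /cone/= addr_gt0//=.
apply: le_trans (lerD ab cd); rewrite -mulrDr ler_wpM2l ?ler_normD//.
by rewrite mulr_ge0// ltW.
Qed.

Lemma complex_ext_mul z w y : cone 16 z -> cone 16 w ->
  complex_ext_fun z (complex_ext_fun w y) = complex_ext_fun (z + w) y.
Proof.
move=> cz cw; rewrite /complex_ext_fun cone_add// cz cw.
case/andP: cz cw => z0 zI /andP[w0 wI].
rewrite (complex_sg_mul sg Yc) ?rnorm_imag//.
by case: z w {z0 zI w0 wI} => a b [c d]/=; simpc.
Qed.

(** For h = a + i b, the vertical step i b is expanded at x + a by the power series, the horizontal
    step a by the real expansion, and the derivatives at x + a and x are compared. *)
Lemma complex_ext_taylor x : 0 < x -> exists r C, [/\ 0 < r, 0 <= C &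
  forall h, rnorm h < r -> cone 16 (x%:C + h) /\
  forall y, rnorm (complex_ext_fun (x%:C + h) y - T x y - h *: E 1 x y) <=
            C * rnorm h ^+ 2 * rnorm y].
Proof.
move=> x0; pose r := x / (64 * ang); pose D := 2 * (M * (32 * ang / x) ^+ 2).
have r0 : 0 < r by rewrite divr_gt0// mulr_gt0.
have D0 : 0 <= D by rewrite mulr_ge0// mulr_ge0// sqr_ge0.
exists r, (D + 12 * L x); split => //; first by rewrite addr_ge0// mulr_ge0.
case=> a b hr; set h := a +i* b in hr *.
have ha : `|a| <= rnorm h.
  rewrite -(@ler_pXn2r _ 2)// ?nnegrE ?rnorm_ge0// rnormC_sqr/= real_normK ?num_real//.
  by rewrite lerDl sqr_ge0.
have hb : `|b| <= rnorm h.
  rewrite -(@ler_pXn2r _ 2)// ?nnegrE ?rnorm_ge0// rnormC_sqr/= real_normK ?num_real//.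
  by rewrite lerDr sqr_ge0.
have rx : 64 * (ang * rnorm h) <= x.
  by move: hr; rewrite /r ltr_pdivlMr ?mulr_gt0// => /ltW; rewrite mulrC mulrA.
have ax : `|a| <= x / 2.
  have : 1 * rnorm h <= ang * rnorm h by rewrite ler_wpM2r ?rnorm_ge0// (ang_ge1 sg).
  by have := rnorm_ge0 h; lra.
have xa : x / 2 <= x + a by move: ax; rewrite ler_norml => /andP[]; lra.
have xa0 : 0 < x + a by lra.
have bang : ang * `|b| <= ang * rnorm h by rewrite ler_wpM2l// ltW.
have an0 : 0 <= ang * `|b| by rewrite mulr_ge0// ltW.
have cxh : cone 16 (x%:C + h).
  by rewrite /cone /h/= xa0 add0r/= -mulrA; lra.
split => // y; rewrite /complex_ext_fun cxh /h/= add0r.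
have bx : 16 * ang * rnorm (0 +i* b : R[i]) <= x + a by rewrite rnorm_imag -mulrA; lra.
have t1 := complex_sg_taylor sg Yc y xa0 bx.
have [t2 t3] := sg_taylor_two_sided y x0 ax.
set z := complex_sg _ _ _ _ in t1 *.
rewrite (_ : z - T x y - (a +i* b) *: E 1 x y =
   (z - T (x + a) y - (0 +i* b) *: E 1 (x + a) y) +
   ((T (x + a) y - T x y - a%:C *: E 1 x y) +
    (0 +i* b) *: (E 1 (x + a) y - E 1 x y))); last first.
  have -> : a +i* b = a%:C + (0 +i* b) :> R[i] by simpc.
  by rewrite scalerDl scalerBr; zmod.
apply: le_trans (rnormD _ _) _; rewrite 2!mulrDl; apply: lerD.
  apply: le_trans t1 _; rewrite rnorm_imag /D.
  set u := 16 * ang * `|b| / (x + a).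
  suff uu : u ^+ 2 <= (32 * ang / x) ^+ 2 * rnorm h ^+ 2.
    rewrite [leRHS](_ : _ = 2 * (M * ((32 * ang / x) ^+ 2 * rnorm h ^+ 2) * rnorm y)).
      by rewrite ler_wpM2l// ler_wpM2r ?rnorm_ge0// ler_wpM2l.
    by ring.
  have xI : (x + a)^-1 <= 2 / x.
    by rewrite -[leRHS]invf_div lef_pV2 ?posrE ?divr_gt0.
  rewrite -exprMn; apply: lerXn2r; rewrite ?nnegrE.
  - by rewrite divr_ge0 ?(ltW xa0)// -mulrA mulr_ge0.
  - by rewrite mulr_ge0 ?rnorm_ge0// divr_ge0 ?(ltW x0)// mulr_ge0// ltW.
  apply: (@le_trans _ _ (16 * (ang * rnorm h) * (2 / x))).
    rewrite /u -[16 * ang * _]mulrA; apply: ler_pM => //.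
    - by rewrite mulr_ge0.
    - by rewrite invr_ge0 ltW.
    - by rewrite ler_wpM2l.
  by rewrite le_eqVlt; apply/orP; left; apply/eqP; field; rewrite gt_eqF.
apply: le_trans (rnormD _ _) _; rewrite rnormZ rnorm_imag.
have h0 := rnorm_ge0 h.
have a2 : a ^+ 2 <= rnorm h ^+ 2.
  by rewrite -[a ^+ 2](real_normK (num_real a)) ler_pXn2r// nnegrE.
have ab : `|b| * `|a| <= rnorm h ^+ 2 by rewrite expr2 ler_pM.
have t4 : 8 * L x * a ^+ 2 * rnorm y <= 8 * L x * rnorm h ^+ 2 * rnorm y.
  by rewrite ler_wpM2r ?rnorm_ge0// ler_wpM2l// mulr_ge0.
have t5 : `|b| * rnorm (E 1 (x + a) y - E 1 x y) <= 4 * L x * rnorm h ^+ 2 * rnorm y.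
  apply: le_trans (ler_wpM2l (normr_ge0 b) t3) _.
  rewrite mulrA ler_wpM2r ?rnorm_ge0// mulrCA ler_wpM2l// mulr_ge0//.
by apply: le_trans (lerD (le_trans t2 t4) t5) _; lra.
Qed.

End holomorphic_extension.

(** * Holomorphy, continuity at 0 and the real derivative *)

Section bounded_holomorphic.
Context {R : realType} {Y : normedModType R[i]} (T : R -> {linear Y -> Y}) (e : R).
Hypothesis sg : contraction_semigroup T e.
Hypothesis Yc : forall u : Y^nat, rcauchy u -> exists a, rcvg u a.
Implicit Types (a b c r s t x : R) (y : Y) (w v z h : R[i]).
Local Notation ang := (ang e).
Local Notation M := (ext_bound e).
Local Notation E := (sg_deriv T).
Let M0 : 0 <= M := le_trans ler01 (ext_bound_ge1 sg).
Let M20 : 0 <= 2 * M. Proof. exact: mulr_ge0. Qed.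
Let G1 := ang_ge1 sg.
Let G0 : 0 < ang := lt_le_trans ltr01 G1.

Definition sector_angle : R := (64 * ang)^-1.

Let sector_angle_le : sector_angle <= 64^-1.
Proof. by rewrite /sector_angle lef_pV2 ?posrE ?mulr_gt0// ler_peMr. Qed.

(** Here cos t >= 1/2 and |sin t| <= |t|, so 32 [ang] |t| <= 1/2 is enough; this fixes the 64 in
    [sector_angle]. *)
Lemma arg_cone z t : z != 0 -> has_arg z t -> `|t| <= sector_angle -> cone e 32 z.
Proof.
move=> z0 [_]; rewrite rnormE => zt ta; have nz := rnorm_pos z0.
have t1 : `|t| <= 64^-1 := le_trans ta sector_angle_le.
have tpi : 0 <= `|t| <= pi.
  by rewrite normr_ge0 (le_trans t1)//; have := pi_ge2 R; lra.
have ct : 2^-1 <= cos t.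
  have := one_sub_cos_le tpi; rewrite cos_norm.
  have : `|t| ^+ 2 <= 64^-1 ^+ 2 by rewrite ler_pXn2r// nnegrE.
  lra.
have st : `|sin t| <= `|t|.
  have [t0|t0] := leP 0 t.
    rewrite (ger0_norm t0) ger0_norm ?abs_sin_le//.
    by rewrite sin_ge0_pi// t0; rewrite (ger0_norm t0) in tpi; case/andP: tpi.
  rewrite -[`|sin t|]normrN -sinN (ltr0_norm t0) in tpi *.
  have nt : 0 <= - t by rewrite oppr_ge0 ltW.
  by rewrite ger0_norm ?abs_sin_le// sin_ge0_pi.
rewrite zt /cone/= !mul0r subr0 addr0.
rewrite mulr_gt0//=; last lra.
rewrite normrM (ger0_norm (rnorm_ge0 z)) mulrCA ler_wpM2l ?rnorm_ge0//.
apply: le_trans ct; apply: (@le_trans _ _ (32 * ang * sector_angle)).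
  by rewrite ler_wpM2l ?(le_trans st)// mulr_ge0// ltW.
by rewrite /sector_angle le_eqVlt; apply/orP; left; apply/eqP; field; rewrite gt_eqF.
Qed.

Lemma sector_cone z : sector sector_angle z -> cone e 32 z.
Proof. by move=> [z0 [t zt /ltW]]; exact: arg_cone. Qed.

Definition complex_ext z : {linear Y -> Y} := HB.pack (complex_ext_fun T e z)
  (GRing.isLinear.Build R[i] Y Y *:%R _ (complex_ext_linear sg Yc z)).

Let E_linear k x : 0 < x -> linear (E k x).
Proof. exact: (sg_deriv_linear sg Yc). Qed.

(** Reduction to a real point: with x = Re z/2 and w = z - x, still in [cone 16], T(z + h) - T(z) =
    T(w) (T(x + h) - T(x)). *)
Lemma complex_ext_cderive z : cone e 32 z -> exists D, is_op_cderive complex_ext z D.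
Proof.
move=> cz; pose x := complex.Re z / 2; pose w := z - x%:C.
have x0 : 0 < x by rewrite divr_gt0//; case/andP: cz.
have cw : cone e 16 w.
  case/andP: cz; rewrite /w /x; case: (z) => a b /= a0 ab; rewrite /cone/= subr0.
  by apply/andP; split; lra.
pose D0 : {linear Y -> Y} := HB.pack (E 1 x) (GRing.isLinear.Build R[i] Y Y *:%R _ (E_linear 1 x0)).
pose D : {linear Y -> Y} := complex_ext w \o D0; exists D.
have [r [C [r0 C0 tay]]] := complex_ext_taylor sg Yc x0.
have Dle y : rnorm (D y) <= (2 * M * (diff_const e 1 / x ^+ 1)) * rnorm y.
  apply: le_trans (complex_ext_bound sg Yc _ _) _; rewrite -[leRHS]mulrA ler_wpM2l//.
  exact: (sg_deriv_bound sg Yc 1 y x0).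
have cst0 := diff_const_ge0 sg 1.
split.
  apply: (@le_lt_trans _ _ (2 * M * (diff_const e 1 / x ^+ 1))%:E); last exact: ltry.
  by apply: opnorm_le Dle; rewrite mulr_ge0// divr_ge0// exprn_ge0// ltW.
apply: ereal_cvg0 => [h|eta eta0]; first exact: opnorm_ge0.
pose C' := 2 * M * C + 1; have C'0 : 0 < C' by rewrite ltr_wpDl// mulr_ge0.
have m0 : 0 < Num.min r (eta / C') by rewrite lt_min r0 divr_gt0.
apply: filterS (near_dnbhs0_rnorm m0) => h [h0]; rewrite lt_min => /andP[hr he].
apply: opnorm_le => [|y]; first exact: ltW.
have [cxh /(_ y) th] := tay h hr.
have cx : cone e 16 x%:C by rewrite /cone/= x0 normr0 mulr0 ltW.
have zE : z = w + x%:C by rewrite /w subrK.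
have e1 : complex_ext (z + h) y = complex_ext w (complex_ext_fun T e (x%:C + h) y).
  by rewrite /= (complex_ext_mul sg Yc)// addrA -zE.
have e2 : complex_ext z y = complex_ext w (T x y).
  by rewrite -(complex_ext_real sg Yc y x0) /= (complex_ext_mul sg Yc)// -zE.
rewrite e1 e2 -linearB.
have -> : D y = h^-1 *: complex_ext w (h *: E 1 x y).
  by rewrite linearZ scalerA mulVf// scale1r.
rewrite -scalerBr -linearB rnormZ rnormV ler_pdivrMl ?rnorm_pos//.
apply: le_trans (complex_ext_bound sg Yc _ _) _.
apply: le_trans (ler_wpM2l _ th) _; first exact: M20.
have hC : rnorm h * C' <= eta by rewrite -ler_pdivlMr// ltW.
apply: (@le_trans _ _ (rnorm h * (rnorm h * C') * rnorm y)).
  rewrite [leRHS](_ : _ = 2 * M * (C * rnorm h ^+ 2 * rnorm y) + rnorm h ^+ 2 * rnorm y).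
    by rewrite lerDl mulr_ge0 ?sqr_ge0 ?rnorm_ge0.
  by rewrite /C'; ring.
by rewrite [leRHS]mulrA ler_wpM2r ?rnorm_ge0// ler_wpM2l// rnorm_ge0.
Qed.

(** For a fixed small s, T(z) T_s y = T(s + z) y is continuous in z by the expansion at s, and the
    uniform bound controls T(z) (T_s y - y). *)
Lemma complex_ext_cvg0 y (a : R) : 0 < a < sector_angle ->
  complex_ext z y @[z --> within (closed_sector a) (nbhs (0 : R[i]))] --> y.
Proof.
move=> /andP[a0 aS]; apply/cvgrPdist_lt => epsC epsC0.
have [eps eps0 ->] : exists2 eps : R, 0 < eps & epsC = eps%:C.
  case: epsC epsC0 => b b'; rewrite ltcE/= => /andP[/eqP -> b0]; exists b => //.
have M1 : 0 < 2 * M + 2 by rewrite ltr_wpDl.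
have [r r0 hr] := csg_cvg0 sg y (divr_gt0 eps0 (mulr_gt0 (ltr0n R 2%N) M1)).
pose s := r / 2; have s0 : 0 < s by rewrite divr_gt0.
have {hr}ys : rnorm (T s y - y) < eps / (2 * (2 * M + 2)).
  by apply: hr; rewrite s0 /s ltr_pdivrMr// mulr_natr mulr2n ltrDl.
have [r' [C [r'0 C0 tay]]] := complex_ext_taylor sg Yc s0.
pose B := C * r' * rnorm y + rnorm (E 1 s y) + 1.
have B0 : 0 < B by rewrite ltr_wpDl// addr_ge0 ?rnorm_ge0// !mulr_ge0 ?rnorm_ge0// ltW.
have m0 : 0 < Num.min r' (eps / (2 * B)) by rewrite lt_min r'0 divr_gt0// mulr_gt0.
have m0C : 0 < (Num.min r' (eps / (2 * B)))%:C by rewrite ltcR.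
rewrite near_withinE; have := @nbhs0_lt R[i] R[i] _ m0C.
apply: filterS => z; rewrite !rnormE !ltcR lt_min => /andP[zr ze].
have [-> _|z0] := eqVneq z 0.
  by rewrite /= /complex_ext_fun /cone/= ltxx/= subrr rnorm0.
move=> [/eqP|[t zt ta]]; first by rewrite (negPf z0).
have cz : cone e 16 z.
  by apply: (@cone_weaken _ _ _ _ sg 32); rewrite ?ler_nat//; apply: arg_cone zt _ => //; lra.
have cs : cone e 16 s%:C by rewrite /cone/= s0 normr0 mulr0 ltW.
have [_ /(_ y) th] := tay z zr.
have e1 : complex_ext z (T s y) = complex_ext_fun T e (s%:C + z) y.
  by rewrite -(complex_ext_real sg Yc y s0) /= (complex_ext_mul sg Yc)// addrC.
have h1 : rnorm (y - complex_ext z y) <=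
    rnorm (T s y - y) + rnorm (complex_ext z (T s y - y)) + rnorm (complex_ext z (T s y) - T s y).
  rewrite linearB (_ : y - _ = - (T s y - y) + ((complex_ext z (T s y) - complex_ext z y) -
     (complex_ext z (T s y) - T s y))); last by zmod.
  apply: le_trans (rnormD _ _) _; rewrite rnormN -[leRHS]addrA lerD2l.
  exact: rnorm_subr.
apply: le_lt_trans h1 _.
have h2 : rnorm (complex_ext z (T s y - y)) <= 2 * M * rnorm (T s y - y).
  exact: (complex_ext_bound sg Yc).
have h3 : rnorm (complex_ext z (T s y) - T s y) <= rnorm z * B.
  rewrite e1; apply: le_trans (rnormDle _ (z *: E 1 s y)) _.
  apply: le_trans (lerD (lexx _) th) _; rewrite rnormZ /B !mulrDr mulr1.
  have : C * rnorm z ^+ 2 * rnorm y <= rnorm z * (C * r' * rnorm y).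
    rewrite [leLHS](_ : _ = rnorm z * (C * rnorm z * rnorm y)); last by ring.
    by rewrite ler_wpM2l ?rnorm_ge0// ler_wpM2r ?rnorm_ge0// ler_wpM2l// ltW.
  by have := rnorm_ge0 z; lra.
have h4 : rnorm z * B < eps / 2.
  by move: ze; rewrite ltr_pdivlMr ?mulr_gt0//; lra.
have h5 : (2 * M + 2) * rnorm (T s y - y) < eps / 2.
  by move: ys; rewrite ltr_pdivlMr ?mulr_gt0//; lra.
by have := rnorm_ge0 (T s y - y); lra.
Qed.

Lemma complex_ext_bhs : bounded_holomorphic_semigroup sector_angle complex_ext.
Proof.
have ob z : (opnorm (complex_ext z) <= (2 * M)%:E)%E.
  by apply: opnorm_le => [|y]; [exact: M20|exact: (complex_ext_bound sg Yc)].
split.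
- rewrite invr_gt0 mulr_gt0//= (le_lt_trans sector_angle_le)//.
  by have := pi_ge2 R; lra.
- by move=> z _; rewrite (le_lt_trans (ob z))// ltry.
- move=> z w /sector_cone cz /sector_cone cw y.
  by rewrite /= (complex_ext_mul sg Yc)// (@cone_weaken _ _ _ _ sg 32)// ler_nat.
- by move=> z /sector_cone; exact: complex_ext_cderive.
- exact: complex_ext_cvg0.
- by move=> a _; exists (2 * M) => z _; exact: ob.
Qed.

Lemma sg_rderive : exists dT : R -> {linear Y -> Y}, forall t, 0 < t ->
  is_op_rderive T t (dT t) /\
  (opnorm (fun y => t%:C *: dT t y) <= (diff_const e 1)%:E)%E.
Proof.
have cst0 := diff_const_ge0 sg 1.
have H t : exists D : {linear Y -> Y}, 0 < t -> is_op_rderive T t D /\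
    (opnorm (fun y => t%:C *: D y) <= (diff_const e 1)%:E)%E.
  have [t0|t0] := ltP 0 t; last by exists (\0 : {linear Y -> Y}).
  pose D : {linear Y -> Y} := HB.pack (E 1 t) (GRing.isLinear.Build R[i] Y Y *:%R _ (E_linear 1 t0)).
  have Dle y : rnorm (D y) <= diff_const e 1 / t * rnorm y.
    by have := sg_deriv_bound sg Yc 1 y t0; rewrite expr1.
  exists D => _; split; last first.
    apply: opnorm_le => // y; rewrite rnormZC gtr0_norm//.
    by apply: le_trans (ler_wpM2l (ltW t0) (Dle y)) _; rewrite mulrA [t * _]mulrC divfK ?gt_eqF.
  split.
    apply: (@le_lt_trans _ _ (diff_const e 1 / t)%:E); last exact: ltry.
    by apply: opnorm_le Dle; rewrite divr_ge0// ltW.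
  apply: ereal_cvg0 => [h|eta eta0]; first exact: opnorm_ge0.
  pose q := 4 * diff_const e 1 ^+ 2 / t ^+ 2.
  have q0 : 0 <= q by rewrite divr_ge0 ?sqr_ge0// mulr_ge0// sqr_ge0.
  pose C := 8 * q + 1; have C0 : 0 < C by rewrite ltr_wpDl// mulr_ge0.
  have m0 : 0 < Num.min (t / 2) (eta / C) by rewrite lt_min !divr_gt0.
  have := @dnbhs0_lt R R _ m0; have : \forall a \near (0 : R)^', a != 0 by exact: nbhs_dnbhs_neq.
  apply: filterS2 => a a0; rewrite lt_min => /andP[at2 aC].
  apply: opnorm_le => [|y]; first exact: ltW.
  have [tay _] := sg_taylor_two_sided sg Yc y t0 (ltW at2).
  have -> : D y = (a^-1)%:C *: (a%:C *: E 1 t y).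
    by rewrite scalerA -rmorphM/= mulVf// scale1r.
  rewrite -scalerBr rnormZC normfV ler_pdivrMl ?normr_gt0//.
  apply: le_trans tay _; rewrite [leRHS]mulrA ler_wpM2r ?rnorm_ge0//.
  rewrite -/q.
  rewrite [leLHS](_ : _ = `|a| * (`|a| * (8 * q))); last first.
    by rewrite -[a ^+ 2](real_normK (num_real a)); ring.
  rewrite ler_wpM2l//; move: aC; rewrite ltr_pdivlMr// => /ltW; apply: le_trans.
  by rewrite ler_wpM2l// /C lerDl.
by have [dT hdT] := choice H; exists dT.
Qed.

End bounded_holomorphic.

(** * The spaces of p-integrable functions *)

Section Lp_facts.
Context {R : realType} {d} {Om : measurableType d}.
Variable mu : {measure set Om -> \bar R}.

Section general_exponent.
Variables (p : \bar R) (p1 : (1 <= p)%E).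
Implicit Types X : normedModType R[i].

Lemma Lp_valD X (f g : Lp_space mu p1 X) :
  \forall w \ae mu, Lp_val (f + g) w = Lp_val f w + Lp_val g w.
Proof.
by apply: filterS (Lp_val_pi (repr f + repr g)) => w; rewrite Lp_pi_add !reprK => ->.
Qed.

Lemma Lp_valZ X (a : R[i]) (f : Lp_space mu p1 X) :
  \forall w \ae mu, Lp_val (a *: f) w = a *: Lp_val f w.
Proof.
by apply: filterS (Lp_val_pi (a *: repr f)) => w; rewrite Lp_pi_scale reprK => ->.
Qed.

Lemma Lp_val0 X : \forall w \ae mu, Lp_val (0 : Lp_space mu p1 X) w = 0.
Proof.
by have := Lp_valZ 0 (0 : Lp_space mu p1 X); apply: filterS => w; rewrite !scale0r => ->.
Qed.

Lemma Lp_valB X (f g : Lp_space mu p1 X) :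
  \forall w \ae mu, Lp_val (f - g) w = Lp_val f w - Lp_val g w.
Proof.
apply: filterS2 (Lp_valD f (-1 *: g)) (Lp_valZ (-1) g) => w.
by rewrite !scaleN1r => -> ->.
Qed.

Lemma Lp_val_sum X (I : finType) (F : I -> Lp_space mu p1 X) :
  \forall w \ae mu, Lp_val (\sum_i F i) w = \sum_i Lp_val (F i) w.
Proof.
elim: (index_enum I) => [|i s IH].
  by apply: filterS (Lp_val0 X) => w; rewrite !big_nil.
by apply: filterS2 IH (Lp_valD (F i) (\sum_(j <- s) F j)) => w; rewrite !big_cons => <- ->.
Qed.

Lemma Lp_val_tensor X (f : Lp_space mu p1 R[i]) (x : X) :
  \forall w \ae mu, Lp_val (Lp_tensor f x) w = Lp_val f w *: x.
Proof. exact: Lp_val_class. Qed.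

Lemma Lp_val_meas X (f : Lp_space mu p1 X) : strongly_measurable (Lp_val f).
Proof. exact: Lp_elt_meas. Qed.

Lemma Lp_tensorDl X (f g : Lp_space mu p1 R[i]) (x : X) :
  Lp_tensor (f + g) x = Lp_tensor f x + Lp_tensor g x.
Proof.
apply/Lp_valP; near=> w.
rewrite (near (Lp_val_tensor (f + g) x) w)// (near (Lp_valD f g) w)//.
rewrite (near (Lp_valD (Lp_tensor f x) (Lp_tensor g x)) w)//.
rewrite (near (Lp_val_tensor f x) w)// (near (Lp_val_tensor g x) w)//.
by rewrite scalerDl.
Unshelve. all: by end_near. Qed.

Lemma Lp_tensorDr X (f : Lp_space mu p1 R[i]) (x y : X) :
  Lp_tensor f (x + y) = Lp_tensor f x + Lp_tensor f y.
Proof.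
apply/Lp_valP; near=> w.
rewrite (near (Lp_val_tensor f (x + y)) w)//.
rewrite (near (Lp_valD (Lp_tensor f x) (Lp_tensor f y)) w)//.
rewrite (near (Lp_val_tensor f x) w)// (near (Lp_val_tensor f y) w)//.
by rewrite scalerDr.
Unshelve. all: by end_near. Qed.

Lemma Lp_tensorZr X (f : Lp_space mu p1 R[i]) (a : R[i]) (x : X) :
  Lp_tensor f (a *: x) = a *: Lp_tensor f x.
Proof.
apply/Lp_valP; near=> w.
rewrite (near (Lp_val_tensor f (a *: x)) w)// (near (Lp_valZ a (Lp_tensor f x)) w)//.
by rewrite (near (Lp_val_tensor f x) w)// !scalerA mulrC.
Unshelve. all: by end_near. Qed.

Lemma Lp_tensorZl X (f : Lp_space mu p1 R[i]) (a : R[i]) (x : X) :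
  Lp_tensor (a *: f) x = a *: Lp_tensor f x.
Proof.
apply/Lp_valP; near=> w.
rewrite (near (Lp_val_tensor (a *: f) x) w)// (near (Lp_valZ a (Lp_tensor f x)) w)//.
by rewrite (near (Lp_val_tensor f x) w)// (near (Lp_valZ a f) w)// scalerA.
Unshelve. all: by end_near. Qed.

Lemma Lp_tensor0l X (x : X) : Lp_tensor (0 : Lp_space mu p1 R[i]) x = 0.
Proof. by rewrite -[Z in Lp_tensor Z _](scale0r 0) Lp_tensorZl scale0r. Qed.

Lemma Lp_tensor0r X (f : Lp_space mu p1 R[i]) : Lp_tensor f (0 : X) = 0.
Proof. by rewrite -[Z in Lp_tensor _ Z](scale0r 0) Lp_tensorZr scale0r. Qed.

Lemma Lp_tensor_suml X (I : finType) (F : I -> Lp_space mu p1 R[i]) (x : X) :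
  Lp_tensor (\sum_i F i) x = \sum_i Lp_tensor (F i) x.
Proof. by elim/big_ind2: _ => [|f g h k <- <-|//]; rewrite ?Lp_tensor0l ?Lp_tensorDl. Qed.

Lemma rnorm_Lp X (f : Lp_space mu p1 X) :
  (rnorm f)%:E = Lp_seminorm mu p (Lp_val f).
Proof. by rewrite -Lp_seminormK. Qed.

Lemma rnorm_Lp_le X Z (f : Lp_space mu p1 X) (g : Lp_space mu p1 Z) :
  (\forall w \ae mu, rnorm (Lp_val f w) <= rnorm (Lp_val g w)) -> rnorm f <= rnorm g.
Proof.
move=> fg; rewrite -lee_fin !rnorm_Lp; apply: le_Lnorm => //.
- exact/measurable_rnorm/Lp_val_meas.
- exact/measurable_rnorm/Lp_val_meas.
- by apply: filterS fg => w; rewrite /= !ger0_norm ?rnorm_ge0.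
Qed.

Lemma rnorm_tensor X (f : Lp_space mu p1 R[i]) (x : X) :
  rnorm (Lp_tensor f x) = rnorm f * rnorm x.
Proof.
have -> : rnorm f * rnorm x = rnorm ((rnorm x)%:C *: f).
  by rewrite rnormZC ger0_norm ?rnorm_ge0// mulrC.
apply/le_anti/andP; split; apply: rnorm_Lp_le;
  apply: filterS2 (Lp_val_tensor f x) (Lp_valZ (rnorm x)%:C f) => w -> ->;
  by rewrite rnormZC rnormZ ger0_norm ?rnorm_ge0// mulrC.
Qed.

End general_exponent.

Section finite_exponent.
Variables (q : R) (q1 : (1 <= q%:E)%E).
Implicit Types X : normedModType R[i].

Let q_ge1 : 1 <= q. Proof. by rewrite -lee_fin. Qed.
Let q0 : 0 < q. Proof. exact: lt_le_trans ltr01 q_ge1. Qed.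

(** The q-th power of the L_q norm, the form in which pointwise inequalities integrate. *)
Definition modular X (f : Om -> X) : \bar R := (\int[mu]_w (rnorm (f w) `^ q)%:E)%E.

Lemma modular_seminorm X (f : Om -> X) : modular f = (Lp_seminorm mu q%:E f `^ q)%E.
Proof.
rewrite /Lp_seminorm powR_Lnorm ?gt_eqF//; apply: eq_integral => w _.
by rewrite /= ger0_norm ?rnorm_ge0.
Qed.

Lemma Lp_fun_modular X (f : Om -> X) : strongly_measurable f -> (modular f < +oo)%E ->
  f \in Lp_fun mu q%:E X.
Proof.
move=> mf; rewrite modular_seminorm => /lty_poweRy h; apply/Lp_funP; split => //.
by apply: h; rewrite gt_eqF.
Qed.

Lemma modular_Lp X (f : Lp_space mu q1 X) : modular (Lp_val f) = (rnorm f `^ q)%:E.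
Proof. by rewrite modular_seminorm -rnorm_Lp poweR_EFin. Qed.

Lemma measurable_rnorm_powR X (f : Om -> X) : strongly_measurable f ->
  measurable_fun setT (fun w => (rnorm (f w) `^ q)%:E).
Proof.
move=> mf; apply/measurable_EFinP.
apply: (@measurableT_comp _ _ _ _ _ _ (@powR R ^~ q)) => //.
exact: measurable_rnorm.
Qed.

Lemma eq_modular X (f g : Om -> X) : strongly_measurable f -> strongly_measurable g ->
  (\forall w \ae mu, f w = g w) -> modular f = modular g.
Proof.
move=> mf mg fg; apply: ge0_ae_eq_integral => //.
- exact: measurable_rnorm_powR.
- exact: measurable_rnorm_powR.
- by move=> w _; rewrite lee_fin powR_ge0.
- by move=> w _; rewrite lee_fin powR_ge0.
- by apply: filterS fg => w -> _.
Qed.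

Lemma modular_class X (f : Om -> X) (fP : f \in Lp_fun mu q%:E X) :
  modular f = (rnorm (Lp_class q1 fP) `^ q)%:E.
Proof.
rewrite -modular_Lp; apply: eq_modular.
- by case/Lp_funP : fP.
- exact: Lp_val_meas.
- by apply: filterS (Lp_val_class q1 fP) => w ->.
Qed.

Lemma powR_inj_le (a b : R) : 0 <= a -> 0 <= b -> (a `^ q <= b `^ q) = (a <= b).
Proof.
move=> a0 b0; apply/idP/idP => [|ab]; last by rewrite ge0_ler_powR ?nnegrE// ltW.
by apply: contra_le => ba; rewrite gt0_ltr_powR ?nnegrE.
Qed.

End finite_exponent.

End Lp_facts.

Section topological_limits.
Context {R : realType}.
Implicit Types X : normedModType R[i].

Lemma pos_complexE (eps : R[i]) : 0 < eps -> exists2 e : R, 0 < e & eps = e%:C.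
Proof. by case: eps => a b; rewrite ltcE/= => /andP[/eqP -> a0]; exists a. Qed.

Lemma rcvgP X (u : X^nat) (a : X) : rcvg u a <-> u @ \oo --> a.
Proof.
split=> [ua|/cvgrPdist_lt ua eta eta0].
  apply/cvgrPdist_lt => eps /pos_complexE[e e0 ->]; have [N h] := ua e e0.
  by exists N => // n /h; rewrite rnormE ltcR rnormB.
have /ua[N _ h] : 0 < eta%:C by rewrite ltcR.
by exists N => n /h /=; rewrite rnormE ltcR rnormB.
Qed.

Lemma rcauchy_cvg (X : completeNormedModType R[i]) (u : X^nat) :
  rcauchy u -> exists a, rcvg u a.
Proof.
move=> uc; have : cauchy (u @ \oo).
  apply/cauchy_ballP => eps /pos_complexE[e e0 ->]; have [N h] := uc e e0.
  exists ([set x | exists2 n, (N <= n)%N & x = u n], [set x | exists2 n, (N <= n)%N & x = u n]).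
    by split; exists N => // n Nn; exists n.
  move=> [x y] [/= [m Nm ->] [n Nn ->]].
  by rewrite -ball_normE /= rnormE ltcR; exact: h.
move=> /cauchy_cvg /cvg_ex[a ua]; exists a; exact/rcvgP.
Qed.

End topological_limits.

(** * Density of simple functions in L_q *)

Section Lq_density.
Context {R : realType} {d} {Om : measurableType d}.
Variables (mu : {measure set Om -> \bar R}) (q : R) (q1 : (1 <= q%:E)%E).
Implicit Types X : normedModType R[i].
Let q_ge1 : 1 <= q. Proof. by rewrite -lee_fin. Qed.
Let q0 : 0 < q. Proof. exact: lt_le_trans ltr01 q_ge1. Qed.

Lemma simple_fun_mem (B : set Om) : measurable B -> simple_fun (fun w => w \in B).
Proof.
move=> mB; split; first exact: finite_finset.
move=> b; rewrite (_ : _ @^-1` _ = if b then B else ~` B).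
  by case: b => //; exact: measurableC.
apply/seteqP; split => w /=; case: b => /=.
- by move=> /set_mem.
- by move=> wB /mem_set; rewrite wB.
- by move=> /mem_set.
- by move=> wB; apply/negbTE; rewrite notin_setE.
Qed.

Lemma simple_fun_cut X (s : Om -> X) (B : set Om) : simple_fun s -> measurable B ->
  simple_fun (fun w => if w \in B then s w else 0).
Proof.
by move=> ss mB; apply: (simple_fun_op2 (fun (b : bool) x => if b then x else 0) (simple_fun_mem mB) ss).
Qed.

Lemma simple_fun_meas X (s : Om -> X) : simple_fun s -> strongly_measurable s.
Proof. by move=> ss; exists (fun=> s); split => // w; exact: cvg_cst. Qed.

Lemma strongly_measurableB X (f g : Om -> X) : strongly_measurable f ->
  strongly_measurable g -> strongly_measurable (f - g).
Proof.
by apply: (strongly_measurable_op2 (h := fun x y => x - y)) => u v a b; exact: cvgB.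
Qed.

Lemma powR_le_self (a : R) : 0 <= a <= 1 -> a `^ q <= a.
Proof.
move=> /andP[]; rewrite le_eqVlt => /predU1P[<- _|a0 a1].
  by rewrite powR0 ?gt_eqF.
by rewrite ge1r_powR ?a0.
Qed.

(** Simple approximants are cut to 0 where they exceed 2 |f|; then |f - t_n| <= 3 |f| and dominated
    convergence applies. *)
Lemma Lq_simple_approx X (y : Lp_space mu q1 X) (eps : R) : 0 < eps ->
  exists s (sP : s \in Lp_fun mu q%:E X), simple_fun s /\ rnorm (y - Lp_class q1 sP) < eps.
Proof.
move=> eps0; set f := Lp_val y; have mf : strongly_measurable f by exact: Lp_val_meas.
have [s [ss sf]] := mf.
pose B n := [set w | rnorm (s n w) <= 2 * rnorm (f w)].
have mB n : measurable (B n).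
  have := @measurable_fun_le _ _ R setT (fun w => rnorm (s n w)) (fun w => 2 * rnorm (f w)) measurableT.
  rewrite setTI; apply.
    exact/measurable_rnorm/simple_fun_meas.
  by apply: measurable_funM => //; exact: measurable_rnorm.
pose t n w := if w \in B n then s n w else 0.
have st n : simple_fun (t n) by exact: simple_fun_cut.
have mt n : strongly_measurable (t n) by exact: simple_fun_meas.
have t2 n w : rnorm (t n w) <= 2 * rnorm (f w).
  rewrite /t; case: ifPn => [/set_mem//|_].
  by rewrite rnorm0 mulr_ge0 ?rnorm_ge0.
have pw (c : R) w : 0 <= c -> (c * rnorm (f w)) `^ q = c `^ q * rnorm (f w) `^ q.
  by move=> c0; rewrite powRM ?rnorm_ge0.
have tL n : t n \in Lp_fun mu q%:E X.
  apply: (Lp_fun_modular q1) => //.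
  apply: (@le_lt_trans _ _ (\int[mu]_w ((2 `^ q)%:E * (rnorm (f w) `^ q)%:E))%E).
    apply: ge0_le_integral => //.
    - by move=> w _; rewrite lee_fin powR_ge0.
    - exact: measurable_rnorm_powR.
    - by apply: measurable_funeM; exact: measurable_rnorm_powR.
    - move=> w _; rewrite -EFinM lee_fin -pw// (powR_inj_le q1) ?rnorm_ge0//.
      by rewrite mulr_ge0 ?rnorm_ge0.
  rewrite ge0_integralZl_EFin ?powR_ge0//;
    [|by move=> w _; rewrite lee_fin powR_ge0|exact: measurable_rnorm_powR].
  by rewrite -/(modular mu q f) modular_Lp -EFinM ltry.
pose g n w := (rnorm (f w - t n w) `^ q)%:E.
have mg n : measurable_fun setT (g n).
  by apply: measurable_rnorm_powR; exact: strongly_measurableB.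
pose G w := ((3 `^ q)%:E * (rnorm (f w) `^ q)%:E)%E.
have iG : mu.-integrable setT G.
  apply: integrableZl => //; apply/integrableP; split; first exact: measurable_rnorm_powR.
  under eq_integral do rewrite gee0_abs ?lee_fin ?powR_ge0//.
  by rewrite -/(modular mu q f) modular_Lp ltry.
have gG n w : (`|g n w| <= G w)%E.
  rewrite gee0_abs; last by rewrite lee_fin powR_ge0.
  rewrite /g /G -EFinM lee_fin -pw// (powR_inj_le q1) ?rnorm_ge0//.
    by apply: le_trans (rnorm_subr _ _) _; have := t2 n w; lra.
  by rewrite mulr_ge0 ?rnorm_ge0.
have g0 w : g ^~ w @ \oo --> 0%E.
  apply: cvg_EFin; first exact: nearW.
  apply/cvgrPdist_lt => e e0.
  have m0 : 0 < Num.min e 1 by rewrite lt_min e0/=.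
  (* Where f w is nonzero the cut is eventually inactive; where f w = 0 the bound 2 |f| forces t n w
     = 0. *)
  have [N1 _ hN1] : \forall n \near \oo, t n w = s n w \/ f w = 0 /\ t n w = 0.
    have [fw0|fw0] := eqVneq (f w) 0.
      exists 0%N => // n _; right; split => //.
      by apply/rnorm0_eq0/le_anti; rewrite rnorm_ge0 andbT (le_trans (t2 n w))// fw0 rnorm0 mulr0.
    have fp : 0 < rnorm (f w).
      by rewrite lt_neqAle rnorm_ge0 andbT eq_sym; apply: contra_neq fw0 => /rnorm0_eq0.
    have /rcvgP/(_ _ fp)[N hN] := sf w; exists N => // n /hN h; left.
    rewrite /t ifT//; apply/mem_set; rewrite /B/=.
    by apply: le_trans (rnormDle _ (f w)) _; lra.
  have /rcvgP/(_ _ m0)[N2 hN2] := sf w.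
  exists (maxn N1 N2) => // n /=; rewrite geq_max => /andP[/hN1 h1 /hN2].
  rewrite lt_min sub0r normrN ger0_norm ?powR_ge0// => /andP[h2 h3].
  have : rnorm (f w - t n w) <= rnorm (s n w - f w).
    by case: h1 => [->|[-> ->]]; [rewrite rnormB|rewrite subrr rnorm0 rnorm_ge0].
  move=> h4; apply: le_lt_trans (powR_le_self _) (le_lt_trans h4 h2).
  by rewrite rnorm_ge0 (le_trans h4)// ltW.
have [_ _] := dominated_convergence measurableT mg (measurable_cst (0 : \bar R))
  (aeW _ (fun w _ => g0 w)) iG (aeW _ (fun w n _ => gG n w)).
rewrite integral0 => /fine_cvgP[hfin0] /cvgrPdist_lt /(_ _ (powR_gt0 q eps0)) hN0.
have [N1 _ hfin] := hfin0; have [N2 _ hN2] := hN0.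
pose n := maxn N1 N2; exists (t n), (tL n); split => //.
have := hN2 n (leq_maxr _ _) => /=; have := hfin n (leq_maxl _ _).
have -> : (\int[mu]_w g n w)%E = (rnorm (y - Lp_class q1 (tL n)) `^ q)%:E.
  rewrite -modular_Lp -[LHS]/(modular mu q (f - t n)); apply: eq_modular.
  - exact: strongly_measurableB.
  - exact: Lp_val_meas.
  apply: filterS2 (Lp_valB y (Lp_class q1 (tL n))) (Lp_val_class q1 (tL n)) => w -> ->.
  by [].
move=> _ /=; rewrite sub0r normrN ger0_norm ?powR_ge0//.
by rewrite !ltNge (powR_inj_le q1) ?rnorm_ge0// ltW.
Qed.

End Lq_density.

(** * Completeness of L_q *)

Section Lq_complete.
Context {R : realType} {d} {Om : measurableType d}.
Variables (mu : {measure set Om -> \bar R}) (q : R) (q1 : (1 <= q%:E)%E).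
Variable X : completeNormedModType R[i].
Local Notation L := (Lp_space mu q1 X).
Let q_ge1 : 1 <= q. Proof. by rewrite -lee_fin. Qed.
Let q0 : 0 < q. Proof. exact: lt_le_trans ltr01 q_ge1. Qed.

Section simple_sequence.
Variables (s : (Om -> X)^nat) (sP : forall n, s n \in Lp_fun mu q%:E X).
Hypothesis s_simple : forall n, simple_fun (s n).
Hypothesis s_fast : forall n,
  rnorm (Lp_class q1 (sP n) - Lp_class q1 (sP n.+1)) <= 3 * 4^-1 ^+ n.

Let c n : L := Lp_class q1 (sP n).
(** The weight 2^k makes s k w converge geometrically wherever the sum of the H k w is finite, while
    the rate 4^-k keeps their integrals summable. *)
Let H k w : R := (2 ^+ k * rnorm (s k w - s k.+1 w)) `^ q.
Let S w : \bar R := (\sum_(0 <= k <oo) (H k w)%:E)%E.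

Let ms n : strongly_measurable (s n). Proof. exact: simple_fun_meas. Qed.

Let mH k : measurable_fun setT (fun w => (H k w)%:E).
Proof.
apply/measurable_EFinP; apply: (@measurableT_comp _ _ _ _ _ _ (@powR R ^~ q)) => //.
apply: measurable_funM => //; apply: (@measurable_rnorm _ _ _ _ (s k - s k.+1)).
exact: strongly_measurableB.
Qed.

Let B : R := 2 * 3 `^ q.

Let int_H k : (\int[mu]_w (H k w)%:E <= (3 `^ q * 2^-1 ^+ k)%:E)%E.
Proof.
have -> : (\int[mu]_w (H k w)%:E = ((2 ^+ k * rnorm (c k - c k.+1)) `^ q)%:E)%E.
  rewrite powRM ?rnorm_ge0// EFinM -modular_Lp.
  have -> : modular mu q (Lp_val (c k - c k.+1)) = modular mu q (s k - s k.+1).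
    apply: eq_modular; [exact: Lp_val_meas|exact: strongly_measurableB|].
    have h1 := Lp_val_class q1 (sP k); have h2 := Lp_val_class q1 (sP k.+1).
    apply: filterS (filterI (Lp_valB (c k) (c k.+1)) (filterI h1 h2)).
    by move=> w [/= -> [-> ->]].
  rewrite -ge0_integralZl_EFin ?powR_ge0//; last 2 first.
  - by move=> w _; rewrite lee_fin powR_ge0.
  - by apply: measurable_rnorm_powR; exact: strongly_measurableB.
  by apply: eq_integral => w _; rewrite -EFinM -powRM ?rnorm_ge0.
rewrite lee_fin; apply: (@le_trans _ _ ((3 * 2^-1 ^+ k) `^ q)).
  rewrite (powR_inj_le q1) ?mulr_ge0 ?rnorm_ge0//.
  apply: le_trans (ler_wpM2l _ (s_fast k)) _ => //.
  have -> : (2^-1 : R) = 2 * 4^-1 by field.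
  by rewrite mulrCA exprMn.
rewrite powRM ?exprn_ge0//; apply: (ler_wpM2l (powR_ge0 3 q)).
have h0 : 0 <= (2^-1 : R) ^+ k by exact: exprn_ge0.
by apply: (powR_le_self q1); rewrite h0 exprn_ile1// invf_le1// ler1n.
Qed.

Let S0 w : (0 <= S w)%E.
Proof. by apply: nneseries_ge0 => n _ _; rewrite lee_fin powR_ge0. Qed.

Let mS : measurable_fun setT S.
Proof.
apply: ge0_emeasurable_sum => //= k w _ _; by rewrite lee_fin powR_ge0.
Qed.

Let int_S : (\int[mu]_w S w <= B%:E)%E.
Proof.
rewrite integral_nneseries//; last by move=> n w _; rewrite lee_fin powR_ge0.
apply: lime_le.
  by apply: is_cvg_nneseries => n _ _; apply: integral_ge0 => w _; rewrite lee_fin powR_ge0.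
apply: nearW => n; apply: (@le_trans _ _ (\sum_(0 <= k < n) (3 `^ q * 2^-1 ^+ k)%:E)%E).
  by apply: lee_sum => k _; exact: int_H.
rewrite sumEFin lee_fin -mulr_sumr /B mulrC ler_wpM2r ?powR_ge0//.
suff -> : \sum_(0 <= k < n) 2^-1 ^+ k = 2 - 2 * 2^-1 ^+ n :> R.
  by rewrite lerBlDr lerDl mulr_ge0// exprn_ge0.
elim: n => [|n ih]; first by rewrite big_nil expr0 mulr1 subrr.
by rewrite big_nat_recr//= ih exprS; field.
Qed.

Let term_le k w : S w \is a fin_num ->
  rnorm (s k w - s k.+1 w) <= fine (S w) `^ q^-1 * 2^-1 ^+ k.
Proof.
move=> Sfin; have HS : H k w <= fine (S w).
  rewrite -lee_fin fineK//; apply: le_trans (nneseries_lim_ge k.+1 _); last first.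
    by move=> n _ _; rewrite lee_fin powR_ge0.
  rewrite big_nat_recr//= leeDr// sume_ge0// => n _.
  by rewrite lee_fin powR_ge0.
have S0' : 0 <= fine (S w) by rewrite fine_ge0.
rewrite exprVn ler_pdivlMr ?exprn_gt0// mulrC.
rewrite -(powR_inj_le q1) ?mulr_ge0 ?rnorm_ge0 ?powR_ge0//.
by rewrite -powRrM mulVf ?gt_eqF// powRr1.
Qed.

(** Riesz-Fischer with simple representatives. Set to 0 on a null set off which S is finite, they
    converge everywhere, hence witness the strong measurability of their limit. *)
Lemma fast_simple_cvg : exists y : L, rcvg c y.
Proof.
have iS : mu.-integrable setT S.
  apply/integrableP; split => //; under eq_integral do rewrite gee0_abs//.
  by rewrite (le_lt_trans int_S)// ltry.
have [N [mN N0 NS]] := integrable_ae measurableT iS.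
have Sfin w : ~ N w -> S w \is a fin_num.
  by move=> Nw; apply: contrapT => h; apply: Nw; apply: NS => /(_ I).
pose t k w := if w \in ~` N then s k w else 0.
have mNC : measurable (~` N) by exact: measurableC.
have tin k w : ~ N w -> t k w = s k w by move=> Nw; rewrite /t ifT//; apply/mem_set.
have tout k w : N w -> t k w = 0.
  by move=> Nw; rewrite /t ifF//; apply/negbTE; rewrite notin_setE => /(_ Nw).
have ts k : simple_fun (t k) by exact: simple_fun_cut.
have tcvg w : exists a, rcvg (t ^~ w) a.
  have [Nw|Nw] := pselect (N w).
    by exists 0 => eta eta0; exists 0%N => k _; rewrite tout// subrr rnorm0.
  have C0 : 0 <= fine (S w) `^ q^-1 by exact: powR_ge0.
  apply: (@geometric_cvg _ _ _ (t ^~ w) _ C0) => [|k]; first exact: rcauchy_cvg.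
  by rewrite !tin//; apply/term_le/Sfin.
have [f tf] := choice tcvg.
have mf : strongly_measurable f by exists t; split => // w; apply/rcvgP.
have mt k : strongly_measurable (t k) by exact: simple_fun_meas.
have dist n w : ((rnorm ((f - t n) w) `^ q)%:E <= ((2 * 2^-1 ^+ n) `^ q)%:E * S w)%E.
  have [Nw|Nw] := pselect (N w).
    rewrite -[(f - t n) w]/(f w - t n w) tout// (_ : f w = 0).
      by rewrite subrr rnorm0 powR0 ?gt_eqF// mule_ge0 ?S0// lee_fin powR_ge0.
    apply: rcvg_unique (tf w) _ => eta eta0; exists 0%N => k _.
    by rewrite tout// subrr rnorm0.
  rewrite -[S w]fineK ?Sfin// -EFinM lee_fin; set C := fine (S w) `^ q^-1.
  have C0 : 0 <= C by exact: powR_ge0.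
  have S0' : 0 <= fine (S w) by rewrite fine_ge0.
  have CE : C `^ q = fine (S w) by rewrite -powRrM mulVf ?gt_eqF// powRr1.
  have h : rnorm (f w - t n w) <= 2 * C * 2^-1 ^+ n.
    apply: (rcvg_le (tf w)); exists n => k nk; rewrite rnormB.
    apply: (@geometric_dist _ _ (t ^~ w) C C0) => // j.
    by rewrite !tin//; apply/term_le/Sfin.
  rewrite -CE -powRM ?mulr_ge0 ?exprn_ge0//.
  rewrite (powR_inj_le q1) ?rnorm_ge0 ?mulr_ge0 ?exprn_ge0//.
  by apply: le_trans h _; rewrite mulrAC.
have modle n : (modular mu q (f - t n)%R <= ((2 * 2^-1 ^+ n) `^ q * B)%:E)%E.
  apply: (@le_trans _ _ (\int[mu]_w (((2 * 2^-1 ^+ n) `^ q)%:E * S w))%E).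
    apply: ge0_le_integral => //.
    - by move=> w _; rewrite lee_fin powR_ge0.
    - by apply: measurable_rnorm_powR; exact: strongly_measurableB.
    - exact: measurable_funeM.
  rewrite ge0_integralZl_EFin ?powR_ge0// EFinM.
  by apply: lee_wpmul2l => //; rewrite lee_fin powR_ge0.
have st n : \forall w \ae mu, s n w = t n w.
  by exists N; split => // w /= h; apply: contrapT => Nw; apply: h; rewrite tin.
have tP n : t n \in Lp_fun mu q%:E X.
  apply: (Lp_fun_modular q1) => //; rewrite -(eq_modular q (ms n) (mt n) (st n)).
  by rewrite (modular_class q1 (sP n)) ltry.
have fP : f \in Lp_fun mu q%:E X.
  rewrite (_ : f = (f - t 0%N) + t 0%N); last by rewrite subrK.
  have dP : f - t 0%N \in Lp_fun mu q%:E X.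
    apply: (Lp_fun_modular q1); first exact: strongly_measurableB.
    by apply: le_lt_trans (modle 0%N) _; exact: ltry.
  have [_ /(_ 1)] := @Lp_fun_submod_closed _ _ _ mu _ q1 X.
  by move=> /(_ _ _ dP (tP 0%N)); rewrite scale1r.
exists (Lp_class q1 fP) => eta eta0.
have K0 : 0 < 2 `^ q * B + 1 by rewrite ltr_wpDl// mulr_ge0 ?mulr_ge0 ?powR_ge0.
have [N' hN] := exprV2_lt (divr_gt0 (powR_gt0 q eta0) K0).
exists N' => n /hN; rewrite ltr_pdivlMr// => hn.
rewrite ltNge -(powR_inj_le q1) ?rnorm_ge0 ?(ltW eta0)// -ltNge; apply: le_lt_trans hn.
rewrite rnormB -lee_fin -modular_Lp.
have -> : modular mu q (Lp_val (Lp_class q1 fP - c n)) = modular mu q (f - t n).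
  apply: eq_modular; [exact: Lp_val_meas|exact: strongly_measurableB|].
  have h1 := Lp_val_class q1 fP; have h2 := Lp_val_class q1 (sP n).
  apply: filterS (filterI (Lp_valB (Lp_class q1 fP) (c n)) (filterI h1 (filterI h2 (st n)))).
  by move=> w [/= -> [-> [-> ->]]].
apply: le_trans (modle n) _; rewrite lee_fin powRM ?exprn_ge0//.
have e0 : 0 <= (2^-1 : R) ^+ n by rewrite exprn_ge0.
have : (2^-1 ^+ n) `^ q <= 2^-1 ^+ n.
  by apply: (powR_le_self q1); rewrite e0 exprn_ile1// invf_le1// ler1n.
have B0 : 0 <= 2 `^ q * B by rewrite mulr_ge0 ?mulr_ge0 ?powR_ge0.
move=> /(ler_wpM2l B0) h; rewrite mulrAC; apply: le_trans h _.
by rewrite mulrC ler_wpM2l// lerDl.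
Qed.

End simple_sequence.

Theorem Lq_complete (u : L^nat) : rcauchy u -> exists y, rcvg u y.
Proof.
move=> uc; have e0 n : 0 < (4^-1 : R) ^+ n by rewrite exprn_gt0.
have [k hk] := choice (fun n => uc _ (e0 n)).
have uk m n : (k n <= m)%N -> rnorm (u m - u (k n)) < 4^-1 ^+ n.
  by move=> h; exact: hk.
have H n : exists s : Om -> X, exists sP : s \in Lp_fun mu q%:E X,
    simple_fun s /\ rnorm (u (k n) - Lp_class q1 sP) < 4^-1 ^+ n.
  exact: Lq_simple_approx.
have [s hs] := choice H.
have sP n : s n \in Lp_fun mu q%:E X by case: (hs n).
have us n : rnorm (u (k n) - Lp_class q1 (sP n)) < 4^-1 ^+ n.
  by case: (hs n) => sP' []; rewrite (bool_irrelevance sP' (sP n)).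
have [||y cy] := @fast_simple_cvg s sP.
- by move=> n; case: (hs n) => ? [].
(* Four errors are chained, with total at most (1 + 1 + 1/4 + 1/4) 4^-n. *)
- move=> n; set N := maxn (k n) (k n.+1).
  have h1 := us n; have h2 := us n.+1.
  have h3 := uk N n (leq_maxl _ _); have h4 := uk N n.+1 (leq_maxr _ _).
  rewrite rnormB in h1; rewrite rnormB in h3.
  have t1 := rnorm_triangle (Lp_class q1 (sP n)) (u (k n)) (Lp_class q1 (sP n.+1)).
  have t2 := rnorm_triangle (u (k n)) (u (k n.+1)) (Lp_class q1 (sP n.+1)).
  have t3 := rnorm_triangle (u (k n)) (u N) (u (k n.+1)).
  have e4 := e0 n; rewrite exprS in h2; rewrite exprS in h4; lra.
exists y => eta eta0; have eta4 : 0 < eta / 4 by rewrite divr_gt0.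
have [|N1 h1] := @geometric_lt R 4^-1 _ _ eta4.
  by rewrite invr_ge0 invf_lt1// ler0n ltr1n.
have [N2 h2] := cy _ eta4.
have h1' := h1 _ (leq_maxl N1 N2); have h2' := h2 _ (leq_maxr N1 N2).
move: (maxn N1 N2) h1' h2' => n {}h1 {}h2; exists (k n) => m km.
apply: le_lt_trans (rnorm_triangle _ (u (k n)) _) _.
have h3 := rnorm_triangle (u (k n)) (Lp_class q1 (sP n)) y.
have := uk _ _ km; have := us n; lra.
Qed.
End Lq_complete.

(** * Coupling inequality for symmetric Markovian operators *)

Section powers.
Context {R : realType}.
Variables (q : R) (q1 : 1 < q).
Implicit Types a m : R.

Let q0 : 0 < q. Proof. exact: lt_trans ltr01 q1. Qed.

Lemma powR_mulr_pred m : 0 <= m -> m `^ (q - 1) * m = m `^ q.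
Proof.
move=> m0; have [->|m_neq0] := eqVneq m 0; first by rewrite mulr0 powR0 ?gt_eqF.
by rewrite -{2}(powRr1 m0) -powRD ?subrK// m_neq0 implybT.
Qed.

(** The graph of a^q lies above its tangent at m: Young's inequality for the exponents q and q/(q -
    1). *)
Lemma powR_tangent a m : 0 <= a -> 0 <= m ->
  m `^ q + q * m `^ (q - 1) * (a - m) <= a `^ q.
Proof.
move=> a0 m0; have q10 : 0 < q - 1 by rewrite subr_gt0.
have h : q^-1 + (q / (q - 1))^-1 = 1 by field; rewrite !gt_eqF.
have := conjugate_powR a0 (powR_ge0 m (q - 1)) q0 (divr_gt0 q0 q10) h.
rewrite -powRrM (_ : (q - 1) * _ = q); last by field; rewrite gt_eqF.
rewrite -(ler_pM2r q0) => {}h.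
have E : (a `^ q / q + m `^ q / (q / (q - 1))) * q = a `^ q + (q - 1) * m `^ q.
  by field; rewrite !gt_eqF.
rewrite E in h; have := powR_mulr_pred m0; nra.
Qed.

Variable X : normedModType R[i].
Local Notation N x := (rnorm (x : X) `^ q).

(** A sub-probability completed by a mass at v0; Jensen follows from the tangent at the mean m of
    the norms. *)
Lemma rnorm_jensen (I : finType) (c : I -> R) (v : I -> X) (v0 : X) :
  (forall i, 0 <= c i) -> \sum_i c i <= 1 ->
  N (\sum_i (c i)%:C *: v i + (1 - \sum_i c i)%:C *: v0) <=
  \sum_i c i * N (v i) + (1 - \sum_i c i) * N v0.
Proof.
move=> c0 c1; set s := \sum_i c i in c1 *; have s0 : 0 <= 1 - s by rewrite subr_ge0.
set m := \sum_i c i * rnorm (v i) + (1 - s) * rnorm v0.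
have m0 : 0 <= m.
  by rewrite addr_ge0 ?sumr_ge0// => [i _|]; rewrite mulr_ge0 ?rnorm_ge0.
apply: (@le_trans _ _ (m `^ q)).
  rewrite ge0_ler_powR ?nnegrE ?rnorm_ge0 ?(ltW q0)//.
  apply: le_trans (rnormD _ _) _; apply: lerD; last by rewrite rnormZC ger0_norm.
  apply: le_trans (rnorm_sum _ _ _) _; apply: ler_sum => i _.
  by rewrite rnormZC ger0_norm.
pose t a := m `^ q + q * m `^ (q - 1) * (a - m).
apply: (@le_trans _ _ (\sum_i c i * t (rnorm (v i)) + (1 - s) * t (rnorm v0))); last first.
  apply: lerD; last by rewrite ler_wpM2l// powR_tangent// rnorm_ge0.
  by apply: ler_sum => i _; rewrite ler_wpM2l// powR_tangent// rnorm_ge0.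
rewrite le_eqVlt; apply/orP; left; apply/eqP.
have -> : \sum_i c i * t (rnorm (v i)) =
    s * (m `^ q - q * m `^ (q - 1) * m) + q * m `^ (q - 1) * \sum_i c i * rnorm (v i).
  rewrite /s mulr_suml mulr_sumr -big_split/=; apply: eq_bigr => i _; rewrite /t; ring.
have -> : \sum_i c i * rnorm (v i) = m - (1 - s) * rnorm v0 by rewrite /m addrK.
rewrite /t; ring.
Qed.

(** Product coupling of the weights c and b, the missing mass of each sitting at 0. Once expanded,
    only c_i b_j, c_i and b_j appear, each linearly, so the bound integrates term by term. *)
Lemma transport_pointwise (I J : finType) (c : I -> R) (b : J -> R) (x : I -> X)
    (y : J -> X) : (forall i, 0 <= c i) -> \sum_i c i <= 1 ->
  (forall j, 0 <= b j) -> \sum_j b j <= 1 ->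
  N (\sum_i (c i)%:C *: x i - \sum_j (b j)%:C *: y j) <=
  \sum_i \sum_j c i * b j * (N (x i - y j) - N (x i) - N (y j)) +
  \sum_i c i * N (x i) + \sum_j b j * N (y j).
Proof.
move=> c0 c1 b0 b1.
pose r z := \sum_j (b j)%:C *: (z - y j) + (1 - \sum_j b j)%:C *: z.
have rE z : r z = z - \sum_j (b j)%:C *: y j.
  rewrite /r (eq_bigr (fun j => (b j)%:C *: z - (b j)%:C *: y j)); last first.
    by move=> j _; rewrite scalerBr.
  rewrite sumrB -scaler_suml addrAC -scalerDl.
  by rewrite -raddf_sum /= -rmorphD (addrC (\sum_j b j)) subrK scale1r.
have -> : \sum_i (c i)%:C *: x i - \sum_j (b j)%:C *: y j =
    \sum_i (c i)%:C *: r (x i) + (1 - \sum_i c i)%:C *: r 0.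
  have -> : \sum_i (c i)%:C *: r (x i) =
      \sum_i ((c i)%:C *: x i - (c i)%:C *: (\sum_j (b j)%:C *: y j)).
    by apply: eq_bigr => i _; rewrite rE scalerBr.
  rewrite rE sub0r sumrB -scaler_suml -addrA; congr (_ + _).
  rewrite scalerN -opprD -scalerDl -raddf_sum /= -rmorphD (addrC (\sum_i c i)) subrK.
  by rewrite scale1r.
apply: le_trans (rnorm_jensen _ _ c0 c1) _.
have rN z : N (r z) <= \sum_j b j * N (z - y j) + (1 - \sum_j b j) * N z.
  exact: rnorm_jensen.
have h : (1 - \sum_i c i) * N (r 0) <= (1 - \sum_i c i) * \sum_j b j * N (y j).
  apply: ler_wpM2l; first by rewrite subr_ge0.
  apply: le_trans (rN 0) _; rewrite rnorm0 powR0 ?gt_eqF// mulr0 addr0.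
  by apply: ler_sum => j _; rewrite sub0r rnormN.
apply: le_trans (lerD (ler_sum _ (fun i _ => ler_wpM2l (c0 i) (rN (x i)))) h) _.
rewrite le_eqVlt; apply/orP; left; apply/eqP.
rewrite mulrBl mul1r mulr_suml [in LHS]addrCA [in LHS]addrC -sumrB -big_split/=.
congr (_ + _); apply: eq_bigr => i _.
have -> : \sum_j c i * b j * (N (x i - y j) - N (x i) - N (y j)) =
    c i * (\sum_j b j * N (x i - y j) - (\sum_j b j) * N (x i) - \sum_j b j * N (y j)).
  by rewrite mulr_suml -!sumrB mulr_sumr; apply: eq_bigr => j _; ring.
ring.
Qed.

End powers.

(** * Integration of the transport bound *)

Section has_int.
Context {R : realType} {d} {Om : measurableType d}.
Variable mu : {measure set Om -> \bar R}.

(** Integrability and a real value in one predicate, stable under finite linear combinations. *)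
Definition has_int (f : Om -> R) (a : R) : Prop :=
  mu.-integrable setT (EFin \o f) /\ (\int[mu]_w (f w)%:E = a%:E)%E.

Lemma has_int_meas f a : has_int f a -> measurable_fun setT f.
Proof. by case=> /integrableP[/measurable_EFinP]. Qed.

Lemma has_intD f g a b : has_int f a -> has_int g b -> has_int (fun w => f w + g w) (a + b).
Proof.
move=> [intf fa] [intg gb]; split.
  by rewrite (_ : _ \o _ = (EFin \o f) \+ (EFin \o g))%E//; exact: integrableD.
under eq_integral do rewrite EFinD.
by rewrite integralD// fa gb.
Qed.

Lemma has_intZ c f a : has_int f a -> has_int (fun w => c * f w) (c * a).
Proof.
move=> [intf fa]; split; first exact: (integrableZl measurableT c intf).
under eq_integral do rewrite EFinM.
by rewrite integralZl// fa.
Qed.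

Lemma has_int0 : has_int (fun=> 0) 0.
Proof. by split; [exact: integrable0|rewrite integral0]. Qed.

Lemma has_int_sum (I : finType) (f : I -> Om -> R) (a : I -> R) :
  (forall i, has_int (f i) (a i)) -> has_int (fun w => \sum_i f i w) (\sum_i a i).
Proof.
move=> fa; elim: (index_enum I) => [|i s IH].
  by under eq_fun do rewrite big_nil; rewrite big_nil; exact: has_int0.
by under eq_fun do rewrite big_cons; rewrite big_cons; exact: has_intD.
Qed.

Lemma has_int_ae f g a : has_int f a -> measurable_fun setT g ->
  (\forall w \ae mu, f w = g w) -> has_int g a.
Proof.
move=> fa mg fg; have mf := has_int_meas fa; case: fa => intf fa.
have mg' : measurable_fun setT (EFin \o g) by exact/measurable_EFinP.
have mf' : measurable_fun setT (EFin \o f) by exact/measurable_EFinP.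
split; last by rewrite -fa; apply: ae_eq_integral => //; apply: filterS fg => w ->.
apply/integrableP; split => //; case/integrableP : intf => _; apply: le_lt_trans.
rewrite le_eqVlt; apply/orP; left; apply/eqP; apply: ae_eq_integral => //.
- exact: measurableT_comp.
- exact: measurableT_comp.
- by apply: filterS fg => w /= ->.
Qed.

Lemma has_int_le f g a b : has_int f a -> has_int g b ->
  (\forall w \ae mu, f w <= g w) -> a <= b.
Proof.
move=> fa gb fg; have mf := has_int_meas fa; have mg := has_int_meas gb.
have : has_int (fun w => Num.max (g w - f w) 0) (b - a).
  rewrite -[X in b + X]mulN1r; apply: has_int_ae (has_intD gb (has_intZ (-1) fa)) _ _.
    by apply: measurable_maxr => //; exact: measurable_funB.
  by apply: filterS fg => w h; rewrite mulN1r max_l// subr_ge0.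
case=> _ h; rewrite -subr_ge0 -lee_fin -h; apply: integral_ge0 => w _.
by rewrite lee_fin le_max lexx orbT.
Qed.

Lemma has_int_bound (f : Om -> R) (a : R) : measurable_fun setT f -> (\forall w \ae mu, 0 <= f w) ->
  (\int[mu]_w `|f w|%:E <= a%:E)%E -> exists2 b, b <= a & has_int f b.
Proof.
move=> mf f0 fa; have intf : mu.-integrable setT (EFin \o f).
  apply/integrableP; split; first exact/measurable_EFinP.
  by apply: le_lt_trans fa _; exact: ltry.
have mf' : measurable_fun setT (EFin \o f) by exact/measurable_EFinP.
have E : (\int[mu]_w (f w)%:E = (fine (\int[mu]_w (f w)%:E))%:E)%E.
  by rewrite fineK//; exact: integrable_fin_num.
exists (fine (\int[mu]_w (f w)%:E)); last by split.
rewrite -lee_fin -E; apply: le_trans fa; rewrite le_eqVlt; apply/orP; left; apply/eqP.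
apply: ae_eq_integral => //.
  by apply/measurable_EFinP; exact: measurableT_comp.
by apply: filterS f0 => w /= h _; rewrite ger0_norm.
Qed.

Lemma transport_modular q (X : normedModType R[i]) (I J : finType) (c : I -> Om -> R)
    (b : J -> Om -> R) (x : I -> X) (y : J -> X) (f : Om -> X) (cc : I -> R) (bb : J -> R)
    (m : I -> J -> R) : 1 < q -> strongly_measurable f ->
  (forall i, has_int (c i) (cc i)) -> (forall j, has_int (b j) (bb j)) ->
  (forall i j, has_int (fun w => c i w * b j w) (m i j)) ->
  (\forall w \ae mu, (forall i, 0 <= c i w) /\ \sum_i c i w <= 1) ->
  (\forall w \ae mu, (forall j, 0 <= b j w) /\ \sum_j b j w <= 1) ->
  (\forall w \ae mu, f w = \sum_i (c i w)%:C *: x i - \sum_j (b j w)%:C *: y j) ->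
  (modular mu q f <= (\sum_i \sum_j m i j *
     (rnorm (x i - y j) `^ q - rnorm (x i) `^ q - rnorm (y j) `^ q) +
   \sum_i cc i * rnorm (x i) `^ q + \sum_j bb j * rnorm (y j) `^ q)%:E)%E.
Proof.
move=> q1 mf hc hb hm c01 b01 fE; set V := (X in X%:E).
pose g w := \sum_i \sum_j c i w * b j w *
    (rnorm (x i - y j) `^ q - rnorm (x i) `^ q - rnorm (y j) `^ q) +
  \sum_i c i w * rnorm (x i) `^ q + \sum_j b j w * rnorm (y j) `^ q.
have Zr h v k : has_int h v -> has_int (fun w => h w * k) (v * k).
  by move=> hv; rewrite mulrC; under eq_fun do rewrite mulrC; exact: has_intZ.
have hg : has_int g V.
  apply: has_intD; first apply: has_intD.
  - by apply: has_int_sum => i; apply: has_int_sum => j; exact: Zr.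
  - by apply: has_int_sum => i; exact: Zr.
  - by apply: has_int_sum => j; exact: Zr.
have fg : \forall w \ae mu, rnorm (f w) `^ q <= g w.
  apply: filterS (filterI c01 (filterI b01 fE)) => w [[c0 c1] [[b0 b1] ->]].
  exact: transport_pointwise.
have mg := has_int_meas hg.
have [_ <-] : has_int (fun w => `|g w|) V.
  apply: (has_int_ae hg); first exact: measurableT_comp.
  by apply: filterS fg => w /= h; rewrite ger0_norm// (le_trans _ h)// powR_ge0.
apply: ae_ge0_le_integral => //.
- by move=> w _; rewrite lee_fin powR_ge0.
- exact: measurable_rnorm_powR.
- by apply/measurable_EFinP; exact: measurableT_comp.
- by apply: filterS fg => w h _; rewrite lee_fin (le_trans h)// ler_norm.
Qed.

End has_int.

(** * Indicators as elements of L_p *)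

Section indicators.
Context {R : realType} {d} {Om : measurableType d}.
Variable mu : {measure set Om -> \bar R}.

Definition finite_meas (A : set Om) : Prop := measurable A /\ (mu A < +oo)%E.

Lemma simple_fun_indic (A : set Om) : measurable A ->
  simple_fun (fun w => (\1_A w : R)%:C).
Proof.
move=> mA; have sA := simple_fun_mem mA.
exact: (simple_fun_op2 (fun (a : bool) (_ : bool) => (a%:R : R)%:C) sA sA).
Qed.

Lemma indic_Lp p (p1 : (1 <= p)%E) A : finite_meas A ->
  (fun w => (\1_A w : R)%:C) \in Lp_fun mu p R[i].
Proof.
move=> [mA fA]; have mf := simple_fun_meas (simple_fun_indic mA).
have rE w : rnorm ((\1_A w : R)%:C) = \1_A w by rewrite rnormC ger0_norm.
case: p p1 => [p| |//] p1.
  apply: (Lp_fun_modular p1) => //; rewrite /modular.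
  rewrite (eq_integral (fun w => (\1_A w)%:E)); first by rewrite integral_indic// setIT.
  move=> w _; rewrite rE indicE; case: (w \in A); first by rewrite powR1.
  by rewrite powR0// gt_eqF// (lt_le_trans ltr01).
apply/Lp_funP; split => //; have /Lp_funP[_] := Lp_one_subproof mu; apply: le_lt_trans.
apply: le_Lnorm => //; first exact: measurable_rnorm.
- exact/measurable_rnorm/strongly_measurable_cst.
- apply: nearW => w /=; rewrite !ger0_norm ?rnorm_ge0// rE rnormC1 indicE.
  by case: (_ \in _).
Qed.

(** Total in A, with default 0, so that families of sets are handled without carrying proofs. *)
Definition ind p (p1 : (1 <= p)%E) (A : set Om) : Lp_space mu p1 R[i] :=
  if pselect (finite_meas A) is left h then Lp_class p1 (indic_Lp p1 h) else 0.

Lemma Lp_val_ind p (p1 : (1 <= p)%E) A : finite_meas A ->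
  \forall w \ae mu, Lp_val (ind p1 A) w = (\1_A w : R)%:C.
Proof. by rewrite /ind; case: pselect => // h _; exact: Lp_val_class. Qed.

Lemma has_int_indic A : finite_meas A -> has_int mu \1_A (fine (mu A)).
Proof.
move=> [mA fA]; split; last by rewrite integral_indic// setIT fineK// ge0_fin_numE.
apply/integrableP; split; first by apply/measurable_EFinP; exact: measurable_indic.
rewrite (eq_integral (fun w => (\1_A w)%:E)); first by rewrite integral_indic// setIT.
by move=> w _; rewrite /= ger0_norm.
Qed.

(** By polarization, the real part is a combination of squared norms. *)
Lemma measurable_Re_inner (f g : Om -> R[i]) : strongly_measurable f -> strongly_measurable g ->
  measurable_fun setT (fun w => complex.Re (f w * (g w)^*)).
Proof.
move=> mf mg.
have E (a b : R[i]) : complex.Re (a * b^*) =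
    2^-1 * (rnorm (a + b) ^+ 2 + (-1) * (rnorm a ^+ 2 + rnorm b ^+ 2)).
  by case: a => a1 a2; case: b => b1 b2; rewrite !rnormC_sqr /=; field.
under eq_fun do rewrite E.
have sq (h : Om -> R[i]) : strongly_measurable h ->
    measurable_fun setT (fun w => rnorm (h w) ^+ 2).
  by move=> mh; apply: measurable_funX; exact: measurable_rnorm.
apply: measurable_funM => //; apply: measurable_funD.
  exact: (sq (f + g) (strongly_measurableD mf mg)).
by apply: measurable_funM => //; apply: measurable_funD; exact: sq.
Qed.

End indicators.

(** * Images of indicators under a symmetric Markovian operator *)

Section symmetric_markovian.
Context {R : realType} {d} {Om : measurableType d}.
Variable mu : {measure set Om -> \bar R}.
Variables (T : Lp_operator mu) (sm : symmetric_markovian T).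

(** A single real version of T 1_A, taken in L_2; for A of finite measure, consistency and
    positivity make it represent T 1_A in every L_p. *)
Definition ind_image (A : set Om) (w : Om) : R := rnorm (Lp_val (T le12 (ind mu le12 A)) w).

Let pos_real (z : R[i]) : 0 <= z -> z = (rnorm z)%:C.
Proof. by move=> z0; rewrite -rnormE ger0_norm. Qed.

Lemma Lp_val_ind_image p (p1 : (1 <= p)%E) A : finite_meas mu A ->
  \forall w \ae mu, Lp_val (T p1 (ind mu p1 A)) w = (ind_image A w)%:C.
Proof.
move=> fA; have h0 : \forall w \ae mu, 0 <= Lp_val (ind mu le12 A) w.
  by apply: filterS (Lp_val_ind le12 fA) => w ->; rewrite ler0c.
have h1 : \forall w \ae mu, Lp_val (ind mu p1 A) w = Lp_val (ind mu le12 A) w.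
  by apply: filterS2 (Lp_val_ind p1 fA) (Lp_val_ind le12 fA) => w -> ->.
apply: filterS2 (sm_consistent sm h1) (sm_positive sm h0) => w ->.
exact: pos_real.
Qed.

Lemma ind_image_ge0 A w : 0 <= ind_image A w. Proof. exact: rnorm_ge0. Qed.

Lemma measurable_ind_image A : measurable_fun setT (ind_image A).
Proof. exact/measurable_rnorm/Lp_val_meas. Qed.

Lemma rnorm_contraction p (p1 : (1 <= p)%E) f : rnorm (T p1 f) <= rnorm f.
Proof. by rewrite -[leRHS]mul1r; apply: opnorm_bound => //; exact: sm_contraction. Qed.

(** Contractivity on L_1. *)
Lemma has_int_ind_image A : finite_meas mu A ->
  exists2 b, b <= fine (mu A) & has_int mu (ind_image A) b.
Proof.
move=> fA; have le11 : (1 <= 1%:E :> \bar R)%E by [].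
have N1 (g : Lp_space mu le11 R[i]) (h : Om -> R) : measurable_fun setT h ->
    (forall w, 0 <= h w) -> (\forall w \ae mu, Lp_val g w = (h w)%:C) ->
    (\int[mu]_w `|h w|%:E = (rnorm g)%:E)%E.
  move=> mh h0 gh; rewrite -[rnorm g]powRr1 ?rnorm_ge0// -modular_Lp.
  apply: ge0_ae_eq_integral => //.
  - by apply/measurable_EFinP; exact: measurableT_comp.
  - exact/measurable_rnorm_powR/Lp_val_meas.
  - by move=> w _; rewrite lee_fin powR_ge0.
  - by apply: filterS gh => w -> _; rewrite powRr1 ?rnorm_ge0// rnormC.
apply: has_int_bound; first exact: measurable_ind_image.
  by apply: nearW => w; exact: ind_image_ge0.
rewrite (N1 _ _ _ _ (Lp_val_ind_image le11 fA)); last 2 first.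
- exact: measurable_ind_image.
- exact: ind_image_ge0.
have [_ <-] := has_int_indic fA; apply: (@le_trans _ _ (rnorm (ind mu le11 A))%:E).
  by rewrite lee_fin rnorm_contraction.
rewrite -(N1 _ \1_A _ _ (Lp_val_ind le11 fA))//; last first.
  by case: fA => mA _; exact: measurable_indic.
by under eq_integral do rewrite ger0_norm//.
Qed.

(** Positivity on L_infinity applied to 1 minus the sum of the indicators, with T 1 = 1. *)
Lemma ind_image_sum (J : finType) (B : J -> set Om) : (forall j, finite_meas mu (B j)) ->
  (forall w, \sum_j \1_(B j) w <= 1 :> R) -> \forall w \ae mu, \sum_j ind_image (B j) w <= 1.
Proof.
move=> fB B1; pose g : Lp_space mu le1y R[i] := Lp_one mu - \sum_j ind mu le1y (B j).
have ae_all (P : J -> Om -> Prop) : (forall j, \forall w \ae mu, P j w) ->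
    \forall w \ae mu, forall j, P j w.
  by move=> h; exact: filter_forall.
have g0 : \forall w \ae mu, 0 <= Lp_val g w.
  have h := ae_all _ (fun j => Lp_val_ind le1y (fB j)).
  have h1 := Lp_val_class le1y (Lp_one_subproof mu).
  have h2 := Lp_valB (Lp_one mu) (\sum_j ind mu le1y (B j)).
  have h3 := Lp_val_sum (fun j => ind mu le1y (B j)).
  apply: filterS (filterI h (filterI h1 (filterI h2 h3))) => w [e [e1 [-> ->]]].
  rewrite e1 (eq_bigr (fun j => (\1_(B j) w)%:C)); last by move=> j _; exact: e.
  by rewrite -raddf_sum -[1]/(1%:C) -rmorphB ler0c subr_ge0.
have h := ae_all _ (fun j => Lp_val_ind_image le1y (fB j)).
have h1 := Lp_val_class le1y (Lp_one_subproof mu).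
have h2 := Lp_valB (Lp_one mu) (\sum_j T le1y (ind mu le1y (B j))).
have h3 := Lp_val_sum (fun j => T le1y (ind mu le1y (B j))).
have h4 := sm_positive sm g0; rewrite linearB linear_sum/= (sm_one sm) in h4.
apply: filterS (filterI h (filterI h1 (filterI h2 (filterI h3 h4)))).
move=> w [e [e1 [e2 [e3]]]].
rewrite e2 e3 e1 (eq_bigr (fun j => (ind_image (B j) w)%:C)); last by move=> j _; exact: e.
by rewrite -raddf_sum -[1]/(1%:C) -rmorphB ler0c subr_ge0.
Qed.

(** Self-adjointness on L_2. The common value m is the mass that the coupling gives to A x B. *)
Lemma has_int_ind_image_sym A B : finite_meas mu A -> finite_meas mu B -> exists m,
  has_int mu (fun w => \1_A w * ind_image B w) m /\
  has_int mu (fun w => \1_B w * ind_image A w) m.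
Proof.
move=> fA fB.
have ex C D : finite_meas mu C -> finite_meas mu D ->
    exists m, has_int mu (fun w => \1_C w * ind_image D w) m.
  move=> fC fD; have [b _ [hb _]] := has_int_ind_image fD.
  have mC : measurable_fun setT (\1_C : Om -> R) by case: fC => mC _; exact: measurable_indic.
  have mCD : measurable_fun setT (fun w => \1_C w * ind_image D w).
    by apply: measurable_funM => //; exact: measurable_ind_image.
  have intCD : mu.-integrable setT (EFin \o (fun w => \1_C w * ind_image D w)).
    apply: le_integrable hb => //; first exact/measurable_EFinP.
    move=> w _ /=; rewrite lee_fin normrM ler_piMl//.
    by rewrite ger0_norm// indicE; case: (_ \in _).
  exists (fine (\int[mu]_w (\1_C w * ind_image D w)%:E)); split => //.
  by rewrite fineK//; exact: integrable_fin_num.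
have [m1 h1] := ex A B fA fB; have [m2 h2] := ex B A fB fA.
suff E : m1 = m2 by exists m1; split; rewrite // E.
have := congr1 (@complex.Re R) (sm_selfadjoint sm (ind mu le12 A) (ind mu le12 B)).
rewrite /L2_inner /= /Rintegral.
have inner (f g : Lp_space mu le12 R[i]) (k : Om -> R) (m : R) : has_int mu k m ->
    (\forall w \ae mu, complex.Re (Lp_val f w * (Lp_val g w)^*) = k w) ->
    (\int[mu]_w (complex.Re (Lp_val f w * (Lp_val g w)^*))%:E = m%:E)%E.
  move=> hk fgk; have [|_ ->//] := has_int_ae hk (measurable_Re_inner (Lp_val_meas f) (Lp_val_meas g)).
  by apply: filterS fgk => w ->.
rewrite (inner _ _ _ _ h2); last first.
  apply: filterS2 (Lp_val_ind_image le12 fA) (Lp_val_ind le12 fB) => w -> -> /=.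
  by rewrite oppr0 mulr0 subr0 mulrC.
rewrite (inner _ _ _ _ h1)//.
apply: filterS2 (Lp_val_ind_image le12 fB) (Lp_val_ind le12 fA) => w -> -> /=.
by rewrite oppr0 mulr0 subr0.
Qed.

End symmetric_markovian.

(** * Simple functions, their images and their atoms *)

Section simple_elements.
Context {R : realType} {d} {Om : measurableType d}.
Variable mu : {measure set Om -> \bar R}.
Variables (T : Lp_operator mu) (sm : symmetric_markovian T).
Variables (q : R) (q1 : (1 <= q%:E)%E) (q_gt1 : 1 < q).
Variable X : normedModType R[i].

Local Notation L := (Lp_space mu q1 X).
Local Notation Ls := (Lp_space mu q1 R[i]).
Local Notation N x := (rnorm (x : X) `^ q).

(** With [idfun] this is a simple function, with [T q1] its image under T tensor the identity of
    X. *)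
Definition comb (F : Ls -> Ls) (I : finType) (A : I -> set Om) (x : I -> X) : L :=
  \sum_i Lp_tensor (F (ind mu q1 (A i))) (x i).

Definition disjoint_sets (I : finType) (A : I -> set Om) : Prop :=
  forall w i j, A i w -> A j w -> i = j.

Section disjoint_families.
Variables (I : finType) (A : I -> set Om) (x : I -> X).
Hypothesis dA : disjoint_sets A.

Let indic_cases w : (forall i, \1_(A i) w = 0 :> R) \/
  exists i, \1_(A i) w = 1 :> R /\ forall j, j != i -> \1_(A j) w = 0 :> R.
Proof.
have [[i Aiw]|h] := pselect (exists i, A i w); last first.
  by left => i; rewrite indicE memNset// => Aiw; apply: h; exists i.
right; exists i; split; first by rewrite indicE mem_set.
by move=> j ji; rewrite indicE memNset// => Ajw; move/eqP: ji; apply; exact: dA Ajw Aiw.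
Qed.

Lemma disjoint_indic_sum w : \sum_i \1_(A i) w <= 1 :> R.
Proof.
have [h|[i [h1 h0]]] := indic_cases w; first by rewrite big1.
by rewrite (bigD1 i)//= big1 ?addr0 ?h1.
Qed.

Lemma disjoint_indic_rnorm w :
  N (\sum_i (\1_(A i) w : R)%:C *: x i) = \sum_i \1_(A i) w * N (x i).
Proof.
have q0 : q != 0 by rewrite gt_eqF// (lt_trans ltr01).
have [h|[i [h1 h0]]] := indic_cases w.
  by rewrite !big1 ?rnorm0 ?powR0// => i _; rewrite h ?mul0r ?scale0r.
rewrite (bigD1 i)//= (bigD1 (F := fun i => _ * _) i)//= h1 mul1r scale1r.
by rewrite !big1 ?addr0// => j ji; rewrite h0// ?mul0r ?scale0r.
Qed.

End disjoint_families.

Lemma Lp_val_comb_id (I : finType) (A : I -> set Om) x : (forall i, finite_meas mu (A i)) ->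
  \forall w \ae mu, Lp_val (comb idfun A x) w = \sum_i (\1_(A i) w : R)%:C *: x i.
Proof.
move=> fA.
have h1 : \forall w \ae mu, forall i, Lp_val (Lp_tensor (ind mu q1 (A i)) (x i)) w =
    Lp_val (ind mu q1 (A i)) w *: x i.
  by apply: filter_forall => i; exact: Lp_val_tensor.
have h2 : \forall w \ae mu, forall i, Lp_val (ind mu q1 (A i)) w = (\1_(A i) w : R)%:C.
  by apply: filter_forall => i; exact: Lp_val_ind.
have h3 := Lp_val_sum (fun i => Lp_tensor (ind mu q1 (A i)) (x i)).
apply: filterS (filterI h3 (filterI h1 h2)) => w [-> [e1 e2]].
by apply: eq_bigr => i _; rewrite e1 e2.
Qed.

Lemma Lp_val_comb_image (I : finType) (A : I -> set Om) x :
  (forall i, finite_meas mu (A i)) ->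
  \forall w \ae mu, Lp_val (comb (T q1) A x) w = \sum_i (ind_image T (A i) w)%:C *: x i.
Proof.
move=> fA.
have h1 : \forall w \ae mu, forall i, Lp_val (Lp_tensor (T q1 (ind mu q1 (A i))) (x i)) w =
    Lp_val (T q1 (ind mu q1 (A i))) w *: x i.
  by apply: filter_forall => i; exact: Lp_val_tensor.
have h2 : \forall w \ae mu, forall i, Lp_val (T q1 (ind mu q1 (A i))) w =
    (ind_image T (A i) w)%:C.
  by apply: filter_forall => i; exact: Lp_val_ind_image.
have h3 := Lp_val_sum (fun i => Lp_tensor (T q1 (ind mu q1 (A i))) (x i)).
apply: filterS (filterI h3 (filterI h1 h2)) => w [-> [e1 e2]].
by apply: eq_bigr => i _; rewrite e1 e2.
Qed.

Lemma rnorm_comb_id (I : finType) (A : I -> set Om) x : (forall i, finite_meas mu (A i)) ->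
  disjoint_sets A -> rnorm (comb idfun A x) `^ q = \sum_i fine (mu (A i)) * N (x i).
Proof.
move=> fA dA; apply: EFin_inj; rewrite -modular_Lp.
have hs : has_int mu (fun w => \sum_i \1_(A i) w * N (x i))
    (\sum_i fine (mu (A i)) * N (x i)).
  apply: has_int_sum => i; rewrite mulrC; under eq_fun do rewrite mulrC.
  exact/has_intZ/has_int_indic.
have ms := has_int_meas hs; have [_ <-] := hs; apply: ge0_ae_eq_integral => //.
- exact/measurable_rnorm_powR/Lp_val_meas.
- exact/measurable_EFinP.
- by move=> w _; rewrite lee_fin powR_ge0.
- by move=> w _; rewrite lee_fin -disjoint_indic_rnorm// powR_ge0.
- by apply: filterS (Lp_val_comb_id x fA) => w -> _; rewrite disjoint_indic_rnorm.
Qed.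

Lemma transport_comb (I J : finType) (A : I -> set Om) (B : J -> set Om) x y m :
  (forall i, finite_meas mu (A i)) -> disjoint_sets A ->
  (forall j, finite_meas mu (B j)) -> disjoint_sets B ->
  (forall i j, has_int mu (fun w => \1_(A i) w * ind_image T (B j) w) (m i j)) ->
  rnorm (comb idfun A x - comb (T q1) B y) `^ q <=
  \sum_i \sum_j m i j * (N (x i - y j) - N (x i) - N (y j)) +
  \sum_i fine (mu (A i)) * N (x i) + \sum_j fine (mu (B j)) * N (y j).
Proof.
move=> fA dA fB dB hm.
have [bb bbP] := choice (fun j => (let: ex_intro2 b h1 h2 := has_int_ind_image sm (fB j) in
  ex_intro (fun b => b <= fine (mu (B j)) /\ has_int mu (ind_image T (B j)) b) b (conj h1 h2))).
rewrite -lee_fin -modular_Lp.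
apply: (@le_trans _ _ (\sum_i \sum_j m i j * (N (x i - y j) - N (x i) - N (y j)) +
    \sum_i fine (mu (A i)) * N (x i) + \sum_j bb j * N (y j))%:E); last first.
  rewrite lee_fin lerD2l; apply: ler_sum => j _; rewrite ler_wpM2r ?powR_ge0//.
  by case: (bbP j).
apply: (@transport_modular _ _ _ mu q X I J (fun i => \1_(A i)) (fun j => ind_image T (B j))).
- by [].
- exact: Lp_val_meas.
- by move=> i; exact: has_int_indic.
- by move=> j; case: (bbP j).
- exact: hm.
- by apply: nearW => w; split; [move=> i|exact: disjoint_indic_sum].
- apply: filterS (ind_image_sum sm fB (disjoint_indic_sum dB)) => w h; split => // j.
  exact: ind_image_ge0.
- have h1 := Lp_val_comb_id x fA; have h2 := Lp_val_comb_image y fB.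
  apply: filterS (filterI (Lp_valB (comb idfun A x) (comb (T q1) B y)) (filterI h1 h2)) => w [-> [-> ->]].
  by [].
Qed.

Section refinement.
Variables (I : finType) (A : I -> set Om).
Hypothesis fA : forall i, finite_meas mu (A i).

(* The atoms generated by the sets A i; the one outside all of them may have
   infinite measure and is replaced by the empty set. *)
Definition atom (S : {set I}) : set Om :=
  [set w | S != finset.set0 /\ forall i, (w \in A i) = (i \in S)].

Lemma atom_disjoint : disjoint_sets atom.
Proof. by move=> w S S' [_ h] [_ h']; apply/setP => i; rewrite -h h'. Qed.

Lemma atom_finite_meas S : finite_meas mu (atom S).
Proof.
have mA i : measurable (A i) by case: (fA i).
have [->|S0] := eqVneq S finset.set0.
  rewrite (_ : atom _ = set0); last by apply/seteqP; split=> w // [/eqP].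
  by split => //; rewrite measure0.
have mS : measurable (atom S).
  rewrite (_ : atom S = \bigcap_(i in [set: I]) (if i \in S then A i else ~` A i)).
    apply: fin_bigcap_measurable => // i _; case: ifP => // _; exact: measurableC.
  apply/seteqP; split => [w [_ h] i _|w h]; first by have := h i; case: ifP => _ /= e;
    [exact: set_mem e|by move=> Aiw; rewrite (mem_set Aiw) in e].
  split => // i; have := h i Logic.I; case: ifP => _ /= e; first by rewrite mem_set.
  by rewrite memNset.
split => //; have [i iS] := set0Pn _ S0; have [_] := fA i; apply: le_lt_trans.
apply: le_measure; rewrite ?inE// => w [_ h]; by apply: set_mem; rewrite h.
Qed.

Lemma indic_atom i w : \1_(A i) w = \sum_(S : {set I}) (i \in S)%:R * \1_(atom S) w :> R.
Proof.
pose U := [set i | w \in A i]%SET.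
have iU j : (j \in U) = (w \in A j) by rewrite inE.
have aU S : atom S w -> S = U by move=> [_ h]; apply/setP => j; rewrite iU h.
rewrite (bigD1 U)//= big1 ?addr0; last first.
  move=> S SU; rewrite [X in _ * X]indicE memNset ?mulr0// => /aU SE.
  by rewrite SE eqxx in SU.
rewrite iU indicE; case: (boolP (w \in A i)) => wA; last by rewrite mul0r.
rewrite indicE mem_set ?mul1r//; split=> [|j]; last by rewrite iU.
by apply/set0Pn; exists i; rewrite iU.
Qed.

Lemma ind_atom i : ind mu q1 (A i) = \sum_(S : {set I}) (i \in S)%:R *: ind mu q1 (atom S).
Proof.
apply/Lp_valP.
have h1 : \forall w \ae mu, forall S : {set I}, Lp_val ((i \in S)%:R *: ind mu q1 (atom S)) w =
    (i \in S)%:R *: Lp_val (ind mu q1 (atom S)) w.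
  by apply: filter_forall => S; exact: Lp_valZ.
have h2 : \forall w \ae mu, forall S, Lp_val (ind mu q1 (atom S)) w = (\1_(atom S) w : R)%:C.
  by apply: filter_forall => S; exact/Lp_val_ind/atom_finite_meas.
have h3 := Lp_val_sum (fun S : {set I} => (i \in S)%:R *: ind mu q1 (atom S)).
apply: filterS (filterI (Lp_val_ind q1 (fA i)) (filterI h3 (filterI h1 h2))).
move=> w [-> [-> [e1 e2]]]; rewrite indic_atom rmorph_sum; apply: eq_bigr => S _.
by rewrite e1 e2 rmorphM rmorph_nat.
Qed.

Definition atom_coef (x : I -> X) (S : {set I}) : X := \sum_i ((i \in S)%:R : R[i]) *: x i.

Lemma comb_atom (F : {linear Ls -> Ls}) x : comb F A x = comb F atom (atom_coef x).
Proof.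
rewrite /comb /atom_coef.
have E S : Lp_tensor (F (ind mu q1 (atom S))) (\sum_i ((i \in S)%:R : R[i]) *: x i) =
    \sum_i ((i \in S)%:R : R[i]) *: Lp_tensor (F (ind mu q1 (atom S))) (x i).
  elim/big_ind2: _ => [|f g h k <- <-|i _]; first exact: Lp_tensor0r.
    exact: Lp_tensorDr.
  exact: Lp_tensorZr.
under [RHS]eq_bigr do rewrite E.
rewrite exchange_big; apply: eq_bigr => i _.
rewrite ind_atom linear_sum Lp_tensor_suml; apply: eq_bigr => S _.
by rewrite linearZ Lp_tensorZl.
Qed.

End refinement.

Lemma comb_contraction (I : finType) (A : I -> set Om) x : (forall i, finite_meas mu (A i)) ->
  rnorm (comb (T q1) A x) <= rnorm (comb idfun A x).
Proof.
move=> fA; rewrite (comb_atom fA (T q1)) (comb_atom fA idfun).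
have fB S := atom_finite_meas fA S; have dB := @atom_disjoint _ A.
rewrite -(powR_inj_le q1) ?rnorm_ge0// (rnorm_comb_id _ fB dB).
(* An empty first family leaves only the image term in the transport bound. *)
have := @transport_comb 'I_0 _ (fun=> set0) _ (fun=> 0) (atom_coef x) (fun _ _ => 0) _ _ fB dB _.
rewrite /comb !big_ord0 !add0r rnormN; by apply=> [[]|? []|[]].
Qed.

End simple_elements.

(** * Two-point inequality for simple functions *)

Section two_point_inequality.
Context {R : realType} {d} {Om : measurableType d}.
Variable mu : {measure set Om -> \bar R}.
Variables (T : Lp_operator mu) (sm : symmetric_markovian T).
Variables (q : R) (q1 : (1 <= q%:E)%E) (q_gt1 : 1 < q).
Variable X : normedModType R[i].
Variables (delta : R) (delta_ge0 : 0 <= delta) (uc : uniformly_convex X q delta).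

Local Notation N x := (rnorm x `^ q).
Local Notation comb := (@comb R d Om mu q q1 X).

Lemma combZ F (I : finType) (A : I -> set Om) a (x : I -> X) :
  comb F A (fun i => a *: x i) = a *: comb F A x.
Proof. by rewrite /comb scaler_sumr; apply: eq_bigr => i _; rewrite Lp_tensorZr. Qed.

Lemma transport_marginal (J : finType) (A : set Om) (B : J -> set Om) m : finite_meas mu A ->
  (forall j, finite_meas mu (B j)) -> disjoint_sets B ->
  (forall j, has_int mu (fun w => \1_A w * ind_image T (B j) w) (m j)) ->
  \sum_j m j <= fine (mu A).
Proof.
move=> fA fB dB hm; apply: has_int_le (has_int_sum hm) (has_int_indic fA) _.
apply: filterS (ind_image_sum sm fB (disjoint_indic_sum dB)) => w h.
by rewrite -mulr_sumr -[leRHS]mulr1 ler_wpM2l.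
Qed.

(** The transport bounds for (f - S g)/2 and (g + S f)/2 involve the same masses m by symmetry, so
    uniform convexity applies at each pair (x_i, y_j). What the marginals of m lack is covered by P
    >= 0, which is uniform convexity at (z, 0). *)
Lemma two_point_disjoint (I J : finType) (A : I -> set Om) (B : J -> set Om)
    (x : I -> X) (y : J -> X) :
  (forall i, finite_meas mu (A i)) -> disjoint_sets A ->
  (forall j, finite_meas mu (B j)) -> disjoint_sets B ->
  N (2^-1 *: (comb idfun B y + comb (T q1) A x)) +
  delta * N (2^-1 *: (comb idfun A x - comb (T q1) B y)) <=
  2^-1 * (N (comb idfun A x) + N (comb idfun B y)).
Proof.
move=> fA dA fB dB.
have /choice[m hm] : forall ij, exists m,
    has_int mu (fun w => \1_(A ij.1) w * ind_image T (B ij.2) w) m /\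
    has_int mu (fun w => \1_(B ij.2) w * ind_image T (A ij.1) w) m.
  by move=> ij; exact: has_int_ind_image_sym.
pose h (z : X) := 2^-1 *: z.
have t1 := transport_comb sm q1 q_gt1 (h \o x) (h \o y) fA dA fB dB
  (fun i j => proj1 (hm (i, j))).
have t2 := transport_comb sm q1 q_gt1 (h \o y) (fun i => - h (x i)) fB dB fA dA
  (fun j i => proj2 (hm (i, j))).
have E1 : 2^-1 *: (comb idfun A x - comb (T q1) B y) =
    comb idfun A (h \o x) - comb (T q1) B (h \o y).
  by rewrite scalerBr -!combZ.
have E2 : 2^-1 *: (comb idfun B y + comb (T q1) A x) =
    comb idfun B (h \o y) - comb (T q1) A (fun i => - h (x i)).
  rewrite scalerDr -!combZ -scaleN1r -combZ; congr (_ + _).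
  by congr comb; apply/funext => i; rewrite scaleN1r opprK.
rewrite {}E1 {}E2 (rnorm_comb_id q1 q_gt1 x fA dA) (rnorm_comb_id q1 q_gt1 y fB dB).
apply: le_trans (lerD t2 (ler_wpM2l delta_ge0 t1)) _.
pose P (z : X) := 2^-1 * N z - (1 + delta) * N (h z).
have P0 z : 0 <= P z.
  have := uc z 0; rewrite addr0 subr0 rnorm0 powR0 ?gt_eqF ?(lt_trans ltr01)// addr0.
  by rewrite /P subr_ge0 mulrDl mul1r.
have m0 i j : 0 <= m (i, j).
  have [h1 _] := hm (i, j); apply: has_int_le (has_int0 mu) h1 _.
  by apply: nearW => w; rewrite mulr_ge0// ind_image_ge0.
have S1 : \sum_i \sum_j m (i, j) * (P (x i) + P (y j)) <=
    \sum_i fine (mu (A i)) * P (x i) + \sum_j fine (mu (B j)) * P (y j).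
  have -> : \sum_i \sum_j m (i, j) * (P (x i) + P (y j)) =
      \sum_i (\sum_j m (i, j)) * P (x i) + \sum_j (\sum_i m (i, j)) * P (y j).
    under [X in _ + X]eq_bigr do rewrite mulr_suml.
    rewrite [X in _ + X]exchange_big -big_split/=; apply: eq_bigr => i _.
    by rewrite mulr_suml -big_split/=; apply: eq_bigr => j _; rewrite mulrDr.
  apply: lerD; apply: ler_sum => k _; apply: ler_wpM2r => //.
    by apply: (transport_marginal (fA k) fB dB) => j; case: (hm (k, j)).
  by apply: (transport_marginal (fB k) fA dA) => i; case: (hm (i, k)).
have S2 : \sum_j \sum_i m (i, j) * (N (h (y j) - - h (x i)) - N (h (y j)) - N (- h (x i))) +
    delta * (\sum_i \sum_j m (i, j) * (N (h (x i) - h (y j)) - N (h (x i)) - N (h (y j)))) <=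
    \sum_i \sum_j m (i, j) * (P (x i) + P (y j)).
  rewrite exchange_big/= mulr_sumr -big_split/=; apply: ler_sum => i _.
  rewrite mulr_sumr -big_split/=; apply: ler_sum => j _.
  rewrite mulrCA -mulrDr; apply: ler_wpM2l => //.
  have := uc (x i) (y j); rewrite scalerDr scalerBr -/(h (x i)) -/(h (y j)).
  rewrite opprK rnormN [h (y j) + _]addrC /P; lra.
have EA : \sum_i fine (mu (A i)) * P (x i) = 2^-1 * \sum_i fine (mu (A i)) * N (x i) -
    (1 + delta) * \sum_i fine (mu (A i)) * N (h (x i)).
  by rewrite !mulr_sumr -sumrB; apply: eq_bigr => i _; rewrite /P; ring.
have EB : \sum_j fine (mu (B j)) * P (y j) = 2^-1 * \sum_j fine (mu (B j)) * N (y j) -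
    (1 + delta) * \sum_j fine (mu (B j)) * N (h (y j)).
  by rewrite !mulr_sumr -sumrB; apply: eq_bigr => j _; rewrite /P; ring.
have EN : \sum_i fine (mu (A i)) * N (- h (x i)) = \sum_i fine (mu (A i)) * N (h (x i)).
  by apply: eq_bigr => i _; rewrite rnormN.
rewrite /= EN in S2 *; lra.
Qed.

Lemma two_point_simple (I J : finType) (A : I -> set Om) (B : J -> set Om)
    (x : I -> X) (y : J -> X) :
  (forall i, finite_meas mu (A i)) -> (forall j, finite_meas mu (B j)) ->
  N (2^-1 *: (comb idfun B y + comb (T q1) A x)) +
  delta * N (2^-1 *: (comb idfun A x - comb (T q1) B y)) <=
  2^-1 * (N (comb idfun A x) + N (comb idfun B y)).
Proof.
move=> fA fB; rewrite (comb_atom fA (T q1)) (comb_atom fA idfun).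
rewrite (comb_atom fB (T q1)) (comb_atom fB idfun); apply: two_point_disjoint.
- exact: atom_finite_meas.
- exact: atom_disjoint.
- exact: atom_finite_meas.
- exact: atom_disjoint.
Qed.

End two_point_inequality.

(** * The vector-valued extension *)

Section simple_pairs.
Context {R : realType} {d} {Om : measurableType d}.
Variable mu : {measure set Om -> \bar R}.
Variables (q : R) (q1 : (1 <= q%:E)%E) (q_gt1 : 1 < q).

Let q0 : 0 < q. Proof. exact: lt_trans ltr01 q_gt1. Qed.

Section density.
Variable X : normedModType R[i].

Lemma simple_class_comb (s : Om -> X) (sP : s \in Lp_fun mu q%:E X) : simple_fun s ->
  exists (I : finType) (A : I -> set Om) (x : I -> X),
    (forall i, finite_meas mu (A i)) /\ Lp_class q1 sP = comb idfun A x.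
Proof.
move=> ss; have ms := simple_fun_meas ss; have [/finite_seqP[r rE] mfib] := ss.
(* The fibre over 0 may have infinite measure and contributes nothing, so the empty set replaces
   it. *)
pose A (i : seq_sub r) := if ssval i == 0 then set0 else s @^-1` [set ssval i].
have fA i : finite_meas mu (A i).
  rewrite /A; case: eqVneq => [_|v0]; first by split => //; rewrite measure0.
  set v := ssval i; have mv : measurable (s @^-1` [set v]) by exact: mfib.
  split => //; have c0 : 0 < rnorm v `^ q.
    rewrite powR_gt0// lt_neqAle rnorm_ge0 andbT eq_sym.
    by apply: contra_neq v0 => /rnorm0_eq0.
  rewrite ltNge leye_eq; apply/negP => /eqP muv.
  (* Markov's inequality: a fibre over v != 0 has finite measure. *)
  have : ((rnorm v `^ q)%:E * mu (s @^-1` [set v]) <= modular mu q s)%E.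
    rewrite -[X in mu X]setIT -integral_indic// -ge0_integralZl_EFin//; last 2 first.
    - by apply/measurable_EFinP; exact: measurable_indic.
    - exact: ltW.
    apply: ge0_le_integral => //.
    - by move=> w _; rewrite -EFinM lee_fin mulr_ge0// ltW.
    - apply/measurable_EFinP; apply: measurable_funM => //; exact: measurable_indic.
    - exact: measurable_rnorm_powR.
    move=> w _; rewrite -EFinM lee_fin indicE; case: (boolP (w \in _)) => wv.
      by rewrite mulr1 (set_mem wv).
    by rewrite mulr0 powR_ge0.
  by rewrite muv gt0_muley ?lte_fin// (modular_class q1 sP).
exists (seq_sub r), A, (@ssval _ r); split => //; apply/Lp_valP.
apply: filterS2 (Lp_val_class q1 sP) (Lp_val_comb_id q1 (@ssval _ r) fA) => w -> ->.
have sr : s w \in r by have : range s (s w) by [exists w]; rewrite rE.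
rewrite (bigD1 (SeqSub sr))//= big1 ?addr0.
  set c := (\1_(A _) w : R)%:C; have [sw0|sw0] := eqVneq (s w) 0.
    by move: c; rewrite sw0 => c; rewrite scaler0.
  by rewrite /c indicE mem_set ?scale1r// /A/= (negbTE sw0).
move=> i ir; rewrite indicE memNset ?scale0r// /A; case: eqP => [_ []|_ /= E].
by move/eqP: ir; apply; exact: val_inj.
Qed.

End density.

Variables (T : Lp_operator mu) (sm : symmetric_markovian T).

Section pairs.
Variable X : normedModType R[i].
Local Notation L := (Lp_space mu q1 X).
Implicit Types y z : L.

(** A relation, because a simple function has many representations; linearity and
    [simple_pair_contr] make it single-valued. *)
Definition simple_pair y z : Prop := exists (I : finType) (A : I -> set Om) (x : I -> X),
  [/\ forall i, finite_meas mu (A i), y = comb idfun A x & z = comb (T q1) A x].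

Lemma simple_pair_lin a y z y' z' : simple_pair y z -> simple_pair y' z' ->
  simple_pair (a *: y + y') (a *: z + z').
Proof.
move=> [I [A [x [fA -> ->]]]] [J [B [x' [fB -> ->]]]].
exists (I + J)%type, (fun k => match k with inl i => A i | inr j => B j end).
exists (fun k => match k with inl i => a *: x i | inr j => x' j end).
by split; [case|rewrite -!combZ /comb big_sumType..].
Qed.

Lemma simple_pair_contr y z : simple_pair y z -> rnorm z <= rnorm y.
Proof. by move=> [I [A [x [fA -> ->]]]]; exact: comb_contraction. Qed.

Lemma simple_pair_dense y eps : 0 < eps -> exists y' z', simple_pair y' z' /\ rnorm (y - y') < eps.
Proof.
move=> eps0; have [s [sP [ss h]]] := Lq_simple_approx y eps0.
have [I [A [x [fA E]]]] := simple_class_comb sP ss.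
by exists (Lp_class q1 sP), (comb (T q1) A x); split => //; exists I, A, x.
Qed.

Lemma simple_pair_tensor (f g : Lp_space mu q1 R[i]) (x : X) :
  (exists (I : finType) (A : I -> set Om) (c : I -> R[i]),
    [/\ forall i, finite_meas mu (A i), f = comb idfun A c & g = comb (T q1) A c]) ->
  g = T q1 f /\ simple_pair (Lp_tensor f x) (Lp_tensor g x).
Proof.
move=> [I [A [c [fA -> ->]]]].
have tZ (h : Lp_space mu q1 R[i]) (a : R[i]) : Lp_tensor h a = a *: h.
  apply/Lp_valP; apply: filterS2 (Lp_val_tensor h a) (Lp_valZ a h) => w -> ->.
  exact: mulrC.
split.
  by rewrite /comb linear_sum; apply: eq_bigr => i _; rewrite !tZ linearZ.
exists I, A, (fun i => c i *: x); split=> //; rewrite /comb Lp_tensor_suml;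
  by apply: eq_bigr => i _; rewrite tZ Lp_tensorZl Lp_tensorZr.
Qed.

Lemma extension_simple_pair (S : {linear L -> L}) y z :
  is_contractive_extension T S -> simple_pair y z -> S y = z.
Proof.
move=> [_ ST] [I [A [x [_ -> ->]]]]; rewrite /comb linear_sum.
by apply: eq_bigr => i _; rewrite ST.
Qed.

(** The closure of the graph of T tensor identity on simple functions; the extension is read off
    this closed contractive relation. *)
Definition extension_graph y z : Prop := forall eps, 0 < eps ->
  exists y' z', [/\ simple_pair y' z', rnorm (y - y') < eps & rnorm (z - z') < eps].

Lemma extension_graph_lin a y z y' z' : extension_graph y z -> extension_graph y' z' ->
  extension_graph (a *: y + y') (a *: z + z').
Proof.
move=> h h' eps eps0; have c0 : 0 < rnorm a + 1 by rewrite ltr_wpDl ?rnorm_ge0.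
have [y1 [z1 [s1 hy1 hz1]]] := h _ (divr_gt0 eps0 (mulr_gt0 (ltr0Sn R 1) c0)).
have [y2 [z2 [s2 hy2 hz2]]] := h' _ (divr_gt0 eps0 (ltr0Sn R 1)).
have aux (u u1 v v1 : L) : rnorm (u - u1) < eps / (2 * (rnorm a + 1)) ->
    rnorm (v - v1) < eps / 2 -> rnorm (a *: u + v - (a *: u1 + v1)) < eps.
  move=> hu hv; rewrite opprD addrACA -scalerBr.
  apply: le_lt_trans (rnormD _ _) _; rewrite rnormZ.
  have : (rnorm a + 1) * rnorm (u - u1) < eps / 2.
    by rewrite mulrC -ltr_pdivlMr// -mulrA -invfM.
  have := rnorm_ge0 (u - u1); lra.
exists (a *: y1 + y2), (a *: z1 + z2); split; [exact: simple_pair_lin|exact: aux..].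
Qed.

Lemma extension_graph_contr y z : extension_graph y z -> rnorm z <= rnorm y.
Proof.
move=> h; apply/ler_addgt0Pr => eps eps0; have e2 : 0 < eps / 2 by rewrite divr_gt0.
have [y' [z' [/simple_pair_contr s hy hz]]] := h _ e2.
have := rnorm_triangle z z' 0; have := rnorm_triangle y' y 0.
by rewrite !subr0 (rnormB y'); lra.
Qed.

Lemma extension_graph_unique y z z' : extension_graph y z -> extension_graph y z' -> z = z'.
Proof.
move=> h h'; apply/eqP; rewrite -subr_eq0; apply/eqP/rnorm0_eq0/le_anti.
rewrite rnorm_ge0 andbT -[leRHS](@rnorm0 _ L).
have := extension_graph_contr (extension_graph_lin (-1) h' h).
by rewrite !scaleN1r addNr addrC.
Qed.

Lemma extension_graph_total (Lc : forall u : L^nat, rcauchy u -> exists a, rcvg u a) y :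
  exists z, extension_graph y z.
Proof.
have e0 n : 0 < (2^-1 : R) ^+ n by rewrite exprn_gt0.
have [u hu] := choice (fun n => simple_pair_dense y (e0 n)).
have [v hv] := choice hu.
have uv n : rnorm (v n - v n.+1) <= 2 * 2^-1 ^+ n.
  have [s1 h1] := hv n; have [s2 h2] := hv n.+1.
  have := simple_pair_contr (simple_pair_lin (-1) s2 s1).
  rewrite !scaleN1r addrC (addrC (- u _)) => h; apply: le_trans h _.
  apply: le_trans (rnorm_triangle _ y _) _; rewrite rnormB exprS in h2 *.
  have := e0 n; lra.
have [z vz] := geometric_cvg Lc (ler0n R 2) uv.
exists z => eps eps0; have [N1 hN1] := exprV2_lt eps0; have [N2 hN2] := vz _ eps0.
exists (u (maxn N1 N2)), (v (maxn N1 N2)).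
have [s h] := hv (maxn N1 N2); split => //.
  by apply: lt_trans h _; apply: hN1; exact: leq_maxl.
by rewrite rnormB; apply: hN2; exact: leq_maxr.
Qed.

End pairs.

Lemma extension_graph_tensor (X : normedModType R[i]) (f : Lp_space mu q1 R[i]) (x : X) :
  extension_graph (Lp_tensor f x) (Lp_tensor (T q1 f) x).
Proof.
move=> eps eps0; have c0 : 0 < rnorm x + 1 by rewrite ltr_wpDl ?rnorm_ge0.
have [f' [g' [s h]]] := simple_pair_dense f (divr_gt0 eps0 c0).
have [E sx] := simple_pair_tensor x s; exists (Lp_tensor f' x), (Lp_tensor g' x).
have tB (k k' : Lp_space mu q1 R[i]) :
    Lp_tensor k x - Lp_tensor k' x = Lp_tensor (k - k') x.
  by rewrite -scaleN1r -Lp_tensorZl -Lp_tensorDl scaleN1r.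
have h' : rnorm (f - f') * rnorm x < eps.
  rewrite ltr_pdivlMr// in h; apply: le_lt_trans h.
  by rewrite ler_wpM2l ?rnorm_ge0// lerDl.
split => //; rewrite tB rnorm_tensor//; apply: le_lt_trans h'.
by rewrite ler_wpM2r ?rnorm_ge0// E -linearB; exact: rnorm_contraction.
Qed.

Lemma contractive_extension_exists (X : completeNormedModType R[i]) :
  exists S : {linear Lp_space mu q1 X -> Lp_space mu q1 X}, is_contractive_extension T S.
Proof.
pose L := Lp_space mu q1 X.
have [F FP] := choice (extension_graph_total (@Lq_complete _ _ _ mu q q1 X)).
have linF : linear F.
  move=> a y y'; apply: extension_graph_unique (FP _) _.
  by apply: extension_graph_lin; exact: FP.
pose S : {linear L -> L} := HB.pack F (GRing.isLinear.Build R[i] L L *:%R F linF).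
exists S; split.
  by apply: opnorm_le => // y; rewrite mul1r; exact: extension_graph_contr.
move=> f x; apply: extension_graph_unique (FP _) _; exact: extension_graph_tensor.
Qed.

End simple_pairs.

(** * The gap for the vector-valued extension *)

Section extension_bounds.
Context {R : realType} {d} {Om : measurableType d}.
Variable mu : {measure set Om -> \bar R}.
Variables (q : R) (q1 : (1 <= q%:E)%E) (q_gt1 : 1 < q).
Variable X : normedModType R[i].
Variables (delta : R) (delta_gt0 : 0 < delta) (uc : uniformly_convex X q delta).

Local Notation L := (Lp_space mu q1 X).
Local Notation N x := (rnorm x `^ q).

Let q0 : 0 < q. Proof. exact: lt_trans ltr01 q_gt1. Qed.

Lemma rnorm_powR_lip (Z : normedModType R[i]) (v w : Z) :
  N v <= N w + q * rnorm v `^ (q - 1) * rnorm (v - w).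
Proof.
have := powR_tangent q_gt1 (rnorm_ge0 w) (rnorm_ge0 v).
have K0 : 0 <= q * rnorm v `^ (q - 1) by rewrite mulr_ge0 ?powR_ge0// ltW.
have : q * rnorm v `^ (q - 1) * rnorm v <=
    q * rnorm v `^ (q - 1) * (rnorm w + rnorm (v - w)).
  by apply: ler_wpM2l => //; have := rnorm_triangle v w 0; rewrite !subr0 addrC.
set K := q * _; rewrite mulrDr mulrBr; lra.
Qed.

Lemma scale_half_double (Z : lmodType R[i]) (v : Z) : 2^-1 *: (v + v) = v.
Proof.
have -> : v + v = (2 : R[i]) *: v by rewrite -[2]/(1 + 1 : R[i]) scalerDl !scale1r.
rewrite scalerA.
by rewrite mulVf ?pnatr_eq0// scale1r.
Qed.

Lemma uniformly_convex_le1 : (exists x : X, x != 0) -> delta <= 1.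
Proof.
move=> [x x0]; have nx : 0 < N x.
  by rewrite powR_gt0// lt_neqAle rnorm_ge0 andbT eq_sym; apply: contra_neq x0 => /rnorm0_eq0.
have := uc x (- x); rewrite subrr scaler0 rnorm0 powR0 ?gt_eqF// add0r rnormN.
rewrite opprK scale_half_double.
move=> h; have : delta * N x <= 1 * N x by lra.
by rewrite ler_pM2r.
Qed.

Section one_operator.
Variables (T : Lp_operator mu) (sm : symmetric_markovian T).
Variables (S : {linear L -> L}) (ST : is_contractive_extension T S).

Lemma extension_contr f : rnorm (S f) <= rnorm f.
Proof.
by rewrite -[leRHS]mul1r; apply: opnorm_bound => //; case: ST.
Qed.

Lemma two_point_extension f g :
  N (2^-1 *: (g + S f)) + delta * N (2^-1 *: (f - S g)) <= 2^-1 * (N f + N g).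
Proof.
pose K (r : R) := q * r `^ (q - 1).
have K0 r : 0 <= K r by rewrite mulr_ge0 ?powR_ge0// ltW.
set a := 2^-1 *: (g + S f); set b := 2^-1 *: (f - S g).
(* Local Lipschitz constants of the q-th power. The last two are taken at norm + 1 because they come
   from the approximants f' and g', at distance below 1. *)
pose C := K (rnorm a) + delta * K (rnorm b) + K (rnorm f + 1) + K (rnorm g + 1).
have C0 : 0 <= C.
  have := K0 (rnorm a); have := mulr_ge0 (ltW delta_gt0) (K0 (rnorm b)).
  have := K0 (rnorm f + 1); have := K0 (rnorm g + 1); rewrite /C; lra.
have C1 : 0 < C + 1 by rewrite ltr_wpDl.
apply/ler_addgt0Pr => eta eta0; pose e := Num.min 1 (eta / (C + 1)).
have e0 : 0 < e by rewrite lt_min ltr01 divr_gt0.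
have [f' [Sf' [sf hf]]] := simple_pair_dense T f e0.
have [g' [Sg' [sg hg]]] := simple_pair_dense T g e0.
have Ef := extension_simple_pair ST sf; have Eg := extension_simple_pair ST sg.
have half (u v u' v' : L) : rnorm (u - u') < e -> rnorm (v - v') < e ->
    rnorm (2^-1 *: (u + v) - 2^-1 *: (u' + v')) <= e.
  move=> hu hv; rewrite -scalerBr rnormZ rnormV rnormC_nat opprD addrACA.
  rewrite mulrC ler_pdivrMr//; apply: le_trans (rnormD _ _) _; lra.
have SB (u u' : L) : rnorm (u - u') < e -> rnorm (S u - S u') < e.
  by move=> h; rewrite -linearB; exact: le_lt_trans (extension_contr _) h.
have ha : rnorm (a - 2^-1 *: (g' + Sf')) <= e by apply: half => //; rewrite -Ef SB.
have hb : rnorm (b - 2^-1 *: (f' - Sg')) <= e.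
  by apply: half => //; rewrite -Eg -opprD rnormN SB.
have KN (u u' : L) : rnorm (u - u') <= e -> N u <= N u' + K (rnorm u) * e.
  move=> h; apply: le_trans (rnorm_powR_lip u u') _; rewrite lerD2l.
  exact: (ler_wpM2l (K0 _) h).
have KN' (u u' : L) : rnorm (u - u') < e -> N u' <= N u + K (rnorm u + 1) * e.
  move=> h; have h1 : e <= 1 by rewrite ge_min lexx.
  have hu : rnorm u' <= rnorm u + 1.
    have := rnorm_triangle u' u 0; rewrite !subr0 (rnormB u'); lra.
  apply: le_trans (KN u' u _) _; first by rewrite rnormB ltW.
  rewrite lerD2l ler_pM2r//; apply: ler_wpM2l; first exact: ltW.
  apply: ge0_ler_powR => //; rewrite ?nnegrE ?rnorm_ge0//; first by rewrite subr_ge0 ltW.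
  by rewrite addr_ge0 ?rnorm_ge0.
have main : N (2^-1 *: (g' + Sf')) + delta * N (2^-1 *: (f' - Sg')) <= 2^-1 * (N f' + N g').
  move: sf sg {Ef Eg ha hb hf hg} => [I [A [x [fA -> ->]]]] [J [B [y [fB -> ->]]]].
  by apply: two_point_simple => //; exact: ltW.
have h1 := KN _ _ ha; have h2 := ler_wpM2l (ltW delta_gt0) (KN _ _ hb).
have h3 := KN' _ _ hf; have h4 := KN' _ _ hg.
have Ce : C * e <= eta.
  apply: (@le_trans _ _ ((C + 1) * e)); first by rewrite ler_pM2r// lerDl.
  by rewrite mulrC -ler_pdivlMr// ge_min lexx orbT.
have k3 := mulr_ge0 (K0 (rnorm f + 1)) (ltW e0).
have k4 := mulr_ge0 (K0 (rnorm g + 1)) (ltW e0).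
rewrite /C !mulrDl in Ce; rewrite mulrDr mulrA in h2; clear -h1 h2 h3 h4 main Ce k3 k4.
lra.
Qed.

(** Take g = S f and F = |f|. If |f - S^2 f| exceeded (2 - 2e) F, then |S f| >= (1 - 2e) F, and the
    tangent bounds with q e = delta/3 would push F^q (1 - 2 delta/3) + 2 delta F^q (1 - delta/3)
    below F^q, although it exceeds F^q by delta (4/3 - 2 delta/3) F^q. *)
Lemma extension_far f : delta <= 1 ->
  rnorm (f - S (S f)) <= (2 - 2 * (delta / (3 * q))) * rnorm f.
Proof.
move=> d1; have := two_point_extension f (S f).
rewrite scale_half_double.
rewrite rnormZ rnormV rnormC_nat.
set D := rnorm (f - _); rewrite [2^-1 * D]mulrC.
set F := rnorm f; set s := rnorm (S f).
have Ds : D <= F + s.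
  apply: le_trans (rnorm_triangle f 0 _) _; rewrite subr0 sub0r rnormN lerD2l.
  exact: extension_contr.
have [F0 s0] : 0 <= F /\ 0 <= s by split; exact: rnorm_ge0.
set e := delta / (3 * q); have qe : q * e = delta / 3 by rewrite /e; field; rewrite gt_eqF.
have e0 : 0 <= e by rewrite divr_ge0 ?mulr_ge0// ltW.
have e3 : e <= 1 / 3.
  rewrite /e ler_pdivrMr ?mulr_gt0//; have := q_gt1; lra.
move=> main; rewrite leNgt; apply/negP => hD.
have Fpos : 0 < F.
  rewrite lt_neqAle F0 andbT eq_sym; apply/negP => /eqP Fz.
  have : s <= 0 by rewrite -Fz; exact: extension_contr.
  by rewrite Fz mulr0 in hD; rewrite Fz in Ds; lra.
have FN : 0 < F `^ q by exact: powR_gt0.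
have tan c : 0 <= c -> F `^ q * (1 + q * (c - 1)) <= (c * F) `^ q.
  move=> c0; have := powR_tangent q_gt1 (mulr_ge0 c0 F0) F0.
  apply: le_trans; rewrite le_eqVlt; apply/orP; left; apply/eqP.
  have := powR_mulr_pred q_gt1 F0; set Z := F `^ (q - 1) => <-; ring.
have hs : (1 - 2 * e) * F <= s by lra.
have hu : (1 - e) * F <= D / 2 by lra.
have ps : F `^ q * (1 + q * (1 - 2 * e - 1)) <= s `^ q.
  apply: le_trans (tan _ _) _; first by lra.
  by rewrite (powR_inj_le q1) ?mulr_ge0//; lra.
have pu : F `^ q * (1 + q * (1 - e - 1)) <= (D / 2) `^ q.
  apply: le_trans (tan _ _) _; first by lra.
  by rewrite (powR_inj_le q1) ?mulr_ge0// ?rnorm_ge0//; lra.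
have E1 : q * (1 - 2 * e - 1) = - (2 * (delta / 3)) by rewrite -qe; ring.
have E2 : q * (1 - e - 1) = - (delta / 3) by rewrite -qe; ring.
rewrite {}E1 in ps; rewrite {}E2 in pu.
have pu' := ler_wpM2l (ltW delta_gt0) pu.
have : 0 < F `^ q * (delta * (4 / 3 - 2 * delta / 3)).
  by rewrite mulr_gt0// mulr_gt0//; lra.
have -> : F `^ q * (delta * (4 / 3 - 2 * delta / 3)) =
    F `^ q * (1 + - (2 * (delta / 3))) + 2 * (delta * (F `^ q * (1 + - (delta / 3)))) - F `^ q.
  by field.
clear -main ps pu'; lra.
Qed.

End one_operator.

End extension_bounds.

(** * The extended diffusion semigroup *)

Section diffusion_extension.
Context {R : realType} {d} {Om : measurableType d}.
Variable mu : {measure set Om -> \bar R}.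
Variables (T : R -> Lp_operator mu) (sds : symmetric_diffusion_semigroup T).
Variables (q : R) (q1 : (1 <= q%:E)%E) (q_ge2 : 2 <= q).
Variable X : normedModType R[i].
Local Notation L := (Lp_space mu q1 X).
Variables (TX : R -> {linear L -> L}).
Hypothesis TXP : forall t, 0 < t -> is_contractive_extension (T t) (TX t).

Let q_gt1 : 1 < q. Proof. by move: q_ge2; lra. Qed.
Let q0 : 0 < q. Proof. by move: q_ge2; lra. Qed.
Let sm t (t0 : 0 < t) := sds_markovian sds t0.

(** Tensors inherit the law from the scalar semigroup; contractivity carries it from simple
    functions to their closure. *)
Lemma extension_mul s t y : 0 < s -> 0 < t -> TX s (TX t y) = TX (s + t) y.
Proof.
move=> s0 t0; have st0 : 0 < s + t by exact: addr_gt0.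
apply/eqP; rewrite -subr_eq0; apply/eqP/rnorm0_eq0/le_anti; rewrite rnorm_ge0 andbT.
apply/ler_addgt0Pr => eta eta0; rewrite add0r.
have [y' [z' [[I [A [x [fA yE _]]]] h]]] := simple_pair_dense (T s) y (divr_gt0 eta0 (ltr0Sn R 1)).
have E : TX s (TX t y') = TX (s + t) y'.
  rewrite yE /comb !linear_sum; apply: eq_bigr => i _.
  by rewrite !(proj2 (TXP _)) ?(sds_mul sds).
have -> : TX s (TX t y) - TX (s + t) y = TX s (TX t (y - y')) - TX (s + t) (y - y').
  rewrite (linearB (TX t)) (linearB (TX s)) (linearB (TX (s + t))) E.
  by rewrite opprB addrA subrK.
apply: le_trans (rnormD _ _) _; rewrite rnormN.
have c1 := extension_contr (TXP s0) (TX t (y - y')).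
have c2 := extension_contr (TXP t0) (y - y').
have c3 := extension_contr (TXP st0) (y - y'); lra.
Qed.

Lemma L2_ind_cvg0 A (eta : R) : 0 < eta -> exists2 r : R, 0 < r &
  forall t, 0 < t < r -> rnorm (T t le12 (ind mu le12 A) - ind mu le12 A) < eta.
Proof.
move=> eta0; have /cvgrPdist_lt/(_ eta%:C) := @sds_cvg _ _ _ _ _ sds (ind mu le12 A).
rewrite ltcR => /(_ eta0) /nbhs_ballP[r /= r0 h]; exists r => // t /andP[t0 tr].
have := h t; rewrite /ball /= sub0r normrN gtr0_norm// => /(_ tr t0).
by rewrite rnormE ltcR rnormB.
Qed.

Lemma rnorm_le_L2 (f : Lp_space mu q1 R[i]) (g : Lp_space mu le12 R[i]) :
  (\forall w \ae mu, rnorm (Lp_val f w) <= 1 /\ Lp_val f w = Lp_val g w) ->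
  rnorm f `^ q <= rnorm g ^+ 2.
Proof.
move=> fg; have hf := modular_Lp f; have hg := @modular_Lp _ _ _ mu 2%:R le12 _ g.
have : (modular mu q (Lp_val f) <= modular mu 2%:R (Lp_val g))%E.
  apply: ae_ge0_le_integral => //.
  - by move=> w _; rewrite lee_fin powR_ge0.
  - exact/measurable_rnorm_powR/Lp_val_meas.
  - by move=> w _; rewrite lee_fin powR_ge0.
  - exact/measurable_rnorm_powR/Lp_val_meas.
  apply: filterS fg => w [a1 <-] _; rewrite lee_fin.
  move: (rnorm_ge0 (Lp_val f w)) a1; set a := rnorm _ => a0 a1.
  have [->|an0] := eqVneq a 0; first by rewrite !powR0// gt_eqF.
  by rewrite ger_powR // lt_neqAle eq_sym an0 a0.
by rewrite hf hg lee_fin powR_mulrn ?rnorm_ge0.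
Qed.

(* As |T_t 1_A - 1_A| <= 1 and 2 <= q, its L_q norm is controlled by its L_2 norm. *)
Lemma rnorm_ind_diff t A : 0 < t -> finite_meas mu A ->
  rnorm (T t q1 (ind mu q1 A) - ind mu q1 A) `^ q <=
  rnorm (T t le12 (ind mu le12 A) - ind mu le12 A) ^+ 2.
Proof.
move=> t0 fA; apply: rnorm_le_L2.
have b1 : \forall w \ae mu, ind_image (T t) A w <= 1.
  have h := @ind_image_sum _ _ _ mu _ (sm t0) unit (fun=> A) (fun=> fA).
  apply: filterS (h _) => [w|w]; first by rewrite big_const card_unit /= addr0.
  by rewrite big_const card_unit /= addr0 indicE; case: (_ \in _).
have D p (p1 : (1 <= p)%E) : \forall w \ae mu,
    Lp_val (T t p1 (ind mu p1 A) - ind mu p1 A) w = (ind_image (T t) A w - \1_A w)%:C.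
  have h1 := Lp_val_ind_image (sm t0) p1 fA; have h2 := Lp_val_ind p1 fA.
  apply: filterS (filterI (Lp_valB (T t p1 (ind mu p1 A)) (ind mu p1 A)) (filterI h1 h2)).
  by move=> w [-> [-> ->]]; rewrite rmorphB.
apply: filterS (filterI b1 (filterI (D _ q1) (D _ le12))) => w [h [-> ->]]; split=> //.
have h0 := ind_image_ge0 (T t) A w.
by rewrite rnormC indicE; case: (_ \in _); rewrite ler_norml/=; lra.
Qed.

(** Strong continuity is given on L_2. It reaches indicators in L_q through [rnorm_ind_diff], then
    simple functions by linearity, then every y by density. *)
Lemma extension_cvg0 y (eta : R) : 0 < eta -> exists2 r : R, 0 < r &
  forall t, 0 < t < r -> rnorm (TX t y - y) < eta.
Proof.
pose P z := forall eta : R, 0 < eta -> exists2 r : R, 0 < r &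
  forall t, 0 < t < r -> rnorm (TX t z - z) < eta.
have PD u v : P u -> P v -> P (u + v).
  move=> hu hv e e0; have e2 : 0 < e / 2 by rewrite divr_gt0.
  have [r1 r10 h1] := hu _ e2; have [r2 r20 h2] := hv _ e2.
  exists (Num.min r1 r2); first by rewrite lt_min r10.
  move=> t /andP[t0]; rewrite lt_min => /andP[t1 t2].
  have {}h1 : rnorm (TX t u - u) < e / 2 by rewrite h1// t0.
  have {}h2 : rnorm (TX t v - v) < e / 2 by rewrite h2// t0.
  rewrite linearD opprD addrACA; apply: le_lt_trans (rnormD _ _) _.
  by rewrite [e]splitr ltrD.
have PI A x : finite_meas mu A -> P (Lp_tensor (ind mu q1 A) x).
  move=> fA e e0; have c0 : 0 < rnorm x + 1 by rewrite ltr_wpDl ?rnorm_ge0.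
  have ec0 := divr_gt0 e0 c0; have sq0 : 0 < Num.sqrt ((e / (rnorm x + 1)) `^ q).
    by rewrite sqrtr_gt0 powR_gt0.
  have [r r0 h] := L2_ind_cvg0 A sq0; exists r => // t /andP[t0 tr].
  have {}h := h t; rewrite t0 tr in h; have {h} h := h isT.
  rewrite (proj2 (TXP t0)); set f := ind mu q1 A.
  have -> : Lp_tensor (T t q1 f) x - Lp_tensor f x = Lp_tensor (T t q1 f - f) x.
    by rewrite -scaleN1r -Lp_tensorZl -Lp_tensorDl scaleN1r.
  rewrite rnorm_tensor//; set n := rnorm (_ - _).
  have : n < e / (rnorm x + 1).
    rewrite ltNge -(powR_inj_le q1) ?rnorm_ge0 ?(ltW ec0)// -ltNge.
    apply: le_lt_trans (rnorm_ind_diff t0 fA) _.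
    rewrite -[ltRHS]sqr_sqrtr ?powR_ge0// ltrXn2r ?rnorm_ge0//.
  rewrite ltr_pdivlMr//; apply: le_lt_trans.
  by apply: ler_wpM2l; rewrite ?rnorm_ge0// lerDl.
move: y eta; suff : forall y, P y by [].
move=> y e e0; have e3 : 0 < e / 3 by rewrite divr_gt0.
have [y' [z' [[I [A [x [fA yE _]]]] hy]]] := simple_pair_dense (T 1) y e3.
have : P y'.
  rewrite yE /comb; apply: (big_ind P) => //.
  - by move=> e' e'0; exists 1 => // t _; rewrite linear0 subr0 rnorm0.
  - by move=> i _; exact: PI.
move=> /(_ _ e3)[r r0 h]; exists r => // t tr; have /andP[t0 _] := tr.
have {}h := h t tr; have c := extension_contr (TXP t0) (y - y').
have t1 := rnorm_triangle (TX t y) (TX t y') y.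
have t2 := rnorm_triangle (TX t y') y' y.
rewrite -linearB in t1; rewrite (rnormB y') in t2; lra.
Qed.

Variables (delta : R) (delta_gt0 : 0 < delta) (uc : uniformly_convex X q delta).
Hypothesis X_neq0 : exists x : X, x != 0.

Lemma extension_contraction_semigroup : contraction_semigroup TX (delta / (3 * q)).
Proof.
have d1 := uniformly_convex_le1 q_gt1 uc X_neq0.
split.
- rewrite divr_gt0 ?mulr_gt0//= ler_pdivrMr ?mulr_gt0// mul1r; move: q_ge2; lra.
- by move=> t y t0; exact: extension_contr (TXP t0) y.
- by move=> s t y; exact: extension_mul.
- exact: extension_cvg0.
- move=> t y t0; have t2 : 0 < t / 2 by rewrite divr_gt0.
  by rewrite {1}[t]splitr -extension_mul//; exact: (extension_far q_gt1 delta_gt0 uc (sm t2) (TXP t2)).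
Qed.

End diffusion_extension.

(** * Numerical constants *)

Section constants.
Context {R : realType} (q delta : R).
Hypotheses (q2 : 2 <= q) (delta01 : 0 < delta <= 1).
Local Notation e := (delta / (3 * q)).
Local Notation r := (q / delta).

Let q0 : 0 < q. Proof. by move: q2; lra. Qed.
Let d0 : 0 < delta. Proof. by case/andP: delta01. Qed.

Lemma ratio_ge1 : 1 <= r.
Proof. by rewrite ler_pdivlMr// mul1r; case/andP: delta01; move: q2; lra. Qed.

Lemma ratio_inv : 18 / e = 54 * r. Proof. by field; rewrite !gt_eqF. Qed.

(** [ang] is 1 + 54 r <= 55 r < 60 r. Strictness puts the closed sector of the statement, apart from
    0, inside the open sector of holomorphy. *)
Lemma sector_angle_gt : (64 * 60)^-1 * (delta / q) < sector_angle e.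
Proof.
rewrite /sector_angle /ang ratio_inv -[delta / q]invf_div -invfM.
by rewrite ltf_pV2 ?posrE; have := ratio_ge1; lra.
Qed.

(** The estimates above are linear and quadratic in the ratio r; the logarithmic factor enters
    through this inequality. *)
Lemma one_le_log : 1 <= 1 + ln r.
Proof. by rewrite lerDl ln_ge0// ratio_ge1. Qed.

Lemma ext_bound_le : 2 * ext_bound e <= 2 * 192 * 54 * (r * (1 + ln r)).
Proof.
rewrite /ext_bound ratio_inv; have r1 := ratio_ge1.
have : r * 1 <= r * (1 + ln r) by rewrite ler_wpM2l ?one_le_log//; lra.
lra.
Qed.

(** The constant at k = 1 is 192 K (1 + K) 2! with K = 54 r and 1 + K <= 55 r. *)
Lemma diff_const_le : diff_const e 1 <= 192 * 54 * 110 * (q ^+ 2 / delta ^+ 2 * (1 + ln r)).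
Proof.
rewrite /diff_const ratio_inv expr1 -expr_div_n; have r1 := ratio_ge1.
have : r ^+ 2 * 1 <= r ^+ 2 * (1 + ln r) by rewrite ler_wpM2l ?one_le_log ?sqr_ge0.
rewrite -[2`!%:R]/(2 : R); move: (r ^+ 2 * (1 + ln r)) => Z; nra.
Qed.

End constants.

Theorem corollary4p16 (R : realType) :
  exists c C1 C2 : R, [/\ 0 < c, 0 < C1, 0 < C2 &
  forall (q delta : R) (q1 : (1 <= q%:E)%E) (X : completeNormedModType R[i])
    (d : measure_display) (Om : measurableType d)
    (mu : {sigma_finite_measure set Om -> \bar R}) (T : R -> Lp_operator mu),
  2 <= q -> 0 < delta -> (exists x : X, x != 0) ->
  uniformly_convex X q delta ->
  symmetric_diffusion_semigroup T ->
  let Y := Lp_space mu q1 X in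
  (exists TX : R -> {linear Y -> Y},
    forall t, 0 < t -> is_contractive_extension (T t) (TX t)) /\
  (forall TX : R -> {linear Y -> Y},
    (forall t, 0 < t -> is_contractive_extension (T t) (TX t)) ->
    (exists (eta : R) (Tz : R[i] -> {linear Y -> Y}),
      [/\ c * (delta / q) < eta,
          bounded_holomorphic_semigroup eta Tz,
          forall t, 0 < t -> Tz t%:C =1 TX t &
          forall z, z != 0 -> closed_sector (c * (delta / q)) z ->
            (opnorm (Tz z) <= (C1 * (q / delta * (1 + ln (q / delta))))%:E)%E]) /\
    (exists dTX : R -> {linear Y -> Y},
      (forall t, 0 < t -> is_op_rderive TX t (dTX t)) /\
      (ereal_sup [set opnorm (fun y => t%:C *: dTX t y) | t in [set t : R | 0 < t]%R]
        <= (C2 * (q ^+ 2 / delta ^+ 2 * (1 + ln (q / delta))))%:E)%E))].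

Proof.
exists (64 * 60)^-1, (2 * 192 * 54), (192 * 54 * 110); split; rewrite ?invr_gt0 ?mulr_gt0 ?ltr0n//.
move=> q delta q1 X d Om mu T q2 d0 X0 uc sds Y.
have q_gt1 : 1 < q by lra.
split.
  have ex t : exists S : {linear Y -> Y}, 0 < t -> is_contractive_extension (T t) S.
    have [t0|t0] := pselect (0 < t); last by exists idfun.
    have [S SP] := contractive_extension_exists q1 q_gt1 (sds_markovian sds t0) X.
    by exists S.
  by have [TX TXP] := choice ex; exists TX.
move=> TX TXP; have d1 := uniformly_convex_le1 q_gt1 uc X0.
have d01 : 0 < delta <= 1 by rewrite d0.
have sg := extension_contraction_semigroup sds q2 TXP d0 uc X0.
have Yc (u : nat -> Y) : rcauchy u -> exists a, rcvg u a by exact: Lq_complete.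
split.
  exists (sector_angle (delta / (3 * q))), (complex_ext sg Yc); split.
  - exact: sector_angle_gt.
  - exact: complex_ext_bhs.
  - by move=> t t0 y; exact: complex_ext_real.
  - move=> z _ _; apply: le_trans (opnorm_le _ (complex_ext_bound sg Yc z)) _.
      by have := ext_bound_ge1 sg; lra.
    by rewrite lee_fin ext_bound_le.
have [dT dTP] := sg_rderive sg Yc; exists dT; split; first by move=> t /dTP[].
apply: ge_ereal_sup => _ [t /= t0 <-]; have [_] := dTP t t0; move=> /le_trans; apply.
by rewrite lee_fin diff_const_le.
Qed.
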